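(* Let $\beta\in(0,2]$ and $L>0$ be known, let $K$ satisfy the kernel assumptions, let $\alpha\in(0,1)$, run FOMT with $C_n(\alpha)=-2\log(\alpha/2)h_n^{-1}$, and let $\Delta_{\beta,n}=(\log n/n)^{(\beta-\lceil\beta\rceil+1)/(2\beta+1)}$. Then there exist constants $0<c<C<\infty$ depending on $\beta$ such that: (i) $\liminf_{n\to\infty}\inf_{f\in\mathcal F_\beta(C\Delta_{\beta,n})}\mathbb P_f(\Phi=1)\ge1-\alpha$; (ii) for every sequence of tests $\Psi=\Psi_n(Y_1,\dots,Y_n)\in\{0,1\}$ with $\limsup_{n\to\infty}\sup_{f\in H}\mathbb P_f(\Psi=1)\le\alpha$, one has $\limsup_{n\to\infty}\inf_{f\in\mathcal F_\beta(c\Delta_{\beta,n})}\mathbb P_f(\Psi=1)\le\alpha$.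
   Context: Model: for each $n\in\mathbb N$ one observes $Y_i=f(x_i)+\varepsilon_i$, $i\in[n]:=\{1,\dots,n\}$, with $x_i=i/n$, $\varepsilon_i$ i.i.d. $\mathcal N(0,\sigma^2)$ with known $\sigma>0$, and $f:[0,1]\to\mathbb R$ unknown; $\mathbb P_f$ is the law when the regression function is $f$. For $\beta>0,L>0$, $\Sigma(\beta,L)$ is the set of functions $f:[0,1]\to\mathbb R$ with $|f^{(\lceil\beta\rceil-1)}(x)-f^{(\lceil\beta\rceil-1)}(y)|\le L|x-y|^{\beta+1-\lceil\beta\rceil}$ for all $x,y$. $\mathcal M$ is the set of nondecreasing functions on $[0,1]$ and $H=\Sigma(\beta,L)\cap\mathcal M$. For $\delta>0$: if $\beta\in(0,1]$, $\mathcal F_\beta(\delta)=\{f\in\Sigma(\beta,L):\max_{0\le a<b\le1}(f(a)-f(b))\ge\delta\}$; if $\beta\in(1,2]$, $\mathcal F_\beta(\delta)=\{f\in\Sigma(\beta,L):\min_{x\in[0,1]}f'(x)\le-\delta\}$. Kernel assumptions: $K$ nonnegative, $\int K=1$, supported in $[-1,1]$; constants $K_{\min},K_{\max},\Delta>0$ with $K_{\min}\mathbf 1_{\{|u|\le\Delta\}}\le K(u)\le K_{\max}$; $K$ Lipschitz with constant $L_K$; $K$ symmetric. $\mu_2=\int K^2$. LPE of order $k=\lceil\beta\rceil-1$, bandwidth $h$: $U(u)=(1,u,\dots,u^k/k!)^\top$, $\mathcal B_{nx}=\frac1{nh}\sum_iU(\tfrac{x_i-x}h)U(\tfrac{x_i-x}h)^\top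 K(\tfrac{x_i-x}h)$, $\hat f_n(x)=\sum_iW_{ni}(x)Y_i$, $W_{ni}(x)=\frac1{nh}U(0)^\top\mathcal B_{nx}^{-1}U(\tfrac{x_i-x}h)K(\tfrac{x_i-x}h)$. $\lambda_0>0$: smallest eigenvalue of $\mathcal B_{nx}$ is $\ge\lambda_0$ for all $x$ and large $n$ (paper: $\lambda_0=1/2$ for $\beta\le1$, $0.0228$ for $\beta\in(1,2]$). Constants: $C_*=8K_{\max}/\lambda_0$, $q_1=C_*L/(\lceil\beta\rceil-1)!$, $q_2=16\sigma^2\lceil\beta\rceil\mu_2/\lambda_0^2$, $C_h=(q_2/(4q_1^2\beta))^{1/(2\beta+1)}$, $h_n=C_h(\log n/n)^{1/(2\beta+1)}$; $L_1=\sqrt e(K_{\max}+L_K)$, $L_2=2\lceil\beta\rceil K_{\max}+\lceil\beta\rceil L_K$, $\widetilde C_*=L_1/(8L_2)+\sqrt eK_{\max}/\lambda_0$, $W=\max(4C_*^2,4\widetilde C_*^2)$. FOMT: $N_{\max}=\frac{40}{\log2}C_n(\alpha)(\log n)^2$; for $i<j$, $T_{i,j}=\hat f_n(x_i)-\hat f_n(x_j)$ (bandwidth $h_n$), $C_{n,\alpha,i,j}=\sigma\sqrt{-2\log(\alpha/N_{\max})W}\,n^{-1/2}h_n^{-3/2}(\tfrac{8L_2}{\lambda_0}|x_i-x_j|\wedge h_n)$, $D_{n,\beta,i,j}=0$ if $x_i,x_j\in[h_n,1-h_n]$ and $(\tfrac{16K_{\max}}{\lambda_0}\vee2)Lh_n^\beta$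 otherwise, $\Phi_{i,j}=\mathbf 1\{T_{i,j}\ge C_{n,\alpha,i,j}+D_{n,\beta,i,j}\}$. $\Phi$: repeat $C_n(\alpha)$ times: draw $I\sim\mathrm{Unif}([n])$; if $I\le n-1$, repeat $\lceil20\log n\rceil$ times: for $k=0,\dots,\lceil\log_2(n-I)\rceil$ draw $J_k\sim\mathrm{Unif}\{1,\dots,\min(2^k,n-I)\}$, if $\Phi_{I,I+J_k}=1$ output $\Phi=1$ and stop; if $I\ge2$, repeat $\lceil20\log n\rceil$ times: for $k=0,\dots,\lceil\log_2(I-1)\rceil$ draw $J'_k\sim\mathrm{Unif}\{1,\dots,\min(2^k,I-1)\}$, if $\Phi_{I-J'_k,I}=1$ output $\Phi=1$ and stop. Otherwise output $\Phi=0$. All draws independent of each other and of the data. *)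

(* Defs.v *)
From HB Require Import structures.
From mathcomp Require Import all_boot all_order all_algebra.
From mathcomp Require Import all_classical all_reals all_analysis.
Set Implicit Arguments. Unset Strict Implicit. Unset Printing Implicit Defensive.
Import Order.TTheory GRing.Theory Num.Theory.
Import numFieldNormedType.Exports.
Local Open Scope classical_set_scope.
Local Open Scope ring_scope.

(* Function classes on [0,1] (beta in (0,2], so ceil(beta)-1 \in {0,1}) *)

Definition in01 {R : realType} (x : R) : bool := (0 <= x) && (x <= 1).

Definition derivative_on01 {R : realType} (f g : R -> R) : Prop :=
  forall x : R, in01 x ->
    (fun y => (y - x)^-1 * (f y - f x)) @ within [set y : R | in01 y] (x^')
      --> g x.

Definition HolderClass {R : realType} (beta L : R) (f : R -> R) : Prop :=
  if beta <= 1 then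
    forall x y, in01 x -> in01 y -> `|f x - f y| <= L * (`|x - y| `^ beta)
  else exists g : R -> R, derivative_on01 f g /\
    forall x y, in01 x -> in01 y -> `|g x - g y| <= L * (`|x - y| `^ (beta - 1)).

Definition nondecr01 {R : realType} (f : R -> R) : Prop :=
  forall x y, in01 x -> in01 y -> x <= y -> f x <= f y.

Definition Hclass {R : realType} (beta L : R) (f : R -> R) : Prop :=
  HolderClass beta L f /\ nondecr01 f.

Definition Fclass {R : realType} (beta L delta : R) (f : R -> R) : Prop :=
  HolderClass beta L f /\
  if beta <= 1 then
    (exists a b : R, [/\ 0 <= a, a < b, b <= 1 & delta <= f a - f b])
  else
    (exists g : R -> R, derivative_on01 f g /\
       exists x : R, in01 x /\ g x <= - delta).

Definition kernel_assumptions {R : realType} (K : R -> R)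
    (Kmin Kmax Delta LK : R) : Prop :=
  (forall u : R, 0 <= K u) /\
  (\int[lebesgue_measure]_u (K u)%:E = 1)%E /\
  (forall u : R, 1 < `|u| -> K u = 0) /\
  (0 < Kmin /\ 0 < Kmax /\ 0 < Delta) /\
  (forall u : R, Kmin * (if `|u| <= Delta then 1 else 0) <= K u /\ K u <= Kmax) /\
  (forall u v : R, `|K u - K v| <= LK * `|u - v|) /\
  (forall u : R, K (- u) = K u).

Record setting (R : realType) := Setting {
  s_beta : R; s_L : R; s_sigma : R; s_K : R -> R;
  s_Kmax : R; s_LK : R; s_lambda0 : R; s_alpha : R }.

Section Procedure.
Variables (R : realType) (s : setting R).
Local Notation beta := (s_beta s).
Local Notation L := (s_L s).
Local Notation sigma := (s_sigma s).
Local Notation K := (s_K s).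
Local Notation Kmax := (s_Kmax s).
Local Notation LK := (s_LK s).
Local Notation lambda0 := (s_lambda0 s).
Local Notation alpha := (s_alpha s).

Definition cbeta : int := Num.ceil beta.
Definition cbetaR : R := (cbeta)%:~R.
Definition kord : nat := `|cbeta - 1|%N.

Definition xpt (n i : nat) : R := i%:R / n%:R.

(* Local polynomial estimator of order kord with bandwidth h *)
Definition Uvec (u : R) : 'cV[R]_(kord.+1) :=
  \col_(l < kord.+1) (u ^+ l / (l`!)%:R).

Definition Bmat (n : nat) (h x : R) : 'M[R]_(kord.+1) :=
  (n%:R * h)^-1 *: \sum_(i < n)
     (K ((xpt n i.+1 - x) / h) *:
        (Uvec ((xpt n i.+1 - x) / h) *m (Uvec ((xpt n i.+1 - x) / h))^T)).

Definition Wn (n : nat) (h x : R) (i : nat) : R :=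
  (n%:R * h)^-1 *
  ((Uvec 0)^T *m invmx (Bmat n h x) *m Uvec ((xpt n i - x) / h)) ord0 ord0 *
  K ((xpt n i - x) / h).

Definition fhat (n : nat) (h : R) (Y : seq R) (x : R) : R :=
  \sum_(1 <= i < n.+1) Wn n h x i * nth 0 Y i.-1.

Definition mu2 : R := fine (\int[lebesgue_measure]_u ((K u) ^+ 2)%:E)%E.
Definition Cstar : R := 8 * Kmax / lambda0.
Definition q1 : R := Cstar * L / (kord`!)%:R.
Definition q2 : R := 16 * sigma ^+ 2 * cbetaR * mu2 / lambda0 ^+ 2.
Definition Ch : R := (q2 / (4 * q1 ^+ 2 * beta)) `^ ((2 * beta + 1)^-1).
Definition hn (n : nat) : R :=
  Ch * (ln n%:R / n%:R) `^ ((2 * beta + 1)^-1).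
Definition L1 : R := Num.sqrt (expR 1) * (Kmax + LK).
Definition L2 : R := 2 * cbetaR * Kmax + cbetaR * LK.
Definition Ctilde : R := L1 / (8 * L2) + Num.sqrt (expR 1) * Kmax / lambda0.
Definition Wconst : R := Num.max (4 * Cstar ^+ 2) (4 * Ctilde ^+ 2).

Definition Cn (n : nat) : R := - 2 * ln (alpha / 2) / hn n.
Definition Nmax (n : nat) : R := 40 / ln 2 * Cn n * (ln n%:R) ^+ 2.

Definition Tstat (n : nat) (Y : seq R) (i j : nat) : R :=
  fhat n (hn n) Y (xpt n i) - fhat n (hn n) Y (xpt n j).

Definition Ccrit (n i j : nat) : R :=
  sigma * Num.sqrt (- 2 * ln (alpha / Nmax n) * Wconst) *
  (n%:R `^ (- 2^-1)) * (hn n `^ (- (3 / 2))) *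
  Num.min (8 * L2 / lambda0 * `|xpt n i - xpt n j|) (hn n).

Definition Dterm (n i j : nat) : R :=
  if [&& hn n <= xpt n i, xpt n i <= 1 - hn n,
         hn n <= xpt n j & xpt n j <= 1 - hn n]
  then 0
  else Num.max (16 * Kmax / lambda0) 2 * L * (hn n `^ beta).

Definition Phi_ij (n : nat) (Y : seq R) (i j : nat) : bool :=
  Ccrit n i j + Dterm n i j <= Tstat n Y i j.

(* ---- the randomized multiple test FOMT ----
   All random draws are independent uniform draws on finite sets,
   independent of the data. Given the data Y, we compute the exact
   probability (over the draws) that the procedure outputs Phi = 1. *)

Definition unif_prob (m : nat) (P : nat -> bool) : R :=
  (m%:R)^-1 * \sum_(1 <= j < m.+1) (P j)%:R.

Definition reps (n : nat) : nat := `|Num.ceil (20 * ln (n%:R : R))|%N.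
Definition rounds (n : nat) : nat := `|Num.ceil (Cn n)|%N.

(* probability that one inner repetition on the right of I rejects nothing:
   for k = 0..ceil(log2 (n-I)), J_k ~ Unif{1..min(2^k, n-I)} *)
Definition right_pass_ok (n : nat) (Y : seq R) (I : nat) : R :=
  \prod_(0 <= k < (up_log 2 (n - I)).+1)
     unif_prob (minn (2 ^ k) (n - I)) (fun J => ~~ Phi_ij n Y I (I + J)).

Definition left_pass_ok (n : nat) (Y : seq R) (I : nat) : R :=
  \prod_(0 <= k < (up_log 2 (I - 1)).+1)
     unif_prob (minn (2 ^ k) (I - 1)) (fun J => ~~ Phi_ij n Y (I - J) I).

Definition round_ok_given (n : nat) (Y : seq R) (I : nat) : R :=
  (if (I <= n - 1)%N then right_pass_ok n Y I ^+ reps n else 1) *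
  (if (2 <= I)%N then left_pass_ok n Y I ^+ reps n else 1).

Definition round_ok (n : nat) (Y : seq R) : R :=
  (n%:R)^-1 *
  \sum_(1 <= I < n.+1) round_ok_given n Y I.

Definition FOMT_prob (n : nat) (Y : seq R) : R :=
  1 - round_ok n Y ^+ rounds n.

End Procedure.

(* The law of the data: Y_i = m_i + eps_i, eps_i iid N(0, sigma^2).
   gauss_expect sigma [:: m_1; ...; m_n] g = E[g(Y_1,...,Y_n)]
   (iterated Lebesgue integrals against the Gaussian densities). *)
Fixpoint gauss_expect {R : realType} (sigma : R) (ms : seq R)
    (g : seq R -> \bar R) : \bar R :=
  match ms with
  | [::] => g [::]
  | m :: ms' => (\int[lebesgue_measure]_y
       ((normal_pdf m sigma y)%:E *
        gauss_expect sigma ms' (fun ys => g (y :: ys))))%E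
  end.

(* P_f-expectation of a [0,1]-valued statistic of the sample of size n *)
Definition Pf {R : realType} (sigma : R) (n : nat) (f : R -> R)
    (g : seq R -> R) : \bar R :=
  gauss_expect sigma [seq f (i%:R / n%:R) | i <- iota 1 n] (fun ys => (g ys)%:E).

(* Borel sigma-algebra on R^n (samples are sequences of length n):
   generated by measurable boxes *)
Definition boxes {R : realType} (n : nat) : set (set (seq R)) :=
  [set A | exists B : nat -> set R, (forall i, measurable (B i)) /\
     A = [set ys | size ys = n /\ forall i, (i < n)%N -> B i (nth 0 ys i)]].

Definition measurable_test {R : realType} (n : nat) (T : seq R -> bool) : Prop :=
  <<s boxes n >> [set ys | size ys = n /\ T ys].

Definition Delta_rate {R : realType} (beta : R) (n : nat) : R :=
  (ln n%:R / n%:R) `^ ((beta - (Num.ceil beta)%:~R + 1) / (2 * beta + 1)).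

(* Main.v *)
(* Power. The drop of f forces two blocks of about n h design points such that f decreases by at least 2 v, v of order
   h^beta, from every point of the first block to every point of the second. By Chernoff's bound all estimates are
   simultaneously within a constant times h^beta of their means. On this event every pair with a drop of at least v is
   rejected, and any index between the members of a cross-block pair forms such a pair with one of them. If 2^k is the
   dyadic scale of the distance, one of the two members therefore sees a rejection with probability at least 1/4 in its
   k-th draw. So all indices of one of the blocks are detected, and a block has mass at least h under the draw of I.

   Lower bound. Le Cam's method with null function 0 and about 1/(2r) disjointly supported smooth bumps of height
   c r^beta and width r, r = (log n / n)^(1/(2 beta + 1)): for small c the chi-square distance of the uniform mixture
   from the null is at most 4 r n^(3 c^2 / sigma^2), which tends to 0. *)
Require Import Defs.
From HB Require Import structures.
From mathcomp Require Import all_boot all_order all_algebra.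
From mathcomp Require Import all_classical all_reals all_analysis.
From mathcomp Require Import measurable_realfun ring lra zify.
Import Order.TTheory GRing.Theory Num.Theory.
Import numFieldNormedType.Exports HBNNSimple.
Local Open Scope classical_set_scope.
Local Open Scope ring_scope.
Set Implicit Arguments. Unset Strict Implicit. Unset Printing Implicit Defensive.

(** The expectation is an iterated Lebesgue integral, and [FOMT_prob] is never shown to be
    measurable. Integrals of nonnegative functions are monotone without measurability, so the power
    is bounded below through a measurable minorant built from Chernoff's exponentials of linear
    forms, whose expectations are explicit. Additivity does need measurability, and that of every
    partial integral.

    The bandwidth satisfies h^(2 beta + 1) = Ch^(2 beta + 1) ln n / n, so the noise level sqrt(ln n
    / (n h)), the bias and the critical values are all of order h^beta, and only constants remain to
    be tracked. The error [alpha] is spent in two halves, one on the noise event and one on the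
    random draws: -2 ln(alpha / 2) / h rounds miss with probability at most alpha / 2 if one round
    succeeds with probability at least h / 2.

    The order of the estimator is 0 or 1, so its Gram matrix has size one or two and the eigenvalue
    bound controls the weights by explicit inversion. *)

(** * Iterated Gaussian integrals *)

(* Joint measurability in the parameter and n coordinates: the parameter space absorbs the coordinates one by one, so that the class is stable under partial integration. *)
Fixpoint seq_measurable {R : realType} (n : nat) {d d' : measure_display}
    (T : measurableType d) (U : sigmaRingType d') (g : T -> seq R -> U) : Prop :=
  match n with
  | 0 => measurable_fun setT (fun t => g t [::])
  | n'.+1 => @seq_measurable R n' _ _ (T * R)%type U
               (fun ty ys => g ty.1 (ty.2 :: ys))
  end.
Arguments seq_measurable {R} n {d d' T U} g.

Section SeqMeasurable.
Context {R : realType}.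



Lemma measurable_fun_comp d d1 d2 (T : measurableType d) (T1 : measurableType d1)
    (U : sigmaRingType d2) (f : T1 -> U) (g : T -> T1) :
  measurable_fun setT f -> measurable_fun setT g -> measurable_fun setT (f \o g).
Proof. by move=> mf mg; apply: (measurable_comp _ _ mf mg). Qed.

Lemma seq_measurable_ext n d d' (T : measurableType d) (U : sigmaRingType d')
    (g h : T -> seq R -> U) :
  (forall t ys, size ys = n -> g t ys = h t ys) ->
  seq_measurable n g -> seq_measurable n h.
Proof.
elim: n d T g h => [|n IH] d T g h gh /=.
  by move=> mg; rewrite (_ : (fun t => h t [::]) = fun t => g t [::])//;
    apply/funext => t; rewrite gh.
by apply: IH => ty ys sys; rewrite gh//= sys.
Qed.

Lemma seq_measurable_comp n d d' d'' (T : measurableType d) (U : sigmaRingType d')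
    (V : sigmaRingType d'') (F : U -> V) (g : T -> seq R -> U) :
  (forall d0 (T0 : measurableType d0) (a : T0 -> U),
     measurable_fun setT a -> measurable_fun setT (F \o a)) ->
  seq_measurable n g -> seq_measurable n (fun t ys => F (g t ys)).
Proof.
move=> mF; elim: n d T g => [|n IH] d T g /= mg; last exact: IH mg.
exact: mF mg.
Qed.

Lemma seq_measurable_param n d d' (T : measurableType d) (U : sigmaRingType d')
    (f : T -> U) :
  measurable_fun setT f -> seq_measurable n (fun t (_ : seq R) => f t).
Proof.
elim: n d T f => [|n IH] d T f mf //=.
apply: (IH _ _ (fun ty : T * R => f ty.1)).
exact: measurable_fun_comp mf measurable_fst.
Qed.

Lemma seq_measurable_cst n d d' (T : measurableType d) (U : sigmaRingType d')
    (c : U) : seq_measurable n (fun (_ : T) (_ : seq R) => c).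
Proof. exact: (@seq_measurable_param n d d' T U (fun=> c) (@measurable_cst _ _ _ _ _ _)). Qed.

Lemma seq_measurable_nth n d (T : measurableType d) i :
  seq_measurable n (fun (_ : T) (ys : seq R) => nth 0 ys i : R).
Proof.
elim: n d T i => [|n IH] d T i /=; first by rewrite nth_nil; exact: measurable_cst.
case: i => [|i] /=; last exact: IH.
by apply: (@seq_measurable_param n _ _ _ _ snd); exact: measurable_snd.
Qed.

Lemma seq_measurable_op2 n d d1 d2 d' (T : measurableType d)
    (U1 : sigmaRingType d1) (U2 : sigmaRingType d2) (V : sigmaRingType d')
    (F : U1 -> U2 -> V) (g : T -> seq R -> U1) (h : T -> seq R -> U2) :
  (forall d0 (T0 : measurableType d0) (a : T0 -> U1) (b : T0 -> U2),
     measurable_fun setT a -> measurable_fun setT b ->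
     measurable_fun setT (fun t => F (a t) (b t))) ->
  seq_measurable n g -> seq_measurable n h ->
  seq_measurable n (fun t ys => F (g t ys) (h t ys)).
Proof.
move=> mF; elim: n d T g h => [|n IH] d T g h /= mg mh; last exact: IH mg mh.
exact: mF.
Qed.

Lemma seq_measurableD n d (T : measurableType d) (g h : T -> seq R -> \bar R) :
  seq_measurable n g -> seq_measurable n h ->
  seq_measurable n (fun t ys => g t ys + h t ys)%E.
Proof. by apply: seq_measurable_op2 => *; exact: emeasurable_funD. Qed.

Lemma seq_measurableM n d (T : measurableType d) (g h : T -> seq R -> \bar R) :
  seq_measurable n g -> seq_measurable n h ->
  seq_measurable n (fun t ys => g t ys * h t ys)%E.
Proof. by apply: seq_measurable_op2 => *; exact: emeasurable_funM. Qed.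

Lemma seq_measurable_EFin n d (T : measurableType d)
    (g : T -> seq R -> R) :
  seq_measurable n g -> seq_measurable n (fun t ys => (g t ys)%:E).
Proof. by apply: seq_measurable_comp => d0 T0 a ma; exact/measurable_EFinP. Qed.

Lemma seq_measurable_sum n d (T : measurableType d) (I : Type) (r : seq I)
    (g : I -> T -> seq R -> R) :
  (forall i, seq_measurable n (g i)) ->
  seq_measurable n (fun t ys => \sum_(i <- r) g i t ys : R).
Proof.
move=> mg; elim: r => [|i r IH].
  apply: seq_measurable_ext (seq_measurable_cst n T (0 : R)).
  by move=> t ys _; rewrite big_nil.
apply: (@seq_measurable_ext n _ _ _ _ (fun t ys => g i t ys + \sum_(i <- r) g i t ys)).
  by move=> t ys _; rewrite big_cons.
by apply: seq_measurable_op2 => // *; exact: measurable_funD.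
Qed.

End SeqMeasurable.

Section GaussExpect.
Context {R : realType} (sigma : R).
Local Open Scope ereal_scope.
Local Notation GE := (gauss_expect sigma).


(* No measurability: the integral of a nonnegative function is a supremum over simple functions. *)
Lemma ge0_le_integral_nomeas d (T : measurableType d) (mu : {measure set T -> \bar R})
    (f g : T -> \bar R) : (forall x, 0 <= f x) -> (forall x, f x <= g x) ->
  \int[mu]_x f x <= \int[mu]_x g x.
Proof.
move=> f0 fg; have g0 x : 0 <= g x by exact: le_trans (f0 x) (fg x).
rewrite !ge0_integralTE//; apply: ereal_sup_le => _ [h hf <-].
exists h => // x.
exact: le_trans (hf x) (fg x).
Qed.

Lemma gauss_expect_ge0 ms g :
  (forall ys, size ys = size ms -> 0 <= g ys) -> 0 <= GE ms g.
Proof.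
elim: ms g => [|m ms IH] g g0 /=; first exact: g0.
apply: integral_ge0 => y _; apply: mule_ge0; first by rewrite lee_fin normal_pdf_ge0.
by apply: IH => ys sys; apply: g0; rewrite /= sys.
Qed.

Lemma gauss_expect_le ms g h : (forall ys, size ys = size ms -> 0 <= g ys) ->
  (forall ys, size ys = size ms -> g ys <= h ys) -> GE ms g <= GE ms h.
Proof.
elim: ms g h => [|m ms IH] g h g0 gh /=; first exact: gh.
apply: ge0_le_integral_nomeas => y.
  apply: mule_ge0; first by rewrite lee_fin normal_pdf_ge0.
  by apply: gauss_expect_ge0 => ys sys; apply: g0; rewrite /= sys.
apply: lee_wpmul2l; first by rewrite lee_fin normal_pdf_ge0.
by apply: IH => ys sys; [apply: g0|apply: gh]; rewrite /= sys.
Qed.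

Lemma gauss_expect_eq ms g h :
  (forall ys, size ys = size ms -> g ys = h ys) -> GE ms g = GE ms h.
Proof.
elim: ms g h => [|m ms IH] g h gh /=; first exact: gh.
apply: eq_integral => y _; congr (_ * _).
by apply: IH => ys sys; apply: gh; rewrite /= sys.
Qed.

(** The parameter space has to vary in the induction: Tonelli asks for joint measurability in the
    parameter and the first coordinate, which is the same statement for [T * R]. *)
Lemma measurable_gauss_expect ms d (T : measurableType d) (g : T -> seq R -> \bar R) :
  (forall t ys, 0 <= g t ys) -> seq_measurable (size ms) g ->
  measurable_fun setT (fun t => GE ms (g t)).
Proof.
elim: ms d T g => [|m ms IH] d T g g0 //= mg.
pose F (ty : T * R) : \bar R :=
  (normal_pdf m sigma ty.2)%:E * GE ms (fun ys => g ty.1 (ty.2 :: ys)).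
apply: (measurable_fun_fubini_tonelli_F (m2 := lebesgue_measure) F).
  apply: emeasurable_funM; last exact: (IH _ _ (fun ty ys => g ty.1 (ty.2 :: ys))).
  apply/measurable_EFinP.
  exact: (measurableT_comp (measurable_normal_pdf m sigma) measurable_snd).
move=> ty; apply: mule_ge0; first by rewrite lee_fin normal_pdf_ge0.
by apply: gauss_expect_ge0 => ys _; exact: g0.
Qed.

Lemma measurable_gauss_expect_section ms d (T : measurableType d)
    (g : T -> seq R -> \bar R) t :
  (forall t ys, 0 <= g t ys) -> seq_measurable (size ms).+1 g ->
  measurable_fun setT (fun y : R => GE ms (fun ys => g t (y :: ys))).
Proof.
move=> g0 /= mg.
have := measurable_gauss_expect (fun ty ys => g0 ty.1 (ty.2 :: ys)) mg.
move=> mG; have mp : measurable_fun setT (fun y : R => (t, y)).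
  exact: measurable_fun_pair.
exact: (measurable_fun_comp mG mp).
Qed.

Lemma measurable_gauss_integrand m ms d (T : measurableType d)
    (g : T -> seq R -> \bar R) t :
  (forall t ys, 0 <= g t ys) -> seq_measurable (size ms).+1 g ->
  measurable_fun setT (fun y : R =>
    (normal_pdf m sigma y)%:E * GE ms (fun ys => g t (y :: ys))).
Proof.
move=> g0 mg; apply: emeasurable_funM; last exact: measurable_gauss_expect_section.
by apply/measurable_EFinP; exact: measurable_normal_pdf.
Qed.

(** A parameter is carried along because additivity of the outer integral needs the inner
    expectation to be measurable in the coordinate already fixed. *)
Lemma gauss_expectD_param ms d (T : measurableType d) (g h : T -> seq R -> \bar R) t :
  (forall t ys, 0 <= g t ys) -> (forall t ys, 0 <= h t ys) ->
  seq_measurable (size ms) g -> seq_measurable (size ms) h ->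
  GE ms (fun ys => g t ys + h t ys) = GE ms (g t) + GE ms (h t).
Proof.
elim: ms d T g h t => [|m ms IH] d T g h t g0 h0 //= mg mh.
rewrite -ge0_integralD//=.
- apply: eq_integral => y _.
  rewrite (IH _ _ (fun ty ys => g ty.1 (ty.2 :: ys)) (fun ty ys => h ty.1 (ty.2 :: ys)) (t, y))//.
  by rewrite ge0_muleDr//; apply: gauss_expect_ge0.
- move=> y _; apply: mule_ge0; first by rewrite lee_fin normal_pdf_ge0.
  exact: gauss_expect_ge0.
- exact: measurable_gauss_integrand.
- move=> y _; apply: mule_ge0; first by rewrite lee_fin normal_pdf_ge0.
  exact: gauss_expect_ge0.
- exact: measurable_gauss_integrand.
Qed.

Lemma gauss_expectZ_param ms d (T : measurableType d) (g : T -> seq R -> \bar R) (c : R) t :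
  (0 <= c)%R -> (forall t ys, 0 <= g t ys) -> seq_measurable (size ms) g ->
  GE ms (fun ys => c%:E * g t ys) = c%:E * GE ms (g t).
Proof.
move=> c0; elim: ms d T g t => [|m ms IH] d T g t g0 //= mg.
rewrite -ge0_integralZl//=.
- apply: eq_integral => y _.
  rewrite (IH _ _ (fun ty ys => g ty.1 (ty.2 :: ys)) (t, y))//.
  by rewrite muleCA.
- exact: measurable_gauss_integrand.
- move=> y _; apply: mule_ge0; first by rewrite lee_fin normal_pdf_ge0.
  exact: gauss_expect_ge0.
Qed.

Definition seqm n (g : seq R -> \bar R) := seq_measurable n (fun (_ : unit) ys => g ys).

Lemma gauss_expectD ms g h :
  (forall ys, 0 <= g ys) -> (forall ys, 0 <= h ys) ->
  seqm (size ms) g -> seqm (size ms) h ->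
  GE ms (fun ys => g ys + h ys) = GE ms g + GE ms h.
Proof.
move=> g0 h0 mg mh.
exact: (@gauss_expectD_param _ _ _ (fun _ : unit => g) (fun _ => h) tt).
Qed.

Lemma gauss_expectZ ms g (c : R) : (0 <= c)%R -> (forall ys, 0 <= g ys) ->
  seqm (size ms) g -> GE ms (fun ys => c%:E * g ys) = c%:E * GE ms g.
Proof.
by move=> c0 g0 mg; exact: (@gauss_expectZ_param _ _ _ (fun _ : unit => g) _ tt).
Qed.

End GaussExpect.

(** * Measurability of tests *)

Section SeqMeasurableTest.
Context {R : realType}.

Lemma seq_measurable_op (I : Type) n d d1 d' (T : measurableType d)
    (U : sigmaRingType d1) (V : sigmaRingType d')
    (F : (I -> U) -> V) (g : I -> T -> seq R -> U) :
  (forall d0 (T0 : measurableType d0) (a : I -> T0 -> U),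
     (forall i, measurable_fun setT (a i)) ->
     measurable_fun setT (fun t => F (fun i => a i t))) ->
  (forall i, seq_measurable n (g i)) ->
  seq_measurable n (fun t ys => F (fun i => g i t ys)).
Proof.
move=> mF; elim: n d T g => [|n IH] d T g /= mg; first exact: mF.
by apply: (IH _ _ (fun i (ty : T * R) ys => g i ty.1 (ty.2 :: ys))).
Qed.

Lemma seq_measurable_exists n d (T : measurableType d) (g : nat -> T -> seq R -> bool) :
  (forall i, seq_measurable n (g i)) ->
  seq_measurable n (fun t ys => `[< exists i, g i t ys >]).
Proof.
move=> mg; apply: (@seq_measurable_op nat n _ _ _ T _ _ (fun b : nat -> bool => `[< exists i, b i >]) g _ mg) => d0 T0 a ma.
apply: (measurable_fun_bool true).
rewrite setTI (_ : _ @^-1` _ = \bigcup_i (a i @^-1` [set true])).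
  by apply: bigcup_measurable => i _; rewrite -[X in measurable X]setTI; exact: ma.
by apply/seteqP; split => [t /asboolP[i ai]|t [i _ ai]];
  [exists i|apply/asboolP; exists i].
Qed.

Lemma seq_measurable_neg n d (T : measurableType d) (g : T -> seq R -> bool) :
  seq_measurable n g -> seq_measurable n (fun t ys => ~~ g t ys).
Proof.
apply: seq_measurable_comp => d0 T0 a ma.
exact: measurable_neg.
Qed.

(** Induction over the generated sigma-algebra. Only samples of length [n] are compared in
    [seq_measurable_ext], so the length condition in [boxes] disappears. *)
Lemma seq_measurable_set n d (T : measurableType d) (A : set (seq R)) :
  <<s boxes n >> A -> seq_measurable n (fun (_ : T) ys => `[< A ys >]).
Proof.
move: A; apply: smallest_sub.
  split => /=.
  - apply: seq_measurable_ext (@seq_measurable_cst R n _ _ T _ false) => t ys _.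
    by apply/esym/asboolP.
  - move=> A mA; apply: seq_measurable_ext (seq_measurable_neg mA) => t ys _.
    by rewrite -asbool_neg; congr asbool; rewrite propeqE; split => // -[].
  - move=> F mF; apply: seq_measurable_ext (seq_measurable_exists mF) => t ys _.
    congr asbool; rewrite propeqE; split => [[i /asboolP Fi]|[i _ Fi]].
      by exists i.
    by exists i; apply/asboolP.
move=> _ /= [B [mB ->]].
(* A box is the negation of a countable disjunction of coordinate failures. Indices from [n] on
   never fail, so the disjunction may run over all of [nat]. *)
have mb i : seq_measurable n
    (fun (_ : T) ys => ~~ `[< (i < n)%N -> B i (nth 0 ys i) >]).
  apply: seq_measurable_neg.
  have [i_n|i_n] := boolP (i < n)%N; last first.
    by apply: seq_measurable_ext (@seq_measurable_cst R n _ _ T _ true) => t ys _;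
      apply/esym/asboolP.
  apply: (@seq_measurable_comp R n _ _ _ _ _ _ (fun x : R => `[< true -> B i x >])
    (fun _ ys => nth 0 ys i)); last exact: seq_measurable_nth.
  move=> d0 T0 a ma; apply: (measurable_fun_bool true); rewrite setTI.
  rewrite (_ : _ @^-1` _ = a @^-1` B i); last first.
    by apply/seteqP; split => [t /asboolP Bt|t Bt] /=; [exact: Bt|exact/asboolP].
  by rewrite -[X in measurable X]setTI; exact: ma.
have := seq_measurable_neg (seq_measurable_exists mb).
apply: seq_measurable_ext => t ys sys.
rewrite -asbool_neg; congr asbool; rewrite propeqE; split.
  move=> nex; split => // i i_n; apply: contrapT => nB; apply: nex; exists i.
  by apply/asboolPn => /(_ i_n).
by move=> [_ H] [i /asboolPn]; apply; exact: H.
Qed.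

Lemma seq_measurable_test n d (T : measurableType d) (Psi : seq R -> bool) :
  measurable_test n Psi -> seq_measurable n (fun (_ : T) ys => ((Psi ys)%:R : R)%:E).
Proof.
move=> /(seq_measurable_set T) mP.
apply: seq_measurable_EFin.
apply: (@seq_measurable_comp R n _ _ _ T _ _ (fun b : bool => b%:R : R) (fun _ ys => Psi ys)).
  move=> d0 T0 a ma; apply: (measurable_fun_comp _ ma).
  by move=> _ Y _.
apply: seq_measurable_ext mP => t ys sys.
by apply/asboolP/idP => [[]//|].
Qed.

End SeqMeasurableTest.

(** * Exponential moments and change of measure *)

Section GaussExp.
Context {R : realType} (sigma : R).
Hypothesis sigma_gt0 : 0 < sigma.
Local Notation GE := (gauss_expect sigma).
Definition linform n (a : nat -> R) (ys : seq R) : R := \sum_(i < n) a i * nth 0 ys i.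

Lemma seq_measurable_expR_linform n k d (T : measurableType d) (a : nat -> R) (b : R) :
  seq_measurable n (fun (_ : T) ys => (expR (linform k a ys + b))%:E).
Proof.
apply: seq_measurable_EFin.
apply: (@seq_measurable_comp R n _ _ _ T _ _ (fun x : R => expR (x + b)) (fun _ ys => linform k a ys)).
  move=> d0 T0 f mf; apply: (measurable_fun_comp _ mf).
  apply: (measurable_fun_comp (@measurable_expR R)).
  exact: measurable_funD.
apply: seq_measurable_sum => i.
apply: (@seq_measurable_comp R n _ _ _ T _ _ (fun x : R => a i * x) (fun _ ys => nth 0 ys i)).
  by move=> d0 T0 f mf; exact: measurable_funM.
exact: seq_measurable_nth.
Qed.

(** Completing the square: exponential tilting of a Gaussian density shifts its mean. *)
Lemma normal_pdf_expR m a y :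
  normal_pdf m sigma y * expR (a * y) =
  expR (a * m + sigma ^+ 2 * a ^+ 2 / 2) * normal_pdf (m + sigma ^+ 2 * a) sigma y.
Proof.
have s0 : sigma != 0 by rewrite gt_eqF.
rewrite !normal_pdfE//.
rewrite mulrC mulrCA -mulrA /normal_fun -!expRD [RHS]mulrCA -expRD; congr (_ * expR _).
by field.
Qed.

(** The additive constant [b] makes the induction close: it absorbs the term of the coordinate that
    is held fixed in the inner integral. *)
Lemma gauss_expect_expR ms (a : nat -> R) (b : R) :
  GE ms (fun ys => (expR (linform (size ms) a ys + b))%:E) =
  (expR (\sum_(i < size ms) (a i * nth 0 ms i + sigma ^+ 2 * a i ^+ 2 / 2) + b))%:E.
Proof.
elim: ms a b => [|m ms IH] a b /=.
  by rewrite /linform /= !big_ord0.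
under eq_integral => y _.
  under [X in gauss_expect _ _ X]funext => ys.
    rewrite /linform big_ord_recl /= [in X in X + b]addrC -addrA.
    over.
  rewrite (IH (fun i => a i.+1) (a 0 * y + b)) -EFinM.
  rewrite addrCA expRD mulrA normal_pdf_expR mulrAC -expRD EFinM.
  over.
rewrite ge0_integralZl//=; last 2 first.
- by apply/measurable_EFinP; exact: measurable_normal_pdf.
- by move=> y _; rewrite lee_fin normal_pdf_ge0.
rewrite integral_normal_pdf mule1; congr ((expR _)%:E).
by rewrite big_ord_recl /= addrA.
Qed.

Lemma gauss_expect_cst ms (c : R) : 0 <= c -> GE ms (fun=> c%:E) = c%:E.
Proof.
move=> c0.
have := @gauss_expectZ R sigma ms (fun ys => (expR (linform (size ms) (fun=> 0) ys + 0))%:E) c c0.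
rewrite gauss_expect_expR.
have E ys : linform (size ms) (fun=> 0) ys = 0 :> R.
  by rewrite /linform big1// => i _; rewrite mul0r.
rewrite big1 ?addr0 ?expR0; last by move=> i _; rewrite expr0n /= !mul0r mulr0 mul0r addr0.
rewrite mule1 => H; rewrite -[RHS]H; first last.
- exact: seq_measurable_expR_linform.
- by move=> ys; rewrite lee_fin expR_ge0.
by apply: gauss_expect_eq => ys _; rewrite E addr0 expR0 mule1.
Qed.

(** Measurability of the sum is proved alongside, because the next use of additivity requires it. *)
Lemma gauss_expect_sum (I : Type) (r : seq I) ms (g : I -> seq R -> \bar R) :
  (forall i ys, (0 <= g i ys)%E) -> (forall i, seqm (size ms) (g i)) ->
  (GE ms (fun ys => \sum_(i <- r) g i ys) = \sum_(i <- r) GE ms (g i) /\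
  seqm (size ms) (fun ys => \sum_(i <- r) g i ys))%E.
Proof.
move=> g0 mg; elim: r => [|i r [IH1 IH2]].
  rewrite big_nil; split.
    rewrite -[RHS](@gauss_expect_cst ms 0)//.
    by apply: gauss_expect_eq => ys _; rewrite big_nil.
  apply: seq_measurable_ext (@seq_measurable_cst R _ _ _ unit _ 0%E).
  by move=> t ys _; rewrite big_nil.
have E : (fun ys => \sum_(j <- i :: r) g j ys)%E = (fun ys => g i ys + \sum_(j <- r) g j ys)%E.
  by apply/funext => ys; rewrite big_cons.
split.
  rewrite big_cons E gauss_expectD ?IH1//.
  by move=> ys; exact: sume_ge0.
rewrite E; exact: (seq_measurableD (mg i) IH2).
Qed.

(** No measurability of [F] is available. Additivity is applied to the measurable minorant
    [Num.max 0 (c - h ys)] of [F] instead. *)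
Lemma gauss_expect_markov ms (F h : seq R -> R) (c : R) : 0 <= c ->
  (forall ys, size ys = size ms -> 0 <= F ys) -> (forall ys, 0 <= h ys) ->
  seqm (size ms) (fun ys => (h ys)%:E) ->
  (forall ys, size ys = size ms -> c <= F ys + h ys) ->
  (c%:E <= GE ms (fun ys => (F ys)%:E) + GE ms (fun ys => (h ys)%:E))%E.
Proof.
move=> c0 F0 h0 mh cFh.
pose g ys := Num.max 0 (c - h ys).
have mg : seqm (size ms) (fun ys => (g ys)%:E).
  have gE : (fun (_ : unit) ys => (g ys)%:E) = (fun _ ys => maxe 0 (c%:E - (h ys)%:E))%E.
    by apply/funext => t; apply/funext => ys; rewrite /g EFin_max.
  rewrite /seqm gE.
  apply: (@seq_measurable_comp R _ _ _ _ unit _ _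
    (fun x : \bar R => maxe 0 (c%:E - x))%E (fun _ ys => (h ys)%:E) _ mh) => d0 T0 a ma.
  apply: measurable_maxe; first exact: measurable_cst.
  by apply: emeasurable_funB => //; exact: measurable_cst.
apply: (@le_trans _ _ (GE ms (fun ys => (g ys)%:E + (h ys)%:E)%E)).
  rewrite -{1}(@gauss_expect_cst ms c)//; apply: gauss_expect_le => ys _.
    by rewrite lee_fin.
  by rewrite -EFinD lee_fin -lerBlDr /g le_max lexx orbT.
rewrite gauss_expectD//; last by move=> ys; rewrite lee_fin /g le_max lexx.
apply: leeD => //; apply: gauss_expect_le => ys sys.
  by rewrite lee_fin /g le_max lexx.
by rewrite lee_fin /g ge_max F0//= lerBlDr cFh.
Qed.

(** Change of measure, one coordinate at a time; the exponential is the likelihood ratio of the law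
    with means [ms] to the centred law. *)
Lemma gauss_expect_shift_param ms d (T : measurableType d) (g : T -> seq R -> \bar R) t :
  (forall t ys, 0 <= g t ys)%E -> seq_measurable (size ms) g ->
  GE ms (g t) = GE (nseq (size ms) 0) (fun ys =>
    (expR (linform (size ms) (fun i => nth 0 ms i / sigma ^+ 2) ys
           - \sum_(i < size ms) nth 0 ms i ^+ 2 / (2 * sigma ^+ 2)))%:E * g t ys)%E.
Proof.
elim: ms d T g t => [|m ms IH] d T g t g0 /= mg.
  by rewrite /linform !big_ord0 subr0 expR0 mul1e.
apply: eq_integral => y _.
rewrite (IH _ _ (fun ty ys => g ty.1 (ty.2 :: ys)) (t, y))//=.
pose c := expR (m / sigma ^+ 2 * y - m ^+ 2 / (2 * sigma ^+ 2)).
have -> : normal_pdf m sigma y = normal_pdf 0 sigma y * c.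
  have s0 : sigma != 0 by rewrite gt_eqF.
  rewrite !normal_pdfE// -mulrA; congr (_ * _).
  rewrite /normal_fun -expRD; congr expR.
  by field.
rewrite EFinM -muleA; congr (_ * _)%E.
pose G (ty : T * R) (ys : seq R) :=
 ((expR (linform (size ms) (fun i => nth 0 ms i / sigma ^+ 2) ys
      - \sum_(i < size ms) nth 0 ms i ^+ 2 / (2 * sigma ^+ 2)))%:E *
       g ty.1 (ty.2 :: ys))%E.
have := @gauss_expectZ_param R sigma (nseq (size ms) 0) _ _ G c (t, y).
rewrite /G /= => <-//.
- apply: gauss_expect_eq => ys _; rewrite muleA -EFinM /c -expRD; congr ((expR _)%:E * _)%E.
  rewrite /linform !big_ord_recl /=; lra.
- exact: expR_ge0.
- by move=> ty ys; rewrite mule_ge0// lee_fin expR_ge0.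
- rewrite size_nseq; apply: seq_measurableM => //; exact: seq_measurable_expR_linform.
Qed.

Lemma gauss_expect_shift ms (g : seq R -> \bar R) :
  (forall ys, 0 <= g ys)%E -> seqm (size ms) g ->
  GE ms g = GE (nseq (size ms) 0) (fun ys =>
    (expR (linform (size ms) (fun i => nth 0 ms i / sigma ^+ 2) ys
           - \sum_(i < size ms) nth 0 ms i ^+ 2 / (2 * sigma ^+ 2)))%:E * g ys)%E.
Proof.
move=> g0 mg.
exact: (@gauss_expect_shift_param ms _ unit (fun=> g) tt).
Qed.

End GaussExp.

(** * The multiple test *)

Section Combinatorics.
Context {R : realType}.

(** After the reflection J -> d - J in the second sum, every distance below [d] is counted at least
    once; [d] itself is counted by [P d]. *)
Lemma count_cover (P Q : nat -> bool) (d : nat) : (0 < d)%N -> P d ->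
  (forall J, (0 < J < d)%N -> P J || Q (d - J)%N) ->
  (d <= \sum_(1 <= J < d.+1) P J + \sum_(1 <= J < d.+1) Q J)%N.
Proof.
case: d => // d _ Pd PQ.
rewrite (big_nat_recr d.+1)//= (big_nat_recr d.+1)//= Pd.
rewrite [X in (_ <= _ + (X + _))%N]big_nat_rev/=.
suff : (d <= \sum_(1 <= J < d.+1) P J + \sum_(1 <= J < d.+1) Q (1 + d.+1 - J.+1))%N by lia.
rewrite -big_split/=; apply: (@leq_trans (\sum_(1 <= J < d.+1) 1)%N).
  by rewrite sum_nat_const_nat muln1 subSS subn0.
rewrite !big_nat; apply: leq_sum => J JI.
have := PQ J; rewrite (_ : 1 + d.+1 - J.+1 = d.+1 - J)%N; last by lia.
by case: (P J) => //=; move=> -> //; lia.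
Qed.

Lemma unif_prob_ge0 m (P : nat -> bool) : 0 <= unif_prob R m P :> R.
Proof. by rewrite mulr_ge0 ?invr_ge0 ?sumr_ge0. Qed.

Lemma unif_probC m (P : nat -> bool) : (0 < m)%N ->
  unif_prob R m (fun J => ~~ P J) = 1 - m%:R^-1 * (\sum_(1 <= J < m.+1) P J)%N%:R :> R.
Proof.
move=> m0; rewrite /unif_prob; apply/eqP; rewrite eq_sym subr_eq -mulrDr natr_sum -big_split/=.
rewrite (eq_bigr (fun=> 1)); last by move=> i _; case: (P i); rewrite ?addr0 ?add0r.
by rewrite sumr_const_nat subSS subn0 mulVf// pnatr_eq0 -lt0n.
Qed.

Lemma unif_prob_le1 m (P : nat -> bool) : unif_prob R m P <= 1 :> R.
Proof.
have [->|m0] := posnP m; first by rewrite /unif_prob invr0 mul0r.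
have E : (fun J => ~~ ~~ P J) = P by apply/funext => J; exact: negbK.
have := @unif_probC m (fun J => ~~ P J) m0; rewrite E => ->.
by rewrite gerBl mulr_ge0.
Qed.

Lemma prod_le_factor (u : nat -> R) (n k : nat) : (k < n)%N ->
  (forall i, 0 <= u i <= 1) -> \prod_(0 <= i < n) u i <= u k.
Proof.
move=> kn u01; rewrite (big_rem k)/= ?mem_index_iota//.
rewrite ler_piMr//; first by case/andP: (u01 k).
elim: (rem _ _) => [|i r IH]; first by rewrite big_nil.
rewrite big_cons; have /andP[a b] := u01 i; apply: mulr_ile1 => //.
by apply: prodr_ge0 => l _; case/andP: (u01 l).
Qed.

Lemma prod_in01 (u : nat -> R) (n : nat) :
  (forall i, 0 <= u i <= 1) -> 0 <= \prod_(0 <= i < n) u i <= 1.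
Proof.
move=> u01; apply/andP; split; first by apply: prodr_ge0 => l _; case/andP: (u01 l).
elim: n => [|n IH]; first by rewrite big_nil.
rewrite big_nat_recr//=; have /andP[a b] := u01 n; apply: mulr_ile1 => //.
by apply: prodr_ge0 => l _; case/andP: (u01 l).
Qed.

Lemma up_log2_lt d : (0 < d)%N -> (2 ^ up_log 2 d <= 2 * d)%N.
Proof.
case: d => [//|[|d]] _; first by rewrite up_log1.
have /andP[+ _] := up_log_bounds (isT : (1 < 2)%N) (isT : (1 < d.+2)%N).
have : (0 < up_log 2 d.+2)%N by rewrite up_log_gt0.
case: (up_log 2 d.+2) => // k _ /= kd; rewrite expnS; lia.
Qed.

Variable s : setting R.
Implicit Types (n i j : nat) (Y : seq R).

(** With d = j - i, [count_cover] shows that one endpoint rejects at no fewer than half of the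
    distances 1..d. At the scale [up_log 2 d] the draw has between d and 2d values, so that endpoint
    rejects with probability at least 1/4. *)
Lemma pass_dichotomy n Y i j : (0 < i)%N -> (i < j)%N -> (j <= n)%N ->
  Phi_ij s n Y i j ->
  (forall z, (i < z < j)%N -> Phi_ij s n Y i z || Phi_ij s n Y z j) ->
  right_pass_ok s n Y i <= 3 / 4 \/ left_pass_ok s n Y j <= 3 / 4.
Proof.
move=> i0 ij jn Pij Pz.
pose d := (j - i)%N; pose k := up_log 2 d.
have d0 : (0 < d)%N by rewrite subn_gt0.
have dk : (d <= 2 ^ k)%N by apply: up_logP.
have kd : (2 ^ k <= 2 * d)%N by exact: up_log2_lt.
pose m1 := minn (2 ^ k) (n - i); pose m2 := minn (2 ^ k) (j - 1).
have dm1 : (d <= m1)%N by rewrite leq_min dk/= /d leq_sub2r.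
have dm2 : (d <= m2)%N by rewrite leq_min dk/= /d leq_sub2l.
have m1d : (m1 <= 2 * d)%N by apply: leq_trans kd; exact: geq_minl.
have m2d : (m2 <= 2 * d)%N by apply: leq_trans kd; exact: geq_minl.
pose P J := Phi_ij s n Y i (i + J); pose Q J := Phi_ij s n Y (j - J) j.
have PQ : (d <= \sum_(1 <= J < d.+1) P J + \sum_(1 <= J < d.+1) Q J)%N.
  apply: count_cover => //; first by rewrite /P subnKC// ltnW.
  move=> J /andP[J0 Jd]; rewrite /P /Q (_ : j - (d - J) = i + J)%N; last by rewrite /d; lia.
  by apply: Pz; rewrite /d in Jd; lia.
have mono (F : nat -> bool) a b : (a <= b)%N ->
    (\sum_(1 <= J < a.+1) F J <= \sum_(1 <= J < b.+1) F J)%N.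
  by move=> ab; rewrite [X in (_ <= X)%N](@big_cat_nat _ _ _ a.+1)//= leq_addr.
have S1 := mono P _ _ dm1; have S2 := mono Q _ _ dm2.
(* If less than a quarter of at most 2d values reject, then fewer than d/2 do. This cannot happen on
   both sides. *)
have key (F : nat -> bool) m : (d <= m)%N -> (m <= 2 * d)%N ->
    3 / 4 < unif_prob R m (fun J => ~~ F J) :> R ->
    (2 * \sum_(1 <= J < m.+1) F J < d)%N.
  move=> dm md; rewrite unif_probC; last by lia.
  have m0 : 0 < m%:R :> R by rewrite ltr0n; lia.
  set S := (\sum_(_ <= _ < _) _)%N => H.
  have : m%:R^-1 * S%:R < 4^-1 :> R by lra.
  rewrite mulrC ltr_pdivrMr// => H'.
  have : (4 * S)%:R < m%:R :> R by rewrite natrM; lra.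
  rewrite ltr_nat; lia.
have [|gt1] := leP (unif_prob R m1 (fun J => ~~ P J) : R) (3 / 4).
  move=> le1; left; apply: le_trans le1.
  apply: (@prod_le_factor (fun k => unif_prob R (minn (2 ^ k) (n - i))
     (fun J => ~~ Phi_ij s n Y i (i + J))) _ k).
    by rewrite ltnS; apply: leq_up_log; rewrite /d leq_sub2r.
  by move=> l; rewrite unif_prob_ge0 unif_prob_le1.
have [|gt2] := leP (unif_prob R m2 (fun J => ~~ Q J) : R) (3 / 4).
  move=> le1; right; apply: le_trans le1.
  apply: (@prod_le_factor (fun k => unif_prob R (minn (2 ^ k) (j - 1))
     (fun J => ~~ Phi_ij s n Y (j - J) j)) _ k).
    by rewrite ltnS; apply: leq_up_log; rewrite /d leq_sub2l.
  by move=> l; rewrite unif_prob_ge0 unif_prob_le1.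
have := key P m1 dm1 m1d gt1; have := key Q m2 dm2 m2d gt2; lia.
Qed.

Lemma right_pass_in01 n Y i : 0 <= right_pass_ok s n Y i <= 1.
Proof. by apply: prod_in01 => k; rewrite unif_prob_ge0 unif_prob_le1. Qed.

Lemma left_pass_in01 n Y i : 0 <= left_pass_ok s n Y i <= 1.
Proof. by apply: prod_in01 => k; rewrite unif_prob_ge0 unif_prob_le1. Qed.

Lemma right_round_in01 n Y i :
  0 <= (if (i <= n - 1)%N then right_pass_ok s n Y i ^+ reps R n else 1) <= 1.
Proof.
case: ifP => _; last by rewrite ler01 lexx.
by have /andP[a b] := right_pass_in01 n Y i; rewrite exprn_ge0//= exprn_ile1.
Qed.

Lemma left_round_in01 n Y i :
  0 <= (if (2 <= i)%N then left_pass_ok s n Y i ^+ reps R n else 1) <= 1.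
Proof.
case: ifP => _; last by rewrite ler01 lexx.
by have /andP[a b] := left_pass_in01 n Y i; rewrite exprn_ge0//= exprn_ile1.
Qed.

Lemma round_ok_given_in01 n Y i : 0 <= round_ok_given s n Y i <= 1.
Proof.
have /andP[a b] := right_round_in01 n Y i; have /andP[c e] := left_round_in01 n Y i.
by rewrite /round_ok_given mulr_ge0//= mulr_ile1.
Qed.

Lemma round_ok_ge0 n Y : 0 <= round_ok s n Y.
Proof.
rewrite /round_ok mulr_ge0// sumr_ge0// => i _.
by case/andP: (round_ok_given_in01 n Y i).
Qed.

Let half_mass (q h : R) : h <= q -> 1 - q * (1 - 1 / 2) <= 1 + - (h / 2).
Proof. by move=> hq; lra. Qed.

Lemma round_ok_le n Y (m p : nat) (q : R) : (0 < n)%N -> (m + p <= n)%N ->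
  (forall i, (m < i <= m + p)%N -> round_ok_given s n Y i <= q) ->
  round_ok s n Y <= 1 - p%:R / n%:R * (1 - q).
Proof.
move=> n0 mpn hq.
have n0R : 0 < n%:R :> R by rewrite ltr0n.
rewrite /round_ok mulrC ler_pdivrMr//.
have -> : (1 - p%:R / n%:R * (1 - q)) * n%:R = n%:R - p%:R * (1 - q).
  by field; rewrite gt_eqF.
rewrite (@big_cat_nat _ _ _ m.+1)//= ?ltnS; last by lia.
rewrite (@big_cat_nat _ _ _ (m + p).+1 m.+1)//= ?ltnS; last by lia.
have one a b : (a <= b)%N -> \sum_(a.+1 <= i < b.+1) round_ok_given s n Y i <= (b - a)%:R.
  move=> ab; rewrite -(subSS a b) -(sumr_const_nat) ; apply: ler_sum => i _.
  by case/andP: (round_ok_given_in01 n Y i).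
have A := one 0%N m (leq0n m); have B := one (m + p)%N n mpn.
have C : \sum_(m.+1 <= i < (m + p).+1) round_ok_given s n Y i <= p%:R * q.
  rewrite [leRHS](_ : _ = \sum_(m.+1 <= i < (m + p).+1) q); last first.
    by rewrite sumr_const_nat subSS addKn mulr_natl.
  rewrite !big_nat; apply: ler_sum => i; rewrite !ltnS => mi; exact: hq.
move: A B; rewrite subn0 natrB// natrD => A B; lra.
Qed.

Lemma FOMT_prob_ge0 n Y : (0 < n)%N -> 0 <= FOMT_prob s n Y.
Proof.
move=> n0; rewrite /FOMT_prob subr_ge0 exprn_ile1// ?round_ok_ge0//.
have := @round_ok_le n Y 0 0 1 n0 isT; rewrite mul0r mul0r subr0; apply.
by move=> i; lia.
Qed.

(** A round draws [I] in the block with probability at least h and then rejects with probability at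
    least 1/2, so it misses with probability at most 1 - h/2 <= exp(-h/2). The number of rounds
    turns this into alpha / 2. *)
Lemma FOMT_prob_ge n Y (m p : nat) : (0 < n)%N -> (m + p <= n)%N ->
  0 < s_alpha s < 1 -> 0 < hn s n -> hn s n <= p%:R / n%:R -> (3 <= reps R n)%N ->
  (forall i, (m < i <= m + p)%N -> round_ok_given s n Y i <= (3 / 4) ^+ reps R n) ->
  1 - s_alpha s / 2 <= FOMT_prob s n Y.
Proof.
move=> n0 mpn /andP[a0 a1].
have a2_gt0 : 0 < s_alpha s / 2 by rewrite divr_gt0.
have a2_le1 : s_alpha s / 2 <= 1 by lra.
move=> h0 hp rep H.
rewrite /FOMT_prob lerD2l lerN2.
(* Three repetitions already suffice: (3/4)^3 = 27/64 < 1/2. *)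
have q2 : (3 / 4) ^+ reps R n <= 1 / 2 :> R.
  apply: (@le_trans _ _ ((3 / 4) ^+ 3)); last by rewrite exprS expr2; lra.
  by apply: ler_wiXn2l => //; lra.
have := round_ok_le n0 mpn (fun i Hi => le_trans (H i Hi) q2) => H1.
have pn : 0 <= p%:R / n%:R :> R by rewrite divr_ge0.
have H2 : round_ok s n Y <= expR (- (hn s n / 2)).
  by apply: le_trans H1 _; apply: le_trans (expR_ge1Dx _); exact: half_mass.
apply: (@le_trans _ _ (expR (- (hn s n / 2)) ^+ rounds s n)).
  by apply: lerXn2r => //; rewrite nnegrE ?round_ok_ge0 ?expR_ge0.
rewrite -expRM_natl -[leRHS]lnK ?posrE//.
rewrite ler_expR.
have C0 : 0 <= Cn s n.
  rewrite /Cn divr_ge0 ?(ltW h0)// mulNr oppr_ge0 pmulr_rle0//.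
  exact: ln_le0.
have : Cn s n <= (rounds s n)%:R.
  by rewrite /rounds natr_absz ger0_norm ?ceil_ge0 ?ceil_ge//; apply: lt_le_trans C0; rewrite ltrN10.
have -> : ln (s_alpha s / 2) = - (hn s n / 2) * Cn s n.
  by rewrite /Cn; field; rewrite gt_eqF.
by move=> Cr; rewrite mulrC; apply: ler_wnM2l => //; rewrite oppr_le0 divr_ge0// ltW.
Qed.

(** If a single index of the first block is missed on its right, [pass_dichotomy] applied to its
    pairs shows that every index of the second block is detected on its left. Otherwise the whole
    first block is detected on its right. *)
Lemma FOMT_prob_blocks n Y (ma mb p : nat) :
  0 < s_alpha s < 1 -> 0 < hn s n -> hn s n <= p%:R / n%:R -> (3 <= reps R n)%N ->
  (ma + p <= mb)%N -> (mb + p <= n)%N ->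
  (forall i j, (ma < i <= ma + p)%N -> (mb < j <= mb + p)%N ->
     Phi_ij s n Y i j /\
     forall z, (i < z < j)%N -> Phi_ij s n Y i z || Phi_ij s n Y z j) ->
  1 - s_alpha s / 2 <= FOMT_prob s n Y.
Proof.
move=> a01 h0 hp rep ab bn H.
have p0 : (0 < p)%N.
  by rewrite lt0n; apply: contraTneq hp => ->; rewrite mul0r -ltNge.
have n0 : (0 < n)%N by lia.
have [[i [iA gti]]|noi] := pselect (exists i, (ma < i <= ma + p)%N /\
    3 / 4 < right_pass_ok s n Y i).
  apply: (@FOMT_prob_ge n Y mb p) => // j jB.
  have [Pij Pz] := H i j iA jB.
  have le : left_pass_ok s n Y j <= 3 / 4.
    have := @pass_dichotomy n Y i j; rewrite leNgt gti /= => D.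
    by case: D => //; lia.
  rewrite /round_ok_given.
  rewrite [in X in _ * X]ifT; last by lia.
  have /andP[x0 x1] := right_round_in01 n Y j.
  have /andP[y0 _] := left_pass_in01 n Y j.
  apply: le_trans (_ : 1 * left_pass_ok s n Y j ^+ reps R n <= _).
    by apply: ler_wpM2r => //; exact: exprn_ge0.
  by rewrite mul1r; apply: lerXn2r => //; rewrite nnegrE; lra.
apply: (@FOMT_prob_ge n Y ma p) => //; first by lia.
move=> i iA.
have le : right_pass_ok s n Y i <= 3 / 4.
  by rewrite leNgt; apply/negP => gti; apply: noi; exists i.
rewrite /round_ok_given ifT; last by lia.
have /andP[x0 x1] := left_round_in01 n Y i.
have /andP[y0 _] := right_pass_in01 n Y i.
apply: le_trans (_ : right_pass_ok s n Y i ^+ reps R n * 1 <= _).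
  by apply: ler_wpM2l => //; exact: exprn_ge0.
by rewrite mulr1; apply: lerXn2r => //; rewrite nnegrE; lra.
Qed.

End Combinatorics.

(** * Local polynomial weights *)

Section Counting.
Context {R : realType}.

Let ge_min_id (a B : R) : Num.min a (B + 1) <= B + 1.
Proof. by rewrite ge_min lexx orbT. Qed.

Lemma count_in_interval (n : nat) (A B : R) : A <= B ->
  \sum_(i < n) ((A <= i.+1%:R <= B)%R : nat)%:R <= B - A + 1.
Proof.
move=> AB.
(* The cap at [B + 1] keeps the bound constant once [k] has passed [B], so the induction survives
   the indices that no longer count. *)
have IHn (k : nat) : \sum_(i < k) ((A <= i.+1%:R <= B)%R : nat)%:R <=
    Num.max 0 (Num.min k.+1%:R (B + 1) - A).
  elim: k => [|k IH]; first by rewrite big_ord0 le_max lexx.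
  rewrite big_ord_recr/=; have [/andP[Ak kB]|_] := boolP (A <= k.+1%:R <= B).
    rewrite le_max; apply/orP; right.
    have : Num.max 0 (Num.min k.+1%:R (B + 1) - A) <= k.+1%:R - A.
      by rewrite ge_max subr_ge0 Ak/= lerD2r ge_min lexx.
    have -> : Num.min k.+2%:R (B + 1) = k.+2%:R.
      by apply/min_idPl; rewrite -natr1 lerD2r.
    move=> /(le_trans IH) {}IH; rewrite -(natr1 k.+1) addrAC.
    exact: lerD.
  rewrite addr0; apply: le_trans IH _.
  rewrite ge_max le_max lexx/=; rewrite le_max; apply/orP; right.
  by rewrite lerD2r le_min !ge_min ler_nat leqnSn/= lexx orbT.
apply: le_trans (IHn n) _; rewrite ge_max; apply/andP; split; first lra.
by rewrite (addrAC B) lerD2r ge_min_id.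
Qed.

Lemma count_near (n : nat) (x h : R) : (0 < n)%N -> 0 < h ->
  \sum_(i < n) ((`|i.+1%:R / n%:R - x| <= h)%R : nat)%:R <= 2 * (n%:R * h) + 1.
Proof.
move=> n0 h0; have n0R : 0 < n%:R :> R by rewrite ltr0n.
have nn : n%:R != 0 :> R by rewrite gt_eqF.
have nh : 0 < n%:R * h by rewrite mulr_gt0.
have := @count_in_interval n (n%:R * (x - h)) (n%:R * (x + h)).
rewrite (_ : _ - _ + 1 = 2 * (n%:R * h) + 1); last by ring.
have -> : (n%:R * (x - h) <= n%:R * (x + h)) = true by rewrite ler_pM2l//; lra.
move=> /(_ isT); rewrite (eq_bigr (fun i : 'I_n => ((`|i.+1%:R / n%:R - x| <= h)%R : nat)%:R))//.
move=> i _; congr (nat_of_bool _)%:R; rewrite ler_norml.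
set y := i.+1%:R / n%:R; have -> : i.+1%:R = n%:R * y by rewrite mulrCA divff ?mulr1.
rewrite !ler_pM2l//; congr (_ && _); apply/idP/idP; lra.
Qed.

End Counting.

(** * Inverting the Gram matrix *)

Section LocalPolynomial.
Context {R : realType}.

Definition Uk (k : nat) (u : R) : 'cV[R]_k.+1 := \col_(l < k.+1) (u ^+ l / (l`!)%:R).

Variables (k n : nat) (u w : 'I_n -> R) (c lambda kmax N : R).
Hypotheses (k1 : (k <= 1)%N) (c0 : 0 < c) (l0 : 0 < lambda) (kmax0 : 0 < kmax).
Hypotheses (w0 : forall i, 0 <= w i) (wmax : forall i, w i <= kmax).
Hypothesis (wsupp : forall i, 1 < `|u i| -> w i = 0).
Hypothesis (cN : c * \sum_(i < n) ((`|u i| <= 1)%R : nat)%:R <= 3).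

Let B : 'M[R]_k.+1 := c *: \sum_(i < n) (w i *: (Uk k (u i) *m (Uk k (u i))^T)).
Hypothesis eigB : forall a, eigenvalue B a -> lambda <= a.

Lemma Uk_le1 (v : R) (l : 'I_k.+1) : `|v| <= 1 -> `|Uk k v l ord0| <= 1.
Proof.
move=> v1; rewrite mxE normrM normfV ler_pdivrMr ?normr_gt0 ?pnatr_eq0 -?lt0n ?fact_gt0//.
rewrite mul1r normrX (@le_trans _ _ 1)//; first by rewrite exprn_ile1.
by rewrite ger0_norm// ler1n fact_gt0.
Qed.

Let B_E i j : B i j = c * \sum_(l < n) w l * (Uk k (u l) i ord0 * Uk k (u l) j ord0).
Proof.
rewrite mxE summxE; congr (_ * _); apply: eq_bigr => l _.
by rewrite !mxE big_ord1 !mxE.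
Qed.

Let B_sym i j : B i j = B j i.
Proof. by rewrite !B_E; congr (_ * _); apply: eq_bigr => l _; rewrite [in X in _ * X]mulrC. Qed.

Let B_le i j : `|B i j| <= 3 * kmax.
Proof.
rewrite B_E normrM gtr0_norm//.
apply: (@le_trans _ _ (c * \sum_(l < n) kmax * ((`|u l| <= 1)%R : nat)%:R)).
  rewrite ler_pM2l//; apply: le_trans (ler_norm_sum _ _ _) _; apply: ler_sum => l _.
  have [ul|ul] := leP `|u l| 1; last by rewrite wsupp// mul0r normr0 mulr0.
  rewrite mulr1 normrM (ger0_norm (w0 l)) normrM -[leRHS]mulr1.
  apply: ler_pM => //; rewrite ?mulr_ge0//.
  by rewrite mulr_ile1// Uk_le1.
by rewrite -mulr_sumr mulrCA mulrC ler_pM2r.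
Qed.

Lemma gram_unit : B \in unitmx.
Proof.
rewrite unitmxE unitfE; apply/negP => /det0P[v v0 vB].
suff /eigB : eigenvalue B 0 by rewrite leNgt l0.
by apply/eigenvalueP; exists v => //; rewrite vB scale0r.
Qed.

(** The first term serves k = 0. The second serves k = 1, by Cramer's rule with numerator at most 6
    kmax and determinant at least lambda^2. *)
Definition lpe_bound := lambda^-1 + 6 * kmax / lambda ^+ 2.

(** As U(0) is the first unit vector, the coefficient is the first entry of the solution z of B z =
    U(v). The hypothesis speaks of eigenvalues over [R] only, so eigenvectors are exhibited
    explicitly. *)
Lemma lpe_coef_le v : `|v| <= 1 ->
  `|((Uk k 0)^T *m invmx B *m Uk k v) ord0 ord0| <= lpe_bound.
Proof.
move=> v1.
have lb1 : 0 < lambda^-1 by rewrite invr_gt0.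
have lb2 : 0 < 6 * kmax / lambda ^+ 2 by rewrite divr_gt0// ?mulr_gt0// exprn_gt0.
pose z := invmx B *m Uk k v.
have Bz : B *m z = Uk k v by rewrite mulKVmx// gram_unit.
have -> : ((Uk k 0)^T *m invmx B *m Uk k v) ord0 ord0 = z ord0 ord0.
  rewrite -mulmxA -/z mxE big_ord_recl big1 ?addr0.
    by rewrite !mxE expr0 fact0 divr1 mul1r.
  by move=> i _; rewrite !mxE /= expr0n /= mul0r mul0r.
have Bz0 : \sum_j B ord0 j * z j ord0 = 1.
  have := congr1 (fun M : 'cV_k.+1 => M ord0 ord0) Bz.
  by rewrite !mxE expr0 fact0 divr1.
move: k1; rewrite leq_eqVlt ltnS leqn0 => /orP[/eqP k_1|/eqP k_0]; last first.
  have j0 (j : 'I_k.+1) : j = ord0 by apply/val_inj; case: j => -[|j]//=; rewrite k_0.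
  have B00 : lambda <= B ord0 ord0.
    apply: eigB; apply/eigenvalueP; exists (const_mx 1); last first.
      by apply/negP => /eqP/matrixP/(_ ord0 ord0)/eqP; rewrite !mxE oner_eq0.
    apply/matrixP => i j; rewrite [LHS]mxE (big_pred1 ord0); last first.
      by move=> l; rewrite /= (j0 l) eqxx.
    rewrite (j0 j) [RHS]mxE.
    have cE a b : (const_mx 1 : 'rV[R]_k.+1) a b = 1 by rewrite mxE.
    by rewrite !cE mulr1 mul1r.
  move: Bz0; rewrite (big_pred1 ord0); last by move=> l; rewrite /= (j0 l) eqxx.
  move=> E; have Bp : 0 < B ord0 ord0 by exact: lt_le_trans B00.
  have -> : z ord0 ord0 = (B ord0 ord0)^-1.
    by apply: (mulfI (lt0r_neq0 Bp)); rewrite E divff ?gt_eqF.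
  rewrite gtr0_norm ?invr_gt0// /lpe_bound.
  have : (B ord0 ord0)^-1 <= lambda^-1 by rewrite lef_pV2.
  lra.
have k0 : (0 < k)%N by rewrite k_1.
pose o1 : 'I_k.+1 := Ordinal (k0 : (1 < k.+1)%N).
have sumE (F : 'I_k.+1 -> R) : \sum_j F j = F ord0 + F o1.
  rewrite (bigD1 ord0)//= (bigD1 o1)//= big1 ?addr0// => i /andP[i0 i1]; exfalso.
  have ik : (i < k.+1)%N := ltn_ord i.
  have : (i != 0 :> nat) by [].
  have : (i != 1 :> nat) by [].
  lia.
set p := B ord0 ord0; set q := B ord0 o1; set r := B o1 o1.
have qE : B o1 ord0 = q by rewrite B_sym.
have eigv a v0 v1' : (v0, v1') != (0, 0) -> v0 * p + v1' * q = a * v0 ->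
    v0 * q + v1' * r = a * v1' -> lambda <= a.
  move=> v_neq E0 E1; apply: eigB; apply/eigenvalueP.
  pose V : 'rV[R]_k.+1 := \row_j (if j == ord0 then v0 else v1').
  have V0 i : V i ord0 = v0 by rewrite mxE.
  have V1 i : V i o1 = v1' by rewrite mxE.
  exists V.
    apply/matrixP => i j; rewrite [LHS]mxE sumE [RHS]mxE V0 V1.
    have [->|j0] := eqVneq j ord0; first by rewrite qE V0.
    have -> : j = o1; last by rewrite V1.
    have jk : (j < k.+1)%N := ltn_ord j.
    have : (j != 0 :> nat) by [].
    by move=> ?; apply/val_inj => /=; lia.
  apply: contra v_neq => /eqP H.
  by rewrite -(V0 ord0) -(V1 ord0) H !mxE.
(* The determinant is the product of the two eigenvalues. The diagonal case is separate because the
   eigenvector (q, a - p) may vanish when q = 0. *)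
have det_ge : lambda ^+ 2 <= p * r - q ^+ 2.
  have [q0|q0] := eqVneq q 0.
    have lp : lambda <= p.
      by apply: (eigv p 1 0); rewrite ?xpair_eqE ?oner_eq0//; rewrite q0; ring.
    have lr : lambda <= r.
      by apply: (eigv r 0 1); rewrite ?xpair_eqE ?oner_eq0 ?andbF//; rewrite q0; ring.
    by rewrite q0 expr0n subr0 expr2; apply: ler_pM => //; exact: ltW.
  pose D := Num.sqrt ((p - r) ^+ 2 + 4 * q ^+ 2).
  have D2 : D ^+ 2 = (p - r) ^+ 2 + 4 * q ^+ 2.
    by rewrite sqr_sqrtr// addr_ge0 ?sqr_ge0// mulr_ge0 ?sqr_ge0.
  have eiga a : a ^+ 2 - (p + r) * a + (p * r - q ^+ 2) = 0 -> lambda <= a.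
    move=> Ha; apply: (eigv a q (a - p)); first by rewrite xpair_eqE negb_and q0.
      by ring.
    by lra.
  have la : lambda <= (p + r - D) / 2 by apply: eiga; lra.
  have lb : lambda <= (p + r + D) / 2 by apply: eiga; lra.
  have -> : p * r - q ^+ 2 = ((p + r - D) / 2) * ((p + r + D) / 2) by lra.
  by rewrite expr2; apply: ler_pM => //; exact: ltW.
have l2 : 0 < lambda ^+ 2 by rewrite exprn_gt0.
have Bz1 : q * z ord0 ord0 + r * z o1 ord0 = v.
  have := congr1 (fun M : 'cV_k.+1 => M o1 ord0) Bz.
  by rewrite mxE sumE qE [RHS]mxE /= expr1 divr1.
move: Bz0; rewrite sumE -/p -/q => Bz0.
have E : z ord0 ord0 = (r - q * v) / (p * r - q ^+ 2).
  have D0 : p * r - q ^+ 2 != 0 by rewrite gt_eqF//; exact: lt_le_trans det_ge.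
  apply: (mulIf D0); rewrite divfK//.
  have -> : r - q * v = r * 1 - q * v by rewrite mulr1.
  by rewrite -[in r * 1]Bz0 -Bz1; ring.
rewrite E normrM normfV (gtr0_norm (lt_le_trans l2 det_ge)).
have num : `|r - q * v| <= 6 * kmax.
  apply: le_trans (ler_normB _ _) _; rewrite normrM.
  have := B_le o1 o1; have := B_le ord0 o1; rewrite -/r -/q => hq hr.
  have : `|q| * `|v| <= 3 * kmax * 1 by apply: ler_pM.
  lra.
have : `|r - q * v| / (p * r - q ^+ 2) <= 6 * kmax / lambda ^+ 2.
  apply: ler_pM => //; first by rewrite invr_ge0; lra.
  by rewrite lef_pV2// posrE; lra.
rewrite /lpe_bound; lra.
Qed.

(** Entry [l] of the identity U(0)^T B^-1 B = U(0)^T; it says that polynomials of degree at most [k]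
    are reproduced at the centre. *)
Lemma lpe_reproduce (l : 'I_k.+1) :
  \sum_(i < n) (c * ((Uk k 0)^T *m invmx B *m Uk k (u i)) ord0 ord0 * w i) *
     (u i ^+ l / (l`!)%:R) = 0 ^+ l / (l`!)%:R.
Proof.
have := congr1 (fun M : 'rV_k.+1 => M ord0 l) (mulmxKV gram_unit (Uk k 0)^T).
rewrite ![in RHS]mxE => <-.
rewrite /B -scalemxAr mulmx_sumr mxE summxE mulr_sumr.
apply: eq_bigr => i _.
rewrite -scalemxAr mulmxA [in RHS]mxE [in RHS]mxE big_ord1 !mxE; ring.
Qed.

End LocalPolynomial.

(** * Uniform deviations of linear forms *)

Section Noise.
Context {R : realType} (sigma : R).
Hypothesis sigma_gt0 : 0 < sigma.
Local Notation GE := (gauss_expect sigma).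

(** Off the good event at least one of 2N exponentials, one for each form and sign, is at least 1.
    Hence [F] plus their sum is at least [c] everywhere, and [gauss_expect_markov] applies. *)
Lemma gauss_expect_union (N : nat) (a : 'I_N -> nat -> R) (ms : seq R)
    (F : seq R -> R) (tau V c : R) :
  0 < tau -> 0 < V -> 0 <= c <= 1 ->
  (forall i, \sum_(j < size ms) a i j ^+ 2 <= V) ->
  (forall ys, size ys = size ms -> 0 <= F ys) ->
  (forall ys, size ys = size ms ->
     (forall i, `|linform (size ms) (a i) ys - linform (size ms) (a i) ms| <= tau) ->
     c <= F ys) ->
  ((c - (2 * N)%:R * expR (- (tau ^+ 2 / (2 * sigma ^+ 2 * V))))%:E <=
     GE ms (fun ys => (F ys)%:E))%E.
Proof.
move=> t0 V0 /andP[c0 c1] aV F0 good.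
have s2 : 0 < sigma ^+ 2 by rewrite exprn_gt0.
(* The minimizer of sigma^2 t^2 V / 2 - t tau, whose minimum is -tau^2 / (2 sigma^2 V). *)
pose t := tau / (sigma ^+ 2 * V).
have tpos : 0 < t by rewrite divr_gt0// mulr_gt0.
pose sg (b : bool) : R := if b then 1 else -1.
pose mu i := linform (size ms) (a i) ms.
pose e (p : 'I_N * bool) (ys : seq R) : R :=
  expR (linform (size ms) (fun j => sg p.2 * t * a p.1 j) ys + (- (sg p.2 * t * mu p.1) - t * tau)).
pose hh ys := \sum_p e p ys.
have e0 p ys : 0 <= e p ys by exact: expR_ge0.
have linE p ys : linform (size ms) (fun j => sg p.2 * t * a p.1 j) ys =
    sg p.2 * t * linform (size ms) (a p.1) ys.
  by rewrite /linform mulr_sumr; apply: eq_bigr => j _; rewrite !mulrA.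
have [sumE msum] := @gauss_expect_sum R sigma sigma_gt0 _ (index_enum ('I_N * bool)%type) ms
   (fun p ys => (e p ys)%:E) (fun p ys => e0 p ys)
   (fun p => @seq_measurable_expR_linform R _ _ _ unit _ _).
have hE : (fun ys => (hh ys)%:E) = (fun ys => \sum_p (e p ys)%:E)%E.
  by apply/funext => ys; rewrite sumEFin.
have := @gauss_expect_markov R sigma sigma_gt0 ms F hh c c0 F0.
rewrite hE sumE => markov.
have {}markov : (c%:E <= GE ms (fun ys => (F ys)%:E) +
    \sum_p GE ms (fun ys => (e p ys)%:E))%E.
  apply: markov => //; first by move=> ys; apply: sumr_ge0.
  move=> ys sys.
  have hh0 : 0 <= hh ys by apply: sumr_ge0.
  have [gd|bad] := pselect (forall i,
      `|linform (size ms) (a i) ys - linform (size ms) (a i) ms| <= tau).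
    by have := good ys sys gd; lra.
  have [i /negP] : exists i, ~ `|linform (size ms) (a i) ys - linform (size ms) (a i) ms| <= tau.
    by apply: contrapT => ne; apply: bad => i; apply: contrapT => ni; apply: ne; exists i.
  rewrite -ltNge -/(mu i) => taui.
  have [b eb] : exists b, 1 <= e (i, b) ys.
    exists (0 <= linform (size ms) (a i) ys - mu i).
    rewrite /e linE /= -expR0 ler_expR.
    have -> : forall S, sg S * t * linform (size ms) (a i) ys +
        (- (sg S * t * mu i) - t * tau) =
        t * (sg S * (linform (size ms) (a i) ys - mu i) - tau) by move=> S; ring.
    apply: mulr_ge0; first exact: ltW.
    rewrite subr_ge0 /sg; move: taui; case: ifPn => [z0|]; first by rewrite ger0_norm// mul1r => /ltW.
    by rewrite -ltNge => z0; rewrite ltr0_norm// mulN1r => /ltW.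
  have : e (i, b) ys <= hh ys.
    by rewrite /hh (bigD1 (i, b))//= lerDl sumr_ge0.
  by have := F0 ys sys; lra.
have bound : (\sum_p GE ms (fun ys => (e p ys)%:E) <=
   ((2 * N)%:R * expR (- (tau ^+ 2 / (2 * sigma ^+ 2 * V))))%:E)%E.
  rewrite (_ : (2 * N)%:R * _ = \sum_(p : 'I_N * bool) expR (- (tau ^+ 2 / (2 * sigma ^+ 2 * V)))); last first.
    by rewrite sumr_const card_prod card_ord card_bool mulnC mulr_natl.
  rewrite -sumEFin; apply: lee_sum => p _.
  rewrite gauss_expect_expR// lee_fin ler_expR big_split/=.
  rewrite (_ : \sum_(i < size ms) sg p.2 * t * a p.1 i * nth 0 ms i = sg p.2 * t * mu p.1); last first.
    by rewrite -linE.
  have -> : \sum_(i < size ms) sigma ^+ 2 * (sg p.2 * t * a p.1 i) ^+ 2 / 2 =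
     sigma ^+ 2 * t ^+ 2 / 2 * \sum_(i < size ms) a p.1 i ^+ 2.
    rewrite mulr_sumr; apply: eq_bigr => i _.
    have : sg p.2 ^+ 2 = 1 by rewrite /sg; case: ifP => _; rewrite ?sqrrN expr1n.
    by move=> sg2; rewrite !exprMn sg2; ring.
  have : sigma ^+ 2 * t ^+ 2 / 2 * \sum_(i < size ms) a p.1 i ^+ 2 <=
     sigma ^+ 2 * t ^+ 2 / 2 * V.
    by apply: ler_wpM2l => //; rewrite divr_ge0// mulr_ge0 ?sqr_ge0.
  have -> : sigma ^+ 2 * t ^+ 2 / 2 * V = t * tau - tau ^+ 2 / (2 * sigma ^+ 2 * V).
    by rewrite /t; field; rewrite !gt_eqF.
  lra.
rewrite EFinB leeBlDr//; apply: le_trans markov _.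
exact: leeD2l.
Qed.

End Noise.

(** * Bias and variance of the estimator *)

Section Weights.
Context {R : realType} (s : setting R).
Local Notation K := (s_K s).
Local Notation Kmax := (s_Kmax s).
Local Notation lambda0 := (s_lambda0 s).

Hypothesis kord1 : (kord s <= 1)%N.
Hypothesis lambda0_gt0 : 0 < lambda0.
Hypothesis Kmax_gt0 : 0 < Kmax.
Hypothesis K_ge0 : forall u, 0 <= K u.
Hypothesis K_le : forall u, K u <= Kmax.
Hypothesis K_supp : forall u, 1 < `|u| -> K u = 0.

Variables (n : nat) (h x : R).
Hypotheses (n_gt0 : (0 < n)%N) (h_gt0 : 0 < h) (nh1 : 1 <= n%:R * h).
Hypothesis eigB : forall a, eigenvalue (Bmat s n h x) a -> lambda0 <= a.

Definition weight (i : nat) : R := Wn s n h x i.+1.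
Definition wbound : R := lpe_bound lambda0 Kmax * Kmax.

Lemma fhatE Y : fhat s n h Y x = linform n weight Y.
Proof. by rewrite /fhat big_add1/= big_mkord. Qed.

Let u (i : 'I_n) : R := (xpt R n i.+1 - x) / h.
Let nh_gt0 : 0 < n%:R * h. Proof. exact: lt_le_trans nh1. Qed.
Let c_gt0 : 0 < (n%:R * h)^-1. Proof. by rewrite invr_gt0. Qed.

Let u_le1 i : (`|u i| <= 1) = (`|i.+1%:R / n%:R - x| <= h).
Proof.
by rewrite /u normrM normfV (gtr0_norm h_gt0) ler_pdivrMr// mul1r.
Qed.

Let cN : (n%:R * h)^-1 * \sum_(i < n) ((`|u i| <= 1)%R : nat)%:R <= 3.
Proof.
rewrite mulrC ler_pdivrMr//; under eq_bigr do rewrite u_le1.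
by apply: le_trans (count_near _ n_gt0 h_gt0) _; move: nh1; lra.
Qed.

Lemma weight_reproduce (l : nat) : (l <= kord s)%N ->
  \sum_(i < n) weight i * ((xpt R n i.+1 - x) ^+ l) = 0 ^+ l.
Proof.
move=> lk; pose l' : 'I_(kord s).+1 := Ordinal (lk : (l < (kord s).+1)%N).
have := @lpe_reproduce R (kord s) n u (fun i => K (u i)) (n%:R * h)^-1 lambda0 lambda0_gt0
  eigB l'.
have lf : (l`!)%:R != 0 :> R by rewrite pnatr_eq0 -lt0n fact_gt0.
rewrite /l' /= => H.
have {}H : h ^+ l * (l`!)%:R * (0 ^+ l / l`!%:R) = 0 ^+ l.
  have -> : h ^+ l * (l`!)%:R * (0 ^+ l / l`!%:R) = h ^+ l * 0 ^+ l by field.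
  by rewrite -exprMn mulr0.
rewrite -H -[in RHS](@lpe_reproduce R (kord s) n u (fun i => K (u i)) (n%:R * h)^-1 lambda0 lambda0_gt0
  eigB l') mulr_sumr.
apply: eq_bigr => i _; rewrite /weight /Wn /u /= [in RHS]exprMn exprVn.
set z := (_ *m _) ord0 ord0; rewrite -/(u i); field.
by rewrite ?lf ?expf_neq0 ?gt_eqF// ltr0n.
Qed.

Lemma weight_sum : \sum_(i < n) weight i = 1.
Proof. by have := weight_reproduce (leq0n _); under eq_bigr do rewrite expr0 mulr1. Qed.

Lemma weight_le (i : 'I_n) :
  `|weight i| <= wbound / (n%:R * h) * ((`|i.+1%:R / n%:R - x| <= h)%R : nat)%:R.
Proof.
rewrite -u_le1; have [ui|ui] := leP `|u i| 1; last first.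
  by rewrite /weight /Wn -/(u i) K_supp// mulr0 normr0 mulr0.
rewrite mulr1 /weight /Wn -/(u i) !normrM (gtr0_norm c_gt0) (ger0_norm (K_ge0 _)).
rewrite -mulrA mulrC ler_pM2r// /wbound; apply: ler_pM => //.
exact: (@lpe_coef_le R (kord s) n u (fun i => K (u i)) _ lambda0 Kmax kord1 c_gt0
  lambda0_gt0 Kmax_gt0 (fun=> K_ge0 _) (fun=> K_le _) (fun i => @K_supp _) cN eigB).
Qed.

Lemma wbound_ge0 : 0 <= wbound.
Proof.
rewrite mulr_ge0 ?(ltW Kmax_gt0)// addr_ge0// ?invr_ge0 ?(ltW lambda0_gt0)//.
by rewrite divr_ge0 ?mulr_ge0 ?exprn_ge0 ?(ltW lambda0_gt0) ?(ltW Kmax_gt0).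
Qed.

Lemma weight_sum_abs : \sum_(i < n) `|weight i| <= 3 * wbound.
Proof.
apply: le_trans (ler_sum _ (fun i _ => weight_le i)) _.
rewrite -mulr_sumr -mulrA (mulrC 3); apply: ler_wpM2l; first exact: wbound_ge0.
by under eq_bigr do rewrite -u_le1.
Qed.

Lemma weight_sum_sqr : \sum_(i < n) weight i ^+ 2 <= 3 * wbound ^+ 2 / (n%:R * h).
Proof.
apply: (@le_trans _ _ (\sum_(i < n) wbound / (n%:R * h) * `|weight i|)).
  apply: ler_sum => i _; rewrite -real_normK ?num_real// expr2; apply: ler_wpM2r => //.
  apply: le_trans (weight_le i) _; rewrite ler_piMr//.
    by rewrite divr_ge0 ?wbound_ge0// ltW.
  by rewrite lern1 leq_b1.
rewrite -mulr_sumr; apply: le_trans (ler_wpM2l _ weight_sum_abs) _.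
  by rewrite divr_ge0 ?wbound_ge0// ltW.
by rewrite le_eqVlt; apply/orP; left; apply/eqP; field; rewrite !gt_eqF ?ltr0n.
Qed.

(** [D] stands for the derivative at [x]. An estimator of order one annihilates the linear term by
    reproduction; for order zero [D] is 0. The factor 3 [wbound] bounds the sum of the absolute
    weights. *)
Lemma bias_le (F : R -> R) (D eps : R) : (kord s = 0%N -> D = 0) ->
  (forall i : 'I_n, `|i.+1%:R / n%:R - x| <= h ->
     `|F (i.+1%:R / n%:R) - F x - D * (i.+1%:R / n%:R - x)| <= eps) -> 0 <= eps ->
  `|\sum_(i < n) weight i * F (i.+1%:R / n%:R) - F x| <= 3 * wbound * eps.
Proof.
move=> D0 FD eps0.
have WD : \sum_(i < n) weight i * (D * (i.+1%:R / n%:R - x)) = 0.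
  move: (kord1); rewrite leq_eqVlt ltnS leqn0 => /orP[/eqP k_1|/eqP k_0]; last first.
    by rewrite D0// big1// => i _; rewrite mul0r mulr0.
  have := @weight_reproduce 1; rewrite k_1 => /(_ isT); rewrite [RHS]expr1 => H.
  rewrite -[RHS](mulr0 D) -[in RHS]H mulr_sumr; apply: eq_bigr => i _.
  by rewrite expr1 mulrCA.
have -> : \sum_(i < n) weight i * F (i.+1%:R / n%:R) - F x =
    \sum_(i < n) weight i * (F (i.+1%:R / n%:R) - F x - D * (i.+1%:R / n%:R - x)).
  under [RHS]eq_bigr do rewrite mulrBr mulrBr.
  by rewrite !sumrB WD subr0 -mulr_suml weight_sum mul1r.
apply: le_trans (ler_norm_sum _ _ _) _.
apply: (@le_trans _ _ (\sum_(i < n) `|weight i| * eps)).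
  apply: ler_sum => i _; rewrite normrM.
  have [near|far] := leP `|i.+1%:R / n%:R - x| h; first by apply: ler_wpM2l => //; exact: FD.
  have := weight_le i; rewrite (leNgt `|_ - x| h) far /= mulr0 => w0.
  have -> : `|weight i| = 0 by apply/eqP; rewrite eq_le w0 normr_ge0.
  by rewrite !mul0r.
by rewrite -mulr_suml ler_wpM2r// weight_sum_abs.
Qed.

End Weights.

(** * Calculus and asymptotics *)

Section Derivative01.
Context {R : realType}.
Implicit Types f g : R -> R.

Lemma derivative_on01P f g : derivative_on01 f g <->
  forall x, in01 x -> forall e, 0 < e -> exists d, 0 < d /\
    forall y, in01 y -> y != x -> `|y - x| < d ->
      `|g x - (y - x)^-1 * (f y - f x)| < e.
Proof.
split=> fg x x01.
  move=> e e0; have /cvgrPdist_lt/(_ e e0) := fg x x01.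
  move=> -[d /= d0 H]; exists d; split => // y y01 yx yd.
  by apply: (H y) => //; rewrite /ball_/= distrC.
apply/cvgrPdist_lt => e e0; have [d [d0 H]] := fg x x01 e e0.
exists d => //= y yd yx y01.
by apply: H => //; rewrite distrC.
Qed.

(** [HolderClass] and [Fclass] each quantify over a derivative of their own. Uniqueness transfers
    the Hölder bound to the derivative that is known to be very negative. *)
Lemma derivative_on01_unique f g1 g2 x :
  derivative_on01 f g1 -> derivative_on01 f g2 -> in01 x -> g1 x = g2 x.
Proof.
move=> /derivative_on01P fg1 /derivative_on01P fg2 x01.
apply/eqP; rewrite -subr_eq0 -normr_le0 leNgt; apply/negP => gt0.
set e := `|g1 x - g2 x| in gt0; have e2 : 0 < e / 2 by lra.
have [d1 [d10 H1]] := fg1 x x01 _ e2; have [d2 [d20 H2]] := fg2 x x01 _ e2.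
have [y [y01 yx yd]] : exists y, [/\ in01 y, y != x & `|y - x| < Num.min d1 d2].
  (* A step of length at most 1/2, taken away from the nearer endpoint, stays in [0,1]. *)
  pose t := Num.min (Num.min d1 d2) 1 / 2.
  have m0 : 0 < Num.min (Num.min d1 d2) 1 by rewrite !lt_min d10 d20 ltr01.
  have m1 : Num.min (Num.min d1 d2) 1 <= 1 by rewrite ge_min lexx orbT.
  have md : Num.min (Num.min d1 d2) 1 <= Num.min d1 d2 by rewrite ge_min lexx.
  have [x2|x2] := leP x (1 / 2).
    exists (x + t); rewrite /t; split.
    - by move: x01; rewrite /in01 => /andP[? ?]; apply/andP; split; lra.
    - by apply/eqP; lra.
    - by rewrite addrAC subrr add0r gtr0_norm; lra.
  exists (x - t); rewrite /t; split.
  - by move: x01; rewrite /in01 => /andP[? ?]; apply/andP; split; lra.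
  - by apply/eqP; lra.
  - by rewrite addrAC subrr add0r normrN gtr0_norm; lra.
move: yd; rewrite lt_min => /andP[yd1 yd2].
have := H1 y y01 yx yd1; have := H2 y y01 yx yd2.
set q := _^-1 * _ => h2 h1.
have : e <= `|g1 x - q| + `|g2 x - q|.
  by rewrite /e (_ : g1 x - g2 x = (g1 x - q) - (g2 x - q)) ?ler_normB//; ring.
lra.
Qed.

(** At the endpoints of [0,1] the derivative is one-sided, so [MVT] receives two-sided derivatives
    in the open interval and continuity on the closed one. The latter comes from [local], where
    difference quotients near a point are bounded. *)
Lemma derivative_on01_MVT f g a b : derivative_on01 f g -> in01 a -> in01 b -> a < b ->
  exists2 c, a <= c <= b & f b - f a = g c * (b - a).
Proof.
move=> /derivative_on01P fg a01 b01 ab.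
have local x : in01 x -> forall e, 0 < e -> exists d, 0 < d /\
    forall y, in01 y -> `|y - x| < d -> `|f x - f y| < e.
  move=> x01 e e0; have [d [d0 H]] := fg x x01 1 ltr01.
  pose M := `|g x| + 1; have M0 : 0 < M by rewrite ltr_wpDl.
  exists (Num.min d (e / M)); split; first by rewrite lt_min d0 divr_gt0 ?M0 ?e0.
  move=> y y01; have [->|yx] := eqVneq y x; first by rewrite !subrr normr0.
  rewrite lt_min => /andP[yd ye].
  have := H y y01 yx yd; set q := _^-1 * _ => gq.
  have -> : f x - f y = - (q * (y - x)) by rewrite /q; field; rewrite subr_eq0.
  rewrite normrN normrM; apply: le_lt_trans (_ : M * `|y - x| < _); last first.
    by rewrite mulrC -ltr_pdivlMr.
  apply: ler_wpM2r => //; rewrite /M.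
  have : `|q| <= `|g x| + `|g x - q|.
    by rewrite {1}(_ : q = g x - (g x - q)) ?ler_normB//; ring.
  lra.
have /andP[a0 a1] := a01; have /andP[b0 b1] := b01.
have is_d x : x \in `]a, b[ -> is_derive x 1 f (g x).
  rewrite in_itv /= => /andP[ax xb].
  have x01 : in01 x by apply/andP; split; lra.
  have D : (fun h : R => h^-1 *: (f (h *: 1 + x) - f x)) @ 0^' --> g x.
    apply/cvgrPdist_lt => e e0; have [d [d0 H]] := fg x x01 e e0.
    near=> h; have h0 : h != 0 by near: h; exact: nbhs_dnbhs_neq.
    have hd : `|h| < Num.min d (Num.min (x - a) (b - x)).
      near: h; apply: dnbhs0_lt; rewrite !lt_min; apply/and3P; split; lra.
    move: hd; rewrite !lt_min => /and3P[hd ha hb].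
    have := H (h + x); rewrite addrK /GRing.scale /= mulr1; apply => //.
    + move: ha hb; rewrite !ltr_norml => /andP[? ?] /andP[? ?].
      by apply/andP; split; lra.
    + by rewrite -subr_eq0 addrK.
  apply: DeriveDef; first by apply/cvg_ex; exists (g x).
  exact: cvg_lim D.
have cont : {within `[a, b], continuous f}.
  apply/(continuous_within_itvP _ ab); split.
  + move=> x; rewrite in_itv /= => /andP[ax xb].
    have x01 : in01 x by apply/andP; split; lra.
    apply/cvgrPdist_lt => e e0; have [d [d0 H]] := local x x01 e e0.
    exists (Num.min d (Num.min (x - a) (b - x))) => /=.
      by rewrite !lt_min; apply/and3P; split; lra.
    move=> y /=; rewrite distrC !lt_min => /and3P[hd ha hb]; apply: H => //.
    move: ha hb; rewrite !ltr_norml => /andP[? ?] /andP[? ?].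
    by apply/andP; split; lra.
  + apply/cvgrPdist_lt => e e0; have [d [d0 H]] := local a a01 e e0.
    exists (Num.min d (b - a)) => /=; first by rewrite !lt_min; apply/andP; split; lra.
    move=> y /=; rewrite distrC !lt_min => /andP[hd hb] ay; apply: H => //.
    by move: hb; rewrite ltr_norml => /andP[? ?]; apply/andP; split; lra.
  + apply/cvgrPdist_lt => e e0; have [d [d0 H]] := local b b01 e e0.
    exists (Num.min d (b - a)) => /=; first by rewrite !lt_min; apply/andP; split; lra.
    move=> y /=; rewrite distrC !lt_min => /andP[hd hb] ay; apply: H => //.
    by move: hb; rewrite ltr_norml => /andP[? ?]; apply/andP; split; lra.
have [c cab E] := MVT ab is_d cont.
exists c => //; move: cab; rewrite in_itv /= => /andP[? ?]; lra.
Unshelve. all: by end_near.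
Qed.

End Derivative01.

Section Asymptotics.
Context {R : realType}.

Lemma ln_le_2sqrt (x : R) : 0 < x -> ln x <= 2 * x `^ 2^-1.
Proof.
move=> x0; have -> : ln x = 2 * ln (x `^ 2^-1) by rewrite ln_powR; field.
by rewrite ler_pM2l// ltW// ln_sublinear// powR_gt0.
Qed.

Lemma eventually_natr_ge (M : R) : exists N : nat, forall n, (N <= n)%N -> M <= n%:R.
Proof.
exists (Num.truncn `|M|).+1 => n Nn; apply: le_trans (ler_norm M) _.
apply: (@le_trans _ _ (Num.truncn `|M|).+1%:R); last by rewrite ler_nat.
exact/ltW/truncnS_gt.
Qed.

Lemma powR_inv_exp (g x : R) : 0 < g -> 0 <= x -> (x `^ g^-1) `^ g = x.
Proof. by move=> g0 x0; rewrite -powRrM mulVf ?gt_eqF// powRr1. Qed.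

Lemma eventually_powR_ge (g M : R) : 0 < g ->
  exists N : nat, forall n, (N <= n)%N -> M <= n%:R `^ g.
Proof.
move=> g0; have [N HN] := eventually_natr_ge (`|M| `^ g^-1); exists N => n /HN H.
apply: le_trans (ler_norm M) _.
rewrite -[leLHS](powR_inv_exp g0)//.
by apply: ge0_ler_powR; rewrite ?nnegrE ?powR_ge0// ltW.
Qed.

Lemma eventually_ln_ge (M : R) :
  exists N : nat, forall n, (N <= n)%N -> M <= ln (n%:R : R).
Proof.
have [N HN] := eventually_natr_ge (expR M); exists N => n /HN H.
by rewrite -(expRK M) ler_ln// posrE ?expR_gt0//; apply: lt_le_trans H; exact: expR_gt0.
Qed.

Lemma eventually_ln_div (e : R) : 0 < e ->
  exists N : nat, forall n, (N <= n)%N -> ln n%:R / n%:R <= e.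
Proof.
move=> e0; have [N HN] := @eventually_powR_ge 2^-1 (2 / e) ltac:(by rewrite invr_gt0).
exists (maxn N 1) => n; rewrite geq_max => /andP[/HN H n0].
have n0R : 0 < n%:R :> R by rewrite ltr0n.
rewrite ler_pdivrMr//; apply: le_trans (ln_le_2sqrt n0R) _.
have qq : n%:R `^ 2^-1 * n%:R `^ 2^-1 = n%:R :> R.
  rewrite -powRD ?(gt_eqF n0R) ?implybT// (_ : 2^-1 + 2^-1 = 1) ?powRr1//; lra.
rewrite -[in leRHS]qq mulrA ler_pM2r ?powR_gt0//.
by rewrite mulrC -ler_pdivrMr.
Qed.

Lemma eventually_rate_le (g e : R) : 0 < g -> 0 < e ->
  exists N : nat, forall n, (N <= n)%N -> (ln n%:R / n%:R) `^ g <= e.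
Proof.
move=> g0 e0.
have [N HN] := @eventually_ln_div (e `^ g^-1) (powR_gt0 _ e0).
exists (maxn N 1) => n; rewrite geq_max => /andP[/HN H n1].
rewrite -[leRHS](powR_inv_exp g0) ?(ltW e0)//.
apply: ge0_ler_powR; rewrite ?nnegrE ?powR_ge0// ?(ltW g0)//.
by rewrite divr_ge0// ln_ge0// ler1n.
Qed.

Lemma eventually_n_rate_ge (g M : R) : 0 < g < 1 ->
  exists N : nat, forall n, (N <= n)%N -> M <= n%:R * (ln n%:R / n%:R) `^ g.
Proof.
move=> /andP[g0 g1].
have [N1 H1] := @eventually_powR_ge (1 - g) M ltac:(by rewrite subr_gt0).
have [N2 H2] := eventually_ln_ge 1.
exists (maxn (maxn N1 N2) 1) => n; rewrite !geq_max => /andP[/andP[/H1 {}H1 /H2 {}H2] n1].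
have n0R : 0 < n%:R :> R by rewrite ltr0n.
apply: le_trans H1 _.
rewrite powRD ?(gt_eqF n0R) ?implybT// powRr1 ?(ltW n0R)// ler_pM2l//.
rewrite powRN -powR_inv1 ?powR_ge0// -powRrM mulrN1 -mulN1r powRrM powR_inv1 ?(ltW n0R)//.
apply: ge0_ler_powR; rewrite ?nnegrE ?invr_ge0 ?(ltW n0R) ?(ltW g0)//.
  by rewrite divr_ge0 ?(ltW n0R)//; lra.
by rewrite ler_pdivlMr// mulVf ?gt_eqF.
Qed.

End Asymptotics.

(** * Constants, bandwidth and critical values *)

Section Bandwidth.
Context {R : realType} (s : setting R).
Local Notation beta := (s_beta s).
Local Notation L := (s_L s).
Local Notation sigma := (s_sigma s).
Local Notation K := (s_K s).
Local Notation Kmax := (s_Kmax s).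
Local Notation LK := (s_LK s).
Local Notation lambda0 := (s_lambda0 s).
Local Notation alpha := (s_alpha s).
Variables Kmin Delta : R.
Hypothesis beta02 : 0 < beta <= 2.
Hypothesis L_gt0 : 0 < L.
Hypothesis sigma_gt0 : 0 < sigma.
Hypothesis Kas : kernel_assumptions K Kmin Kmax Delta LK.
Hypothesis alpha01 : 0 < alpha < 1.
Hypothesis lambda0_gt0 : 0 < lambda0.

Let beta_gt0 : 0 < beta. Proof. by case/andP: beta02. Qed.
Let P_gt0 : 0 < 2 * beta + 1. Proof. by move: beta_gt0; lra. Qed.

Lemma cbeta_le1 : beta <= 1 -> cbeta s = 1.
Proof. by move=> b1; apply: ceil_def; rewrite subrr beta_gt0 b1. Qed.

Lemma cbeta_gt1 : 1 < beta -> cbeta s = 2.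
Proof. by move=> b1; apply: ceil_def; case/andP: beta02 => _ ->; rewrite andbT. Qed.

Lemma kord_le1 : beta <= 1 -> kord s = 0%N.
Proof. by move=> b1; rewrite /kord cbeta_le1. Qed.

Lemma kord_gt1 : 1 < beta -> kord s = 1%N.
Proof. by move=> b1; rewrite /kord cbeta_gt1. Qed.

Lemma kord_leq1 : (kord s <= 1)%N.
Proof. by have [/kord_le1 ->|/kord_gt1 ->] := leP beta 1. Qed.

Lemma cbetaR_gt0 : 0 < cbetaR s.
Proof. by rewrite /cbetaR ltr0z; have [/cbeta_le1 ->|/cbeta_gt1 ->] := leP beta 1. Qed.

Lemma Kmax_gt0 : 0 < Kmax.
Proof. by case: Kas => _ [_ [_ [[_ [? _]] _]]]. Qed.

Lemma measurable_kernel : measurable_fun setT K.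
Proof.
case: Kas => _ [_ [_ [_ [_ [KL _]]]]].
apply: continuous_measurable_fun => x; apply/cvgrPdist_lt => e e0.
pose M := `|LK| + 1; have M0 : 0 < M by rewrite ltr_wpDl.
exists (e / M) => /=; first exact: divr_gt0.
move=> y /= xy; apply: le_lt_trans (KL _ _) _.
apply: (@le_lt_trans _ _ (M * `|x - y|)).
  by apply: ler_wpM2r => //; rewrite /M; have := ler_norm LK; lra.
by rewrite mulrC -ltr_pdivlMr.
Qed.

(** [fine] sends infinity to 0, so finiteness is needed as well as positivity: K^2 <= Kmax K bounds
    the integral from above, the values on [-Delta, Delta] bound it from below. *)
Lemma mu2_gt0 : 0 < mu2 s.
Proof.
case: Kas => K0 [K1 [_ [[Kmin0 [_ D0]] [Kb _]]]].
have mK := measurable_kernel.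
have mK2 : measurable_fun setT (fun u => (K u ^+ 2)%:E).
  by apply/measurable_EFinP; exact: measurable_funX.
have up : (\int[lebesgue_measure]_u (K u ^+ 2)%:E <= Kmax%:E)%E.
  apply: (@le_trans _ _ (\int[lebesgue_measure]_u (Kmax%:E * (K u)%:E))%E).
    apply: ge0_le_integral_nomeas => u; first by rewrite lee_fin sqr_ge0.
    by rewrite -EFinM lee_fin expr2; apply: ler_wpM2r => //; case: (Kb u).
  have mKE : measurable_fun setT (fun u => (K u)%:E) by exact/measurable_EFinP.
  have Kmax0 : (0 <= Kmax%:E)%E by rewrite lee_fin ltW// Kmax_gt0.
  have KE0 u : setT u -> (0 <= (K u)%:E)%E by rewrite lee_fin.
  by rewrite (ge0_integralZl lebesgue_measure measurableT mKE KE0 Kmax0) K1 mule1.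
have low : ((Kmin ^+ 2 * (2 * Delta))%:E <= \int[lebesgue_measure]_u (K u ^+ 2)%:E)%E.
  apply: (@le_trans _ _ (\int[lebesgue_measure]_u
     ((Kmin ^+ 2)%:E * (\1_`[- Delta, Delta]%classic u)%:E))%E); last first.
    apply: ge0_le_integral_nomeas => u; first by rewrite -EFinM lee_fin mulr_ge0// sqr_ge0.
    rewrite -EFinM lee_fin indicE; case: (boolP (u \in _)) => [|_]; last first.
      by rewrite mulr0 sqr_ge0.
    rewrite inE /= in_itv /= -ler_norml => uD; rewrite mulr1.
    have [+ _] := Kb u; rewrite uD mulr1 => Ku.
    by rewrite ler_pXn2r// nnegrE// ltW.
  have mI : measurable_fun setT (fun u : R => (\1_`[- Delta, Delta]%classic u)%:E : \bar R).
    by apply/measurable_EFinP; exact: measurable_indic.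
  have I0 u : setT u -> (0 <= (\1_`[- Delta, Delta]%classic u)%:E :> \bar R)%E.
    by rewrite lee_fin.
  have k0 : (0 <= (Kmin ^+ 2)%:E)%E by rewrite lee_fin sqr_ge0.
  rewrite (ge0_integralZl lebesgue_measure measurableT mI I0 k0).
  have E : ((2 * Delta)%:E <= lebesgue_measure (`[(- Delta)%R, Delta]%classic : set R))%E.
    rewrite lebesgue_measure_itv /= lte_fin ifT; last lra.
    by rewrite -EFinD lee_fin; lra.
  rewrite integral_indic// setIT EFinM; apply: lee_wpmul2l => //.
rewrite /mu2 fine_gt0//; apply/andP; split.
  by apply: lt_le_trans low; rewrite lte_fin mulr_gt0 ?exprn_gt0// mulr_gt0.
by apply: le_lt_trans up _; rewrite ltry.
Qed.

Lemma Ch_gt0 : 0 < Ch s.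
Proof.
have q1_gt0 : 0 < q1 s.
  by rewrite /q1 /Cstar !(divr_gt0, mulr_gt0)// ?Kmax_gt0 ?ltr0n ?fact_gt0.
have q2_gt0 : 0 < q2 s.
  by rewrite /q2 divr_gt0 ?exprn_gt0 ?mulr_gt0 ?exprn_gt0 ?cbetaR_gt0 ?mu2_gt0.
by rewrite /Ch powR_gt0// divr_gt0// mulr_gt0// mulr_gt0// exprn_gt0.
Qed.

Lemma hn_ge0 n : 0 <= hn s n.
Proof. by rewrite /hn mulr_ge0 ?powR_ge0// ltW// Ch_gt0. Qed.

Lemma rate_ge0 n : 0 <= ln n%:R / n%:R :> R.
Proof. by case: n => [|n]; rewrite ?invr0 ?mulr0// divr_ge0// ln_ge0// ler1n. Qed.

(** Equivalently, h^(2 beta) is a constant times ln n / (n h): squared bias and variance, the latter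
    with its logarithmic factor, balance. *)
Lemma hn_powR n : hn s n `^ (2 * beta + 1) = Ch s `^ (2 * beta + 1) * (ln n%:R / n%:R).
Proof.
rewrite /hn powRM ?powR_ge0 ?(ltW Ch_gt0)//; congr (_ * _).
by rewrite -powRrM mulVf ?gt_eqF// powRr1// rate_ge0.
Qed.

Definition smooth_exp : R := beta - (Num.ceil beta)%:~R + 1.

Lemma smooth_exp_le1 : beta <= 1 -> smooth_exp = beta.
Proof. by move=> /cbeta_le1; rewrite /smooth_exp /cbeta => ->; rewrite subrK. Qed.

Lemma smooth_exp_gt1 : 1 < beta -> smooth_exp = beta - 1.
Proof. by move=> /cbeta_gt1; rewrite /smooth_exp /cbeta => ->; ring. Qed.

Lemma Delta_rate_hn n : Ch s `^ smooth_exp * Delta_rate beta n = hn s n `^ smooth_exp.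
Proof.
rewrite /hn powRM ?powR_ge0 ?(ltW Ch_gt0)//; congr (_ * _).
by rewrite -powRrM /Delta_rate; congr (_ `^ _); rewrite mulrC.
Qed.

(** The bounds on h and n h leave room in [0,1] for blocks of about n h points. The bound 4 / alpha
    <= n makes the failure probability 2 / n of the noise event at most alpha / 2, and the bound on
    [Nmax] makes the logarithmic factor of the critical value at most 8 ln n. *)
Definition large_n n :=
  [/\ (0 < n)%N, 1 <= ln (n%:R : R), 0 < hn s n, hn s n <= 1 / 8 &
   [/\ 8 <= n%:R * hn s n, 4 / alpha <= n%:R & Nmax s n <= alpha * n%:R ^+ 4]].

Lemma eventually_large_n : exists N : nat, forall n, (N <= n)%N -> large_n n.
Proof.
have C0 := Ch_gt0.
have g01 : 0 < (2 * beta + 1)^-1 < 1.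
  by rewrite invr_gt0 P_gt0 invf_lt1//; move: beta_gt0; lra.
have [N1 H1] := eventually_ln_ge (1 : R).
have c8 : 0 < 1 / 8 / Ch s by rewrite !divr_gt0.
have [N2 H2] := eventually_rate_le (proj1 (andP g01)) c8.
have [N3 H3] := @eventually_n_rate_ge R (2 * beta + 1)^-1 (8 / Ch s) g01.
(* Since 1 / h <= n and ln n <= n, [Nmax] is at most alpha kap n^3, and then n >= kap gives the
   fourth power. *)
pose kap := 40 / ln 2 * (- 2 * ln (alpha / 2)) / alpha.
have [N4 H4] := eventually_natr_ge (Num.max (4 / alpha) kap).
have /andP[a0 a1] := alpha01.
exists (maxn (maxn N1 N2) (maxn (maxn N3 N4) 1)) => n.
rewrite !geq_max => /andP[/andP[/H1 {}H1 /H2 {}H2] /andP[/andP[/H3 {}H3 /H4 {}H4] n0]].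
have n0R : 0 < n%:R :> R by rewrite ltr0n.
have n1R : 1 <= n%:R :> R by rewrite ler1n.
have h8 : 8 <= n%:R * hn s n.
  by rewrite /hn mulrCA mulrC -ler_pdivrMr.
have h0 : 0 < hn s n by rewrite -(pmulr_rgt0 _ n0R); lra.
split => //.
  by rewrite /hn mulrC -ler_pdivlMr.
move: H4; rewrite ge_max => /andP[H4 H5]; split => //.
have ln2 : 0 < ln (2 : R) by rewrite ln_gt0// ltr1n.
have lna : 0 < - 2 * ln (alpha / 2).
  rewrite mulNr oppr_gt0 pmulr_rlt0//; apply: ln_lt0; apply/andP; split; lra.
have hinv : (hn s n)^-1 <= n%:R.
  by rewrite -[leLHS]mul1r ler_pdivrMr//; lra.
have lnn : ln n%:R <= n%:R :> R by apply/ltW/ln_sublinear.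
rewrite /Nmax /Cn.
apply: (@le_trans _ _ (40 / ln 2 * ((- 2 * ln (alpha / 2)) * n%:R) * n%:R ^+ 2)).
  apply: ler_pM.
  - apply: mulr_ge0; first by rewrite divr_ge0// ltW.
    by rewrite divr_ge0// ltW.
  - exact: sqr_ge0.
  - apply: ler_wpM2l; first by rewrite divr_ge0// ltW.
    by apply: ler_wpM2l => //; exact: ltW.
  - by rewrite ler_pXn2r ?nnegrE//; lra.
have -> : 40 / ln 2 * (- 2 * ln (alpha / 2) * n%:R) * n%:R ^+ 2 =
   alpha * (kap * n%:R ^+ 3) by rewrite /kap; field; rewrite !gt_eqF.
rewrite ler_pM2l// [leRHS]exprS; exact: ler_wpM2r.
Qed.

Lemma Wconst_ge0 : 0 <= Wconst s.
Proof. by rewrite /Wconst le_max mulr_ge0// sqr_ge0. Qed.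

Definition Ccrit_const := sigma * Num.sqrt (8 * Wconst s / Ch s `^ (2 * beta + 1)).

(** Bounding the minimum by h leaves sigma sqrt(8 W ln n / (n h)), and [hn_powR] expresses ln n / (n
    h) through h^(2 beta). *)
Lemma Ccrit_le n i j : large_n n -> Ccrit s n i j <= Ccrit_const * hn s n `^ beta.
Proof.
move=> [n0 ln1 h0 _ [nh8 _ Nm]]; have /andP[a0 a1] := alpha01.
have n0R : 0 < n%:R :> R by rewrite ltr0n.
have Nm0 : 0 < Nmax s n.
  rewrite /Nmax; apply: mulr_gt0; last by rewrite exprn_gt0//; lra.
  apply: mulr_gt0; first by rewrite divr_gt0// ln_gt0// ltr1n.
  rewrite /Cn divr_gt0// mulNr oppr_gt0 pmulr_rlt0//; apply: ln_lt0; apply/andP; split; lra.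
have lnle : - 2 * ln (alpha / Nmax s n) <= 8 * ln n%:R.
  suff : - (4 * ln n%:R) <= ln (alpha / Nmax s n) by lra.
  have -> : - (4 * ln n%:R) = ln ((n%:R : R) ^+ 4)^-1.
    by rewrite lnV ?posrE ?exprn_gt0// lnXn// mulr_natl.
  rewrite ler_ln ?posrE ?invr_gt0 ?exprn_gt0 ?divr_gt0//.
  by rewrite ler_pdivlMr// mulrC ler_pdivrMr ?exprn_gt0.
rewrite /Ccrit /Ccrit_const.
apply: (@le_trans _ _ (sigma * Num.sqrt (8 * ln n%:R * Wconst s) *
    n%:R `^ (- 2^-1) * hn s n `^ (- (3 / 2)) * hn s n)).
  apply: ler_pM.
  - by rewrite !mulr_ge0 ?powR_ge0 ?sqrtr_ge0// ltW.
  - rewrite le_min hn_ge0 andbT mulr_ge0// divr_ge0 ?(ltW lambda0_gt0)// mulr_ge0//.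
    have := cbetaR_gt0; have := Kmax_gt0 => k0 c0.
    have LK0 : 0 <= LK.
      case: Kas => _ [_ [_ [_ [_ [KL _]]]]].
      by have := KL 1 0; rewrite subr0 normr1 mulr1; apply: le_trans.
    by rewrite /L2; apply: addr_ge0; rewrite !mulr_ge0// ltW.
  - apply: ler_wpM2r; first exact: powR_ge0.
    apply: ler_wpM2r; first exact: powR_ge0.
    apply: ler_wpM2l; first exact: ltW.
    by apply: ler_wsqrtr; apply: ler_wpM2r; rewrite ?Wconst_ge0.
  - by rewrite ge_min lexx orbT.
rewrite -!mulrA ler_pM2l//.
have h12 : hn s n `^ (- (3 / 2)) * hn s n = Num.sqrt (hn s n)^-1.
  rewrite -[X in _ * X]powRr1 ?hn_ge0// -powRD ?(gt_eqF h0) ?implybT//.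
  by rewrite -powR12_sqrt ?invr_ge0 ?hn_ge0// -[(hn s n)^-1]powR_inv1 ?hn_ge0// -powRrM; congr (_ `^ _); lra.
have n12 : n%:R `^ (- 2^-1) = Num.sqrt (n%:R : R)^-1.
  by rewrite -powR12_sqrt ?invr_ge0// -[(n%:R)^-1]powR_inv1// -powRrM; congr (_ `^ _); lra.
have hb : hn s n `^ beta = Num.sqrt ((hn s n `^ beta) ^+ 2).
  by rewrite sqrtr_sqr ger0_norm// powR_ge0.
have lnn0 : 0 <= ln (n%:R : R) by rewrite ln_ge0// ler1n.
rewrite h12 n12 hb -!sqrtrM ?invr_ge0 ?mulr_ge0 ?invr_ge0 ?Wconst_ge0 ?hn_ge0 ?powR_ge0//.
apply: ler_wsqrtr; rewrite le_eqVlt; apply/orP; left; apply/eqP.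
have CP0 : 0 < Ch s `^ (2 * beta + 1) by apply: powR_gt0; exact: Ch_gt0.
have E : (hn s n `^ beta) ^+ 2 * hn s n = Ch s `^ (2 * beta + 1) * (ln n%:R / n%:R).
  rewrite -hn_powR powRD ?(gt_eqF h0) ?implybT// powRr1 ?hn_ge0//.
  by rewrite [2 * _]mulrC powRrM powR_mulrn ?powR_ge0.
have -> : ln n%:R = (hn s n `^ beta) ^+ 2 * hn s n * n%:R / Ch s `^ (2 * beta + 1).
  by rewrite E; field; rewrite !gt_eqF.
by field; rewrite !gt_eqF.
Qed.

Definition Dterm_const := Num.max (16 * Kmax / lambda0) 2 * L.

Lemma Dterm_le n i j : Dterm s n i j <= Dterm_const * hn s n `^ beta.
Proof.
rewrite /Dterm; case: ifP => _ //.
rewrite mulr_ge0 ?powR_ge0// mulr_ge0 ?(ltW L_gt0)//.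
by rewrite le_max ler0n orbT.
Qed.

Lemma reps_ge3 n : large_n n -> (3 <= reps R n)%N.
Proof.
move=> [_ ln1 _ _ _]; rewrite /reps -(ler_nat R) natr_absz ger0_norm.
  by apply: le_trans (ceil_ge _); lra.
by rewrite ceil_ge0; lra.
Qed.

End Bandwidth.

(** * Power of the test *)

Section HolderFacts.
Context {R : realType}.
Implicit Types (beta L : R) (f g : R -> R).

(** By the mean value theorem the Taylor remainder is (g z - g x)(y - x) with z between x and y. *)
Lemma Holder_deriv beta L f : 1 < beta -> 0 <= L -> HolderClass beta L f ->
  exists g, [/\ derivative_on01 f g,
    (forall x y, in01 x -> in01 y -> `|g x - g y| <= L * (`|x - y| `^ (beta - 1))) &
    forall x y, in01 x -> in01 y -> `|f y - f x - g x * (y - x)| <= L * (`|y - x| `^ beta)].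
Proof.
move=> b1 L0; rewrite /HolderClass leNgt b1 /= => -[g [fg gH]]; exists g; split => //.
have main x y z : in01 x -> in01 z -> `|z - x| <= `|y - x| ->
    `|(g z - g x) * (y - x)| <= L * (`|y - x| `^ beta).
  move=> x01 z01 zx; rewrite normrM.
  have -> : `|y - x| `^ beta = `|y - x| `^ (beta - 1) * `|y - x|.
    have [->|yx] := eqVneq `|y - x| 0.
      by rewrite mulr0 powR0//; apply/eqP; lra.
    by rewrite -[X in _ * X]powRr1// -powRD ?yx ?implybT// subrK.
  rewrite mulrA; apply: ler_wpM2r => //; apply: le_trans (gH _ _ z01 x01) _.
  by apply: ler_wpM2l => //; apply: ge0_ler_powR => //; rewrite subr_ge0 ltW.
move=> x y x01 y01; have /andP[x0 x1] := x01; have /andP[y0 y1] := y01.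
have [xy|yx|<-] := ltgtP x y.
- have [z /andP[z1 z2] ->] := derivative_on01_MVT fg x01 y01 xy.
  rewrite -mulrBl; apply: main => //; first by apply/andP; split; lra.
  by rewrite !ger0_norm; lra.
- have [z /andP[z1 z2] E] := derivative_on01_MVT fg y01 x01 yx.
  have -> : f y - f x - g x * (y - x) = (g z - g x) * (y - x) by lra.
  apply: main => //; first by apply/andP; split; lra.
  by rewrite !ler0_norm; lra.
by rewrite !subrr mulr0 subr0 normr0 mulr_ge0// powR_ge0.
Qed.

Lemma block_near (n p : nat) (a : R) : (0 < n)%N -> (p <= n)%N -> in01 a ->
  exists2 m, (m + p <= n)%N &
    forall i, (m < i <= m + p)%N -> `|i%:R / n%:R - a| <= (p%:R + 1) / n%:R.
Proof.
move=> n0 pn /andP[a0 a1].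
have n0R : 0 < n%:R :> R by rewrite ltr0n.
have na0 : 0 <= n%:R * a by rewrite mulr_ge0.
pose t := Num.truncn (n%:R * a).
have /andP[t1 t2] := truncn_itv na0; rewrite -/t in t1 t2.
have tn : (t <= n)%N.
  by rewrite -(ler_nat R); apply: le_trans t1 _; rewrite ler_piMr.
have near (i : nat) : i%:R <= n%:R * a + p%:R + 1 -> n%:R * a <= i%:R + p%:R + 1 ->
    `|i%:R / n%:R - a| <= (p%:R + 1) / n%:R.
  move=> h1 h2; have -> : i%:R / n%:R - a = (i%:R - n%:R * a) / n%:R.
    by field; rewrite gt_eqF.
  rewrite normrM normfV (gtr0_norm n0R) ler_pM2r ?invr_gt0// ler_norml.
  by apply/andP; split; lra.
(* Truncated subtraction: the block ends at t, the integer part of n a, or is 1..p when fewer than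
   [p] indices lie below. *)
exists (t - p)%N; first by lia.
move=> i /andP[i1 i2]; have p0 : 0 <= p%:R :> R by [].
move: t2; rewrite -natr1 => t2.
have [pt|tp] := leqP p t.
  have h1 : (i <= t)%N by lia.
  have h2 : (t < i + p)%N by lia.
  move: h1 h2; rewrite -(ler_nat R) -(ltr_nat R) natrD => h1 h2.
  by apply: near; lra.
have h1 : (i <= p)%N by lia.
have h2 : (t.+1 <= p)%N by lia.
move: h1 h2; rewrite -!(ler_nat R) -(natr1 t) => h1 h2.
have i0 : 0 <= i%:R :> R by [].
by apply: near; lra.
Qed.

Lemma ceil_nat (x : R) : 0 <= x ->
  exists p : nat, x <= p%:R <= x + 1.
Proof.
move=> x0; exists (Num.truncn x).+1.
have /andP[t1 t2] := truncn_itv x0.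
by apply/andP; split; [exact: ltW|rewrite -natr1 lerD2r].
Qed.

Lemma size_means f n : size [seq f (i%:R / n%:R) | i <- iota 1 n] = n.
Proof. by rewrite size_map size_iota. Qed.

Lemma nth_means f n (i : nat) : (i < n)%N ->
  nth 0 [seq f (i%:R / n%:R) | i <- iota 1 n] i = f (i.+1%:R / n%:R).
Proof.
by move=> i_n; rewrite (nth_map 0%N) ?size_iota// nth_iota// add1n.
Qed.

Lemma half_drop (v a b : R) : 0 <= v -> 2 * v <= a - b -> v <= a - b.
Proof. by move=> v0 vab; lra. Qed.

Lemma split_drop (v a b c : R) : 2 * v <= a - b -> a - c < v -> v <= c - b.
Proof. by move=> vab acv; lra. Qed.

Lemma powR_natl_le4 (c x b : R) : 1 <= c <= 4 -> 0 <= x -> 0 <= b <= 1 ->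
  (c * x) `^ b <= 4 * x `^ b.
Proof.
move=> /andP[c1 c4] x0 /andP[b0 b1]; rewrite powRM//; last lra.
apply: ler_wpM2r; first exact: powR_ge0.
apply: le_trans c4; rewrite -[leRHS]powRr1; last lra.
by rewrite ler_powR.
Qed.

End HolderFacts.

Section Power.
Context {R : realType} (s : setting R).
Local Notation beta := (s_beta s).
Local Notation L := (s_L s).
Local Notation sigma := (s_sigma s).
Local Notation K := (s_K s).
Local Notation Kmax := (s_Kmax s).
Local Notation LK := (s_LK s).
Local Notation lambda0 := (s_lambda0 s).
Local Notation alpha := (s_alpha s).
Variables Kmin Delta : R.
Hypothesis beta02 : 0 < beta <= 2.
Hypothesis L_gt0 : 0 < L.
Hypothesis sigma_gt0 : 0 < sigma.
Hypothesis Kas : kernel_assumptions K Kmin Kmax Delta LK.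
Hypothesis alpha01 : 0 < alpha < 1.
Hypothesis lambda0_gt0 : 0 < lambda0.

Let beta_gt0 : 0 < beta. Proof. by case/andP: beta02. Qed.
Let P_gt0 : 0 < 2 * beta + 1. Proof. by move: beta_gt0; lra. Qed.
Let CP_gt0 : 0 < Ch s `^ (2 * beta + 1).
Proof. by apply: powR_gt0; exact: (Ch_gt0 beta02 L_gt0 sigma_gt0 Kas). Qed.
Let Kmax0 : 0 < Kmax. Proof. exact: Kmax_gt0 Kas. Qed.

Lemma Holder_local_approx f : HolderClass beta L f ->
  forall x, in01 x -> exists D, (kord s = 0%N -> D = 0) /\
    forall y, in01 y -> `|f y - f x - D * (y - x)| <= L * (`|y - x| `^ beta).
Proof.
move=> fH x x01; have [b1|b1] := leP beta 1.
  exists 0; split => // y y01; rewrite mul0r subr0.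
  by move: fH; rewrite /HolderClass b1; apply.
have [g [_ _ fg]] := Holder_deriv b1 (ltW L_gt0) fH.
exists (g x); split; last by move=> y y01; exact: fg.
by rewrite (kord_gt1 beta02 b1).
Qed.

Let wb := wbound s.
Let wb_gt0 : 0 < wb.
Proof.
rewrite /wb /wbound mulr_gt0// /lpe_bound addr_gt0 ?invr_gt0//.
by rewrite divr_gt0 ?mulr_gt0 ?exprn_gt0//.
Qed.

(** Chosen such that Chernoff's exponent tau^2 / (2 sigma^2 V), with V = 3 wbound^2 / (n h) and tau
    this constant times h^beta, equals 2 ln n. *)
Definition noise_const := Num.sqrt (12 * sigma ^+ 2 * wbound s ^+ 2 / Ch s `^ (2 * beta + 1)).
(** In units of h^beta: critical value, boundary correction, and the bias and the noise of two
    estimates. *)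
Definition violation_const :=
  Ccrit_const s + Dterm_const s + 6 * wbound s * L + 2 * noise_const.

Let noise_const_gt0 : 0 < noise_const.
Proof.
rewrite /noise_const sqrtr_gt0 divr_gt0//.
by apply: mulr_gt0; [apply: mulr_gt0 => //; exact: exprn_gt0|apply: exprn_gt0].
Qed.

Lemma violation_const_ge0 : 0 <= violation_const.
Proof.
rewrite /violation_const !addr_ge0// ?(ltW noise_const_gt0)//.
- by rewrite /Ccrit_const mulr_ge0 ?sqrtr_ge0 ?(ltW sigma_gt0).
- by rewrite /Dterm_const mulr_ge0 ?(ltW L_gt0)// le_max ler0n orbT.
- have wb0 : 0 <= wbound s := ltW wb_gt0.
  apply: mulr_ge0; last exact: ltW.
  by apply: mulr_ge0.
- by rewrite mulr_ge0 ?(ltW noise_const_gt0).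
Qed.

Variable n : nat.
Hypothesis n_large : large_n s n.
Hypothesis eigB : forall x, in01 x -> forall a, eigenvalue (Bmat s n (hn s n) x) a -> lambda0 <= a.

Let h := hn s n.
Let n_gt0 : (0 < n)%N. Proof. by case: n_large. Qed.
Let n_gt0R : 0 < n%:R :> R. Proof. by rewrite ltr0n. Qed.
Let h_gt0 : 0 < h. Proof. by case: n_large. Qed.
Let h_le : h <= 1 / 8. Proof. by case: n_large. Qed.
Let nh8 : 8 <= n%:R * h. Proof. by case: n_large => _ _ _ _ []. Qed.
Let nh1 : 1 <= n%:R * h. Proof. by apply: le_trans nh8; rewrite ler1n. Qed.
Let hb_gt0 : 0 < h `^ beta. Proof. exact: powR_gt0. Qed.

Let xpt01 i : (i <= n)%N -> in01 (xpt R n i).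
Proof.
by move=> i_n; rewrite /in01 /xpt divr_ge0//= ler_pdivrMr// mul1r ler_nat.
Qed.

Section Means.
Variable f : R -> R.
Hypothesis fH : HolderClass beta L f.
Let ms := [seq f (i%:R / n%:R) | i <- iota 1 n].

Lemma mean_fhat_bias i : (i <= n)%N ->
  `|linform n (weight s n h (xpt R n i)) ms - f (xpt R n i)| <= 3 * wb * (L * h `^ beta).
Proof.
move=> i_n; have x01 := xpt01 i_n.
have [D [D0 fD]] := Holder_local_approx fH x01.
case: (Kas) => K0 [_ [Ks [_ [Kb _]]]].
rewrite /linform (eq_bigr (fun j : 'I_n => weight s n h (xpt R n i) j * f (j.+1%:R / n%:R))); last first.
  by move=> j _; rewrite nth_means.
apply: (bias_le (kord_leq1 beta02) lambda0_gt0 Kmax0 K0 (fun u => (Kb u).2) Ks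
  n_gt0 h_gt0 nh1 (eigB x01) D0) => [j near|]; last first.
  by rewrite mulr_ge0 ?powR_ge0 ?(ltW L_gt0).
apply: le_trans (fD _ (xpt01 (ltn_ord j))) _.
by apply: ler_wpM2l; [exact: ltW|apply: ge0_ler_powR; rewrite ?nnegrE ?(ltW beta_gt0) ?(ltW h_gt0)].
Qed.

Lemma Phi_good ys i j : (i <= n)%N -> (j <= n)%N ->
  `|linform n (weight s n h (xpt R n i)) ys - linform n (weight s n h (xpt R n i)) ms|
     <= noise_const * h `^ beta ->
  `|linform n (weight s n h (xpt R n j)) ys - linform n (weight s n h (xpt R n j)) ms|
     <= noise_const * h `^ beta ->
  violation_const * h `^ beta <= f (xpt R n i) - f (xpt R n j) ->
  Phi_ij s n ys i j.
Proof.
move=> i_n j_n; rewrite !ler_norml => /andP[zi1 zi2] /andP[zj1 zj2] viol.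
have := mean_fhat_bias i_n; have := mean_fhat_bias j_n.
rewrite !ler_norml => /andP[bj1 bj2] /andP[bi1 bi2].
have Cle := Ccrit_le beta02 L_gt0 sigma_gt0 Kas alpha01 lambda0_gt0 i j n_large.
have Dle := Dterm_le L_gt0 n i j.
rewrite /Phi_ij /Tstat !fhatE -/h.
move: viol; rewrite /violation_const -/wb => viol.
rewrite -/h in Cle Dle; lra.
Qed.

Lemma FOMT_power_blocks (ma mb p : nat) :
  h <= p%:R / n%:R -> (ma + p <= mb)%N -> (mb + p <= n)%N ->
  (forall i j, (ma < i <= ma + p)%N -> (mb < j <= mb + p)%N ->
     2 * violation_const * h `^ beta <= f (xpt R n i) - f (xpt R n j)) ->
  ((1 - alpha)%:E <= Pf sigma n f (FOMT_prob s n))%E.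
Proof.
move=> hp ab bn drop; have /andP[a0 a1] := alpha01.
case: (Kas) => K0 [_ [Ks [_ [Kb _]]]].
pose V := 3 * wb ^+ 2 / (n%:R * h).
have V0 : 0 < V.
  by apply: divr_gt0; apply: mulr_gt0 => //; exact: exprn_gt0.
have tau0 : 0 < noise_const * h `^ beta by rewrite mulr_gt0.
have c01 : 0 <= 1 - alpha / 2 <= 1 by apply/andP; split; lra.
have sz : size ms = n by exact: size_means.
have := @gauss_expect_union R sigma sigma_gt0 n
  (fun i => weight s n h (xpt R n i.+1)) ms (FOMT_prob s n)
  (noise_const * h `^ beta) V (1 - alpha / 2) tau0 V0 c01.
rewrite sz => union; rewrite /Pf -/ms; apply: le_trans (union _ _ _); last 3 first.
- move=> i; apply: (weight_sum_sqr (kord_leq1 beta02) lambda0_gt0 Kmax0 K0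
    (fun u => (Kb u).2) Ks n_gt0 h_gt0 nh1); apply: eigB.
  exact: xpt01 (ltn_ord i).
- by move=> ys _; exact: FOMT_prob_ge0.
- move=> ys _ good.
  have good' i : (0 < i <= n)%N ->
    `|linform n (weight s n h (xpt R n i)) ys - linform n (weight s n h (xpt R n i)) ms|
     <= noise_const * h `^ beta.
    by case: i => // i /andP[_ i_n]; exact: (good (Ordinal i_n)).
  apply: (@FOMT_prob_blocks R s n ys ma mb p) => //; first exact: (reps_ge3 n_large).
  have A0 := mulr_ge0 violation_const_ge0 (ltW hb_gt0).
  have Phi_good' i j : (0 < i <= n)%N -> (0 < j <= n)%N ->
      violation_const * h `^ beta <= f (xpt R n i) - f (xpt R n j) -> Phi_ij s n ys i j.
    move=> i_n j_n; apply: Phi_good; [by case/andP: i_n|by case/andP: j_n|exact: good'|exact: good'].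
  set v := violation_const * h `^ beta in A0 Phi_good'.
  move=> i j iA jB; have := drop i j iA jB; rewrite -mulrA -/v => dij.
  have i_n : (0 < i <= n)%N by clear -iA ab bn; lia.
  have j_n : (0 < j <= n)%N by clear -jB ab bn; lia.
  split; first by apply: Phi_good' => //; exact: half_drop dij.
  move=> z zij; have z_n : (0 < z <= n)%N by clear -zij j_n; lia.
  have [v1|v1] := leP v (f (xpt R n i) - f (xpt R n z)).
    by apply/orP; left; exact: Phi_good'.
  by apply/orP; right; apply: Phi_good' => //; exact: split_drop dij v1.
rewrite lee_fin.
have -> : (noise_const * h `^ beta) ^+ 2 / (2 * sigma ^+ 2 * V) = 2 * ln n%:R.
  rewrite exprMn sqr_sqrtr; last first.
    apply: divr_ge0; last exact: ltW.
    by apply: mulr_ge0; [apply: mulr_ge0 => //|]; exact: sqr_ge0.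
  have E : (h `^ beta) ^+ 2 * h = Ch s `^ (2 * beta + 1) * (ln n%:R / n%:R).
    rewrite -(hn_powR beta02) -/h.
    rewrite powRD ?(gt_eqF h_gt0) ?implybT// powRr1 ?(ltW h_gt0)//.
    by rewrite [2 * _]mulrC powRrM powR_mulrn ?powR_ge0.
  have -> : ln n%:R = (h `^ beta) ^+ 2 * h * n%:R / Ch s `^ (2 * beta + 1).
    by rewrite E; field; rewrite !gt_eqF.
  by rewrite /V /wb; field; rewrite -/wb !gt_eqF.
have -> : expR (- (2 * ln n%:R)) = (n%:R ^+ 2)^-1 :> R.
  by rewrite expRN mulr_natl -lnXn// lnK// posrE exprn_gt0.
(* There are n estimates with two signs each, and each deviation has probability at most n^-2. *)
have -> : (2 * n)%:R * (n%:R ^+ 2)^-1 = 2 / n%:R :> R.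
  by rewrite natrM; field; rewrite gt_eqF.
have : 2 / n%:R <= alpha / 2.
  have : 4 / alpha <= n%:R by case: n_large => _ _ _ _ [].
  by rewrite !ler_pdivrMr// => H; lra.
lra.
Qed.

End Means.

(** 4 L pays for passing from the points where f drops, or where its derivative is low, to nearby
    points. The 1 makes the drop strictly larger than the variation 4 L h^beta over a length 4h,
    which separates the blocks when beta <= 1. *)
Definition drop_const := 2 * violation_const + 4 * L + 1.

Lemma drop_blocks f : Fclass beta L (drop_const * h `^ smooth_exp s) f ->
  exists ma mb p : nat, [/\ h <= p%:R / n%:R, (ma + p <= mb)%N, (mb + p <= n)%N &
  forall i j, (ma < i <= ma + p)%N -> (mb < j <= mb + p)%N ->
     2 * violation_const * h `^ beta <= f (xpt R n i) - f (xpt R n j)].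
Proof.
move=> [fH]; have [p /andP[p1 p2]] := ceil_nat (le_trans ler01 nh1).
have nh_n : n%:R * h <= n%:R / 8.
  by apply: le_trans (ler_wpM2l (ltW n_gt0R) h_le) _; rewrite mul1r.
have hp : h <= p%:R / n%:R by rewrite ler_pdivlMr// mulrC.
have A0 := violation_const_ge0.
have xE i : xpt R n i = i%:R / n%:R by [].
have [b1 [a [b [a0 ab b1' drop]]]|b1 [g [fg [x [x01 gx]]]]] := leP beta 1.
(* The blocks lie within 2h of a and b. A drop of this size cannot occur over a length of 4h, so b -
   a > 4h and the blocks are ordered. *)
- rewrite (smooth_exp_le1 beta02 b1) in drop.
  have fL x y : in01 x -> in01 y -> `|f x - f y| <= L * (`|x - y| `^ beta).
    by move: fH; rewrite /HolderClass b1; apply.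
  have a01 : in01 a by apply/andP; split; lra.
  have b01 : in01 b by apply/andP; split; lra.
  have pow c : 1 <= c <= 4 -> L * (c * h) `^ beta <= 4 * L * h `^ beta.
    move=> c14; rewrite -[leRHS]mulrA [leRHS]mulrCA; apply: ler_wpM2l; first exact: ltW.
    by apply: powR_natl_le4 => //; [exact: ltW|rewrite (ltW beta_gt0)].
  have hbL : 0 < L * h `^ beta by rewrite mulr_gt0.
  have hbA := mulr_ge0 A0 (ltW hb_gt0).
  have far : 4 * h < b - a.
    rewrite ltNge; apply/negP => ba.
    have := fL a b a01 b01; rewrite (distrC a b) (gtr0_norm (_ : 0 < b - a)) ?subr_gt0//.
    have : L * (b - a) `^ beta <= L * (4 * h) `^ beta.
      apply: ler_wpM2l; first exact: ltW.
      apply: ge0_ler_powR => //; rewrite ?nnegrE ?(ltW beta_gt0)//.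
      - by rewrite subr_ge0 ltW.
      - by rewrite mulr_ge0// ltW.
    have := pow 4 ltac:(by rewrite lexx ler1n).
    move: drop; rewrite /drop_const => drop h1 h2 /(le_trans (ler_norm _)) h3.
    move: h_gt0 hb_gt0; lra.
  have pn : (p <= n)%N by rewrite -(ler_nat R); move: nh8; lra.
  have [ma ma_n maP] := block_near n_gt0 pn a01.
  have [mb mb_n mbP] := block_near n_gt0 pn b01.
  have close : (p%:R + 1) / n%:R <= 2 * h.
    by rewrite ler_pdivrMr//; move: nh8; lra.
  have p0 : (0 < p)%N by rewrite -(ltr_nat R); move: nh8; lra.
  exists ma, mb, p; split => //.
    have e1 : (ma < ma + p <= ma + p)%N by clear -p0; lia.
    have e2 : (mb < mb + 1 <= mb + p)%N by clear -p0; lia.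
    have := maP _ e1; have := mbP _ e2.
    rewrite !ler_norml => /andP[h1 h2] /andP[h3 h4].
    have : (ma + p)%:R / n%:R < (mb + 1)%:R / n%:R :> R by lra.
    by rewrite ltr_pM2r ?invr_gt0// ltr_nat addn1 ltnS.
  move=> i j iA jB; have i_n : (i <= n)%N by clear -iA ma_n; lia.
  have j_n : (j <= n)%N by clear -jB mb_n; lia.
  have iH := fL a (xpt R n i) a01 (xpt01 i_n).
  have jH := fL (xpt R n j) b (xpt01 j_n) b01.
  have pw y : y <= 2 * h -> 0 <= y -> L * y `^ beta <= 2 * L * h `^ beta.
    move=> y2 y0; apply: (@le_trans _ _ (L * (2 * h) `^ beta)).
      apply: ler_wpM2l; first exact: ltW.
      by apply: ge0_ler_powR => //; rewrite ?nnegrE ?(ltW beta_gt0)// mulr_ge0// ltW.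
    rewrite -[leRHS]mulrA [leRHS]mulrCA; apply: ler_wpM2l; first exact: ltW.
    rewrite powRM ?(ltW h_gt0)//; apply: ler_wpM2r; first exact: powR_ge0.
    by rewrite -[leRHS]powRr1// ler_powR// ler1n.
  have := pw `|a - xpt R n i|; rewrite distrC => /(_ (le_trans (maP i iA) close) (normr_ge0 _)).
  have := pw `|xpt R n j - b| (le_trans (mbP j jB) close) (normr_ge0 _).
  move=> h1 h2; rewrite distrC in h2.
  move: iH jH; rewrite !ler_norml => /andP[_ h3] /andP[_ h4].
  move: drop; rewrite /drop_const => drop; move: hb_gt0; lra.
(* The blocks are the outer thirds of 3p indices around x; the middle third keeps them at least h
   apart. Within 4h of x the derivative stays low, and the mean value theorem turns this into a
   drop. *)
rewrite (smooth_exp_gt1 beta02 b1) in gx.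
have [g' [fg' gH _]] := Holder_deriv b1 (ltW L_gt0) fH.
have {}gx : g' x <= - (drop_const * h `^ (beta - 1)).
  by rewrite -(derivative_on01_unique fg fg' x01).
have hb1 : 0 < h `^ (beta - 1) by rewrite powR_gt0.
have hbE : h `^ beta = h `^ (beta - 1) * h.
  by rewrite -[X in _ * X]powRr1 ?(ltW h_gt0)// -powRD ?(gt_eqF h_gt0) ?implybT// subrK.
have pn : (3 * p <= n)%N by rewrite -(ler_nat R) natrM; move: nh8; lra.
have [m m_n mP] := block_near n_gt0 pn x01.
have close : ((3 * p)%:R + 1) / n%:R <= 4 * h.
  by rewrite natrM ler_pdivrMr//; move: nh8; lra.
have ab : (m + p <= m + 2 * p)%N by clear; lia.
have bn : (m + 2 * p + p <= n)%N by clear -m_n; lia.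
exists m, (m + 2 * p)%N, p; split => //.
move=> i j iA jB; have i_n : (i <= n)%N by clear -iA m_n; lia.
have j_n : (j <= n)%N by clear -jB m_n; lia.
have ij : h <= xpt R n j - xpt R n i.
  rewrite !xE -mulrBl ler_pdivlMr// mulrC; apply: le_trans p1 _.
  by rewrite lerBrDr -natrD ler_nat; clear -iA jB; lia.
have ij' : xpt R n i < xpt R n j by move: h_gt0; lra.
have [z /andP[z1 z2] E] := derivative_on01_MVT fg' (xpt01 i_n) (xpt01 j_n) ij'.
have := xpt01 i_n; have := xpt01 j_n => /andP[xj0 xj1] /andP[xi0 xi1].
have z01 : in01 z by apply/andP; split; lra.
have zx : `|z - x| <= 4 * h.
  have e1 : (m < i <= m + 3 * p)%N by clear -iA; lia.
  have e2 : (m < j <= m + 3 * p)%N by clear -jB; lia.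
  have := mP i e1; have := mP j e2; rewrite -!xE.
  rewrite !ler_norml => /andP[h1 h2] /andP[h3 h4]; apply/andP; split; lra.
have gz : g' z <= - (2 * violation_const * h `^ (beta - 1)).
  have := gH z x z01 x01; rewrite ler_norml => /andP[_ gzx].
  have : L * `|z - x| `^ (beta - 1) <= 4 * L * h `^ (beta - 1).
    rewrite -[leRHS]mulrA [leRHS]mulrCA; apply: ler_wpM2l; first exact: ltW.
    apply: le_trans (@powR_natl_le4 R 4 h (beta - 1) _ _ _).
    - by apply: ge0_ler_powR => //; rewrite ?nnegrE ?subr_ge0 ?(ltW b1)// mulr_ge0// ltW.
    - by rewrite lexx ler1n.
    - exact: ltW.
    - by move/andP: beta02 => [_ b2]; apply/andP; split; lra.
  move: gx; rewrite /drop_const => gx h1; lra.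
have -> : f (xpt R n i) - f (xpt R n j) = - g' z * (xpt R n j - xpt R n i) by lra.
rewrite hbE mulrA; apply: ler_pM => //; first 2 last.
- by rewrite lerNr.
- by rewrite mulr_ge0 ?(ltW hb1)// mulr_ge0.
- exact: ltW.
Qed.

Lemma FOMT_power f :
  Fclass beta L (drop_const * Ch s `^ smooth_exp s * Delta_rate beta n) f ->
  ((1 - alpha)%:E <= Pf sigma n f (FOMT_prob s n))%E.
Proof.
rewrite -mulrA Delta_rate_hn -/h => fF.
have [ma [mb [p [hp ab bn drop]]]] := drop_blocks fF.
by case: fF => fH _; exact: (FOMT_power_blocks fH hp ab bn drop).
Qed.

End Power.

(** * The lower bound *)

Section Bump.
Context {R : realType}.
Implicit Types u v : R.

Definition hump0 u : R := Num.max 0 (1 - u ^+ 2).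
(** Squaring the truncated parabola makes the derivative [dhump] Lipschitz, so one shape serves
    every beta up to 2. *)
Definition hump u : R := hump0 u ^+ 2.
Definition dhump u : R := - 4 * (u * hump0 u).

Lemma hump0P u : (`|u| <= 1 /\ hump0 u = 1 - u ^+ 2) \/ (1 <= `|u| /\ hump0 u = 0).
Proof.
have E : u ^+ 2 = `|u| ^+ 2 by rewrite real_normK// num_real.
rewrite /hump0 E; have := normr_ge0 u; set w := `|u| => w0.
have [w1|w1] := leP w 1; [left|right]; split => //.
- by apply/max_idPr; nra.
- exact: ltW.
- by apply/max_idPl; nra.
Qed.

Lemma hump0_in01 u : 0 <= hump0 u <= 1.
Proof.
rewrite /hump0 le_max lexx /= ge_max ler01 /=.
by have := sqr_ge0 u; lra.
Qed.

Lemma hump0_out u : 1 <= `|u| -> hump0 u = 0.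
Proof.
case: (hump0P u) => [[u1 ->] u1'|[_ ->]//].
have : `|u| = 1 by apply/eqP; rewrite eq_le u1 u1'.
by move=> E; rewrite -(real_normK (num_real u)) E expr1n subrr.
Qed.

(** For |u| <= 1 one has 1 - u^2 <= 2 (1 - |u|) and 1 - |u| <= |u - v|. This settles the estimates
    in which only one of the two points lies in the support. *)
Lemma hump0_le_dist u v : 1 <= `|v| -> hump0 u <= 2 * `|u - v|.
Proof.
move=> v1; have d0 : `|v| - `|u| <= `|u - v| by rewrite distrC lerB_dist.
case: (hump0P u) => [[u1 ->]|[_ ->]]; last by rewrite mulr_ge0.
rewrite -(real_normK (num_real u)); have := normr_ge0 u.
move: d0 v1 u1; set a := `|u|; set b := `|v|; set d := `|u - v|; nra.
Qed.

Lemma hump0_lip u v : `|hump0 u - hump0 v| <= 2 * `|u - v|.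
Proof.
have [v1|v1] := leP 1 `|v|.
  by rewrite (hump0_out v1) subr0 ger0_norm ?hump0_le_dist//; case/andP: (hump0_in01 u).
have [u1|u1] := leP 1 `|u|.
  rewrite (hump0_out u1) sub0r normrN distrC ger0_norm ?hump0_le_dist//.
  by case/andP: (hump0_in01 v).
case: (hump0P u) => [[_ ->]|[u1' _]]; last by move: u1; rewrite ltNge u1'.
case: (hump0P v) => [[_ ->]|[v1' _]]; last by move: v1; rewrite ltNge v1'.
have -> : 1 - u ^+ 2 - (1 - v ^+ 2) = - (u + v) * (u - v) by ring.
rewrite normrM normrN; apply: ler_wpM2r => //.
by apply: le_trans (ler_normD _ _) _; lra.
Qed.

Lemma hump_in01 u : 0 <= hump u <= 1.
Proof. by have /andP[a b] := hump0_in01 u; rewrite exprn_ge0//= exprn_ile1. Qed.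

Lemma hump_lip u v : `|hump u - hump v| <= 4 * `|u - v|.
Proof.
rewrite /hump subr_sqr normrM.
have /andP[a b] := hump0_in01 u; have /andP[c d] := hump0_in01 v.
have -> : 4 * `|u - v| = (2 * `|u - v|) * 2 by ring.
apply: ler_pM => //; first exact: hump0_lip.
by rewrite ger0_norm; lra.
Qed.

Lemma dhump_le u : `|dhump u| <= 4.
Proof.
rewrite /dhump normrM normrN (ger0_norm (ler0n _ _)) -[leRHS]mulr1 ler_pM2l//.
have [u1|u1] := leP 1 `|u|; first by rewrite hump0_out// mulr0 normr0.
have /andP[a b] := hump0_in01 u.
by rewrite normrM (ger0_norm a) mulr_ile1// ltW.
Qed.

Lemma dhump_lip u v : `|dhump u - dhump v| <= 8 * `|u - v|.
Proof.
suff H : `|u * hump0 u - v * hump0 v| <= 2 * `|u - v|.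
  rewrite /dhump -mulrBr normrM normrN (ger0_norm (ler0n _ _)).
  have -> : 8 * `|u - v| = 4 * (2 * `|u - v|) by ring.
  by rewrite ler_pM2l.
have out a b : 1 <= `|b| -> `|a * hump0 a| <= 2 * `|a - b|.
  move=> b1; have [a1|a1] := leP 1 `|a|; first by rewrite hump0_out// mulr0 normr0 mulr_ge0.
  have /andP[m0 _] := hump0_in01 a.
  rewrite normrM (ger0_norm m0); apply: le_trans (hump0_le_dist a b1).
  by rewrite ler_piMl// ltW.
have [v1|v1] := leP 1 `|v|; first by rewrite (hump0_out v1) mulr0 subr0 out.
have [u1|u1] := leP 1 `|u|.
  by rewrite (hump0_out u1) mulr0 sub0r normrN distrC out.
case: (hump0P u) => [[_ ->]|[u1' _]]; last by move: u1; rewrite ltNge u1'.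
case: (hump0P v) => [[_ ->]|[v1' _]]; last by move: v1; rewrite ltNge v1'.
have -> : u * (1 - u ^+ 2) - v * (1 - v ^+ 2) = (1 - (u ^+ 2 + u * v + v ^+ 2)) * (u - v) by ring.
rewrite normrM; apply: ler_wpM2r => //.
move: u1 v1; rewrite !ltr_norml ler_norml => /andP[u1 u2] /andP[v1 v2].
have uu : u ^+ 2 <= 1 by nra.
have vv : v ^+ 2 <= 1 by nra.
have uv := sqr_ge0 (u - v); have uv' := sqr_ge0 (u + v).
by apply/andP; split; nra.
Qed.

(** Inside the support the remainder is a polynomial with the factor (v - u)^2. Across the edge
    every term is of second order by [hump0_le_dist]. *)
Lemma hump_taylor u v : `|hump v - hump u - dhump u * (v - u)| <= 16 * `|v - u| ^+ 2.
Proof.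
rewrite /hump /dhump; have d0 := normr_ge0 (v - u).
have [v1|v1] := leP 1 `|v|.
  rewrite (hump0_out v1) expr0n /= sub0r.
  have [u1|u1] := leP 1 `|u|.
    by rewrite (hump0_out u1) expr0n /= oppr0 !mulr0 mul0r subr0 normr0 mulr_ge0// sqr_ge0.
  have := hump0_le_dist u v1; have /andP[m0 _] := hump0_in01 u; rewrite distrC.
  set m := hump0 u; set d := `|v - u| => md.
  apply: le_trans (ler_normB _ _) _; rewrite normrN normrX !(normrM, normrN) (ger0_norm (ler0n _ _)).
  rewrite (ger0_norm m0) -/d.
  have uu : 0 <= `|u| by [].
  have A : m ^+ 2 <= (2 * d) ^+ 2 by rewrite ler_pXn2r ?nnegrE ?mulr_ge0.
  have B : `|u| * m <= 1 * (2 * d) by apply: ler_pM => //; exact: ltW.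
  have C : 4 * (`|u| * m) * d <= 4 * (2 * d) * d.
    by apply: ler_wpM2r => //; rewrite ler_pM2l//; rewrite mul1r in B.
  by rewrite -/m; move: A C (sqr_ge0 d); lra.
have [u1|u1] := leP 1 `|u|.
  rewrite (hump0_out u1) expr0n /= !mulr0 mul0r !subr0.
  have := hump0_le_dist v u1; have /andP[m0 _] := hump0_in01 v.
  set m := hump0 v; set d := `|v - u| => md.
  rewrite normrX (ger0_norm m0).
  have A : m ^+ 2 <= (2 * d) ^+ 2 by rewrite ler_pXn2r ?nnegrE ?mulr_ge0.
  by rewrite -/m; move: A (sqr_ge0 d); lra.
case: (hump0P u) => [[_ ->]|[u1' _]]; last by move: u1; rewrite ltNge u1'.
case: (hump0P v) => [[_ ->]|[v1' _]]; last by move: v1; rewrite ltNge v1'.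
have -> : (1 - v ^+ 2) ^+ 2 - (1 - u ^+ 2) ^+ 2 - - 4 * (u * (1 - u ^+ 2)) * (v - u) =
  ((u + v) ^+ 2 - 2 * (1 - u ^+ 2)) * (v - u) ^+ 2 by ring.
rewrite normrM normrX; apply: ler_wpM2r; first exact: sqr_ge0.
move: u1 v1; rewrite !ltr_norml ler_norml => /andP[u1 u2] /andP[v1 v2].
have uv := sqr_ge0 (u + v); have uu := sqr_ge0 u.
have uv4 : (u + v) ^+ 2 <= 4 by nra.
have u21 : u ^+ 2 <= 1 by nra.
by apply/andP; split; lra.
Qed.

(** Interpolation between a uniform and a Lipschitz bound: min(1, w) <= w^b for b in [0,1]. *)
Lemma powR_interp (x w C b : R) : 0 <= b <= 1 -> 0 <= w -> 0 <= C ->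
  x <= C -> x <= C * w -> x <= C * w `^ b.
Proof.
move=> /andP[b0 b1] w0 C0 xC xCw; have [w1|w1] := leP 1 w.
  apply: le_trans xC _; rewrite -[leLHS]mulr1; apply: ler_wpM2l => //.
  by rewrite -(powRr0 w) ler_powR.
apply: le_trans xCw _; apply: ler_wpM2l => //.
move: w0; rewrite le_eqVlt => /predU1P[<-|w0]; first exact: powR_ge0.
have wE : w `^ b * w `^ (1 - b) = w.
  by rewrite -powRD ?(gt_eqF w0) ?implybT// subrKC powRr1// ltW.
rewrite -[leLHS]wE ler_piMr ?powR_ge0//.
apply: (@le_trans _ _ (1 `^ (1 - b))); last by rewrite powR1.
by apply: ge0_ler_powR; rewrite ?nnegrE ?subr_ge0 ?(ltW w0) ?(ltW w1).
Qed.

End Bump.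

(** * Le Cam's method for a mixture *)

Section LeCam.
Context {R : realType} (sigma : R).
Hypothesis sigma_gt0 : 0 < sigma.
Local Notation GE := (gauss_expect sigma).
Variables (n N : nat) (ms : 'I_N -> seq R) (S t : R) (Psi : seq R -> bool).
Hypotheses (N_gt0 : (0 < N)%N) (t_gt0 : 0 < t).
Hypothesis size_ms : forall j, size (ms j) = n.
Hypothesis ms_orth : forall j l, j != l -> \sum_(i < n) nth 0 (ms j) i * nth 0 (ms l) i = 0.
Hypothesis ms_norm : forall j, \sum_(i < n) nth 0 (ms j) i ^+ 2 / sigma ^+ 2 <= S.
Hypothesis mPsi : measurable_test n Psi.

Let z := nseq n (0 : R).
Let psi ys : R := (Psi ys)%:R.
Let a j i : R := nth 0 (ms j) i / sigma ^+ 2.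
Let b j : R := - \sum_(i < n) nth 0 (ms j) i ^+ 2 / (2 * sigma ^+ 2).
Let lr j ys : R := expR (linform n (a j) ys + b j).

Let sz : size z = n. Proof. exact: size_nseq. Qed.
Let psi_in01 ys : 0 <= psi ys <= 1.
Proof. by rewrite /psi; case: (Psi ys); rewrite ?lexx ler01. Qed.
Let lr_ge0 j ys : 0 <= lr j ys. Proof. exact: expR_ge0. Qed.
Let mpsi : seqm n (fun ys => (psi ys)%:E). Proof. exact: seq_measurable_test. Qed.
Let mlr j : seqm n (fun ys => (lr j ys)%:E).
Proof. exact: seq_measurable_expR_linform. Qed.

Lemma gauss_expect_prob_fin ks : size ks = n ->
  exists p : R, GE ks (fun ys => (psi ys)%:E) = p%:E.
Proof.
move=> sk; exists (fine (GE ks (fun ys => (psi ys)%:E))); rewrite fineK//.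
rewrite ge0_fin_numE.
  apply: (@le_lt_trans _ _ (GE ks (fun=> 1%:E))).
    by apply: gauss_expect_le => ys _; rewrite lee_fin; case/andP: (psi_in01 ys).
  by rewrite gauss_expect_cst// ltry.
by apply: gauss_expect_ge0 => ys _; rewrite lee_fin; case/andP: (psi_in01 ys).
Qed.

Let GE_lr_psi j : GE z (fun ys => ((lr j ys)%:E * (psi ys)%:E)%E) =
  GE (ms j) (fun ys => (psi ys)%:E).
Proof.
rewrite [RHS](gauss_expect_shift sigma_gt0) ?size_ms//.
by move=> ys; rewrite lee_fin; case/andP: (psi_in01 ys).
Qed.

Let GE_lr2 j l : GE z (fun ys => (lr j ys * lr l ys)%:E) =
  (expR (\sum_(i < n) nth 0 (ms j) i * nth 0 (ms l) i / sigma ^+ 2))%:E.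
Proof.
rewrite (_ : (fun ys => _) = (fun ys =>
    (expR (linform (size z) (fun i => a j i + a l i) ys + (b j + b l)))%:E)); last first.
  apply/funext => ys; rewrite sz /lr -expRD; congr (expR _)%:E.
  rewrite /linform addrACA; congr (_ + _).
  by rewrite -big_split/=; apply: eq_bigr => i _; rewrite mulrDl.
rewrite gauss_expect_expR// sz; congr (expR _)%:E.
rewrite /b -opprD -!big_split/= -sumrB; apply: eq_bigr => i _.
by rewrite /a nth_nseq ltn_ord mulr0 add0r; field; rewrite gt_eqF.
Qed.

Let GE_lr j : GE z (fun ys => (lr j ys)%:E) = 1%E.
Proof.
rewrite (_ : (fun ys => _) = (fun ys =>
    (expR (linform (size z) (a j) ys + b j))%:E)); last by rewrite sz.
rewrite gauss_expect_expR// sz /b -sumrB big1 ?expR0// => i _.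
by rewrite /a nth_nseq ltn_ord mulr0 add0r; field; rewrite gt_eqF.
Qed.

(** Orthogonal means give likelihood ratios whose mixed moments are 1, so only the diagonal
    contributes to the chi-square distance of the mixture. *)
Let GE_lr2_le j l : (GE z (fun ys => (lr j ys * lr l ys)%:E) <=
  (1 + (j == l)%:R * expR S)%:E)%E.
Proof.
rewrite GE_lr2 lee_fin; have [->|jl] := eqVneq j l.
  rewrite mul1r; apply: le_trans (_ : expR S <= _); last by rewrite lerDr.
  by rewrite ler_expR; under eq_bigr do rewrite -expr2; exact: ms_norm.
by rewrite -mulr_suml ms_orth// mul0r expR0 mul0r addr0.
Qed.

(* [Psi (Lbar - 1) <= t/2 + (Lbar - 1)^2 / (2t)] for the averaged likelihood ratio [Lbar], rearranged so that only nonnegative functions are integrated. *)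
Let pointwise (Lb ps : R) : 0 <= ps <= 1 ->
  ps * Lb + t^-1 * Lb <= ps + (t / 2 + (2 * t)^-1) + (2 * t)^-1 * Lb ^+ 2.
Proof.
move=> /andP[p0 p1]; rewrite -subr_ge0.
have -> : ps + (t / 2 + (2 * t)^-1) + (2 * t)^-1 * Lb ^+ 2 - (ps * Lb + t^-1 * Lb) =
   ((t - ps * (Lb - 1) ) ^+ 2 + (1 - ps ^+ 2) * (Lb - 1) ^+ 2) / (2 * t).
  by field; rewrite gt_eqF.
rewrite divr_ge0 ?mulr_ge0 ?(ltW t_gt0)// addr_ge0 ?sqr_ge0// mulr_ge0 ?sqr_ge0//.
by rewrite subr_ge0 exprn_ile1.
Qed.

(** Integrating [pointwise] gives the error t/2 + (E Lbar^2 - 1) / (2t), and E Lbar^2 <= 1 + exp(S)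
    / N. *)
Lemma lecam_mixture (p : 'I_N -> R) (p0 : R) :
  (forall j, GE (ms j) (fun ys => (psi ys)%:E) = (p j)%:E) ->
  GE z (fun ys => (psi ys)%:E) = p0%:E ->
  N%:R^-1 * \sum_j p j <= p0 + t / 2 + expR S / (2 * t * N%:R).
Proof.
move=> pE p0E.
have NR : 0 < N%:R :> R by rewrite ltr0n.
have iN : 0 <= N%:R^-1 :> R by rewrite invr_ge0 ltW.
pose c1 : R := N%:R^-1; pose c2 := t^-1 * N%:R^-1; pose c3 := (2 * t)^-1 * N%:R^-1 ^+ 2.
have c20 : 0 <= c2 by rewrite mulr_ge0// invr_ge0 ltW.
have c30 : 0 <= c3 by rewrite mulr_ge0 ?sqr_ge0// invr_ge0 mulr_ge0// ltW.
have k0 : 0 <= t / 2 + (2 * t)^-1.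
  by rewrite addr_ge0// ?divr_ge0 ?invr_ge0 ?mulr_ge0 ?(ltW t_gt0).
pose A j ys : \bar R := (c1%:E * ((lr j ys)%:E * (psi ys)%:E))%E.
pose B j ys : \bar R := (c2%:E * (lr j ys)%:E)%E.
pose C (q : 'I_N * 'I_N) ys : \bar R := (c3%:E * (lr q.1 ys * lr q.2 ys)%:E)%E.
have psiE0 ys : (0 <= (psi ys)%:E)%E by rewrite lee_fin; case/andP: (psi_in01 ys).
have A0 j ys : (0 <= A j ys)%E by rewrite !mule_ge0// lee_fin.
have B0 j ys : (0 <= B j ys)%E by rewrite !mule_ge0// lee_fin.
have C0 q ys : (0 <= C q ys)%E by rewrite !mule_ge0// lee_fin// mulr_ge0.
have mcst (c : R) : seqm n (fun=> c%:E) by exact: seq_measurable_cst.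
have mlrpsi j : seqm n (fun ys => (lr j ys)%:E * (psi ys)%:E)%E.
  by have := seq_measurableM (mlr j) mpsi.
have mlr2 q : seqm n (fun ys => (lr q.1 ys * lr q.2 ys)%:E).
  by have := seq_measurableM (mlr q.1) (mlr q.2).
have mA j : seqm n (A j) by have := seq_measurableM (mcst c1) (mlrpsi j).
have mB j : seqm n (B j) by have := seq_measurableM (mcst c2) (mlr j).
have mC (q : 'I_N * 'I_N) : seqm n (C q) by have := seq_measurableM (mcst c3) (mlr2 q).
have := @gauss_expect_sum R sigma sigma_gt0 _ (index_enum 'I_N) z A A0.
rewrite sz => /(_ mA) [EA mSA].
have := @gauss_expect_sum R sigma sigma_gt0 _ (index_enum 'I_N) z B B0.
rewrite sz => /(_ mB) [EB mSB].
have := @gauss_expect_sum R sigma sigma_gt0 _ (index_enum ('I_N * 'I_N)%type) z C C0.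
rewrite sz => /(_ mC) [EC mSC].
have sA0 ys : (0 <= \sum_j A j ys)%E by exact: sume_ge0.
have sB0 ys : (0 <= \sum_j B j ys)%E by exact: sume_ge0.
have sC0 ys : (0 <= \sum_q C q ys)%E by exact: sume_ge0.
have main : (GE z (fun ys => \sum_j A j ys + \sum_j B j ys) <=
   GE z (fun ys => ((psi ys)%:E + (t / 2 + (2 * t)^-1)%:E) + \sum_q C q ys))%E.
  apply: gauss_expect_le => ys _; first exact: adde_ge0.
  rewrite /A /B /C.
  under eq_bigr do rewrite -!EFinM.
  under [X in (_ + X <= _)%E]eq_bigr do rewrite -EFinM.
  under [X in (_ <= _ + X)%E]eq_bigr do rewrite -EFinM.
  rewrite !sumEFin -!EFinD lee_fin.
  have := pointwise (N%:R^-1 * \sum_j lr j ys) (psi_in01 ys).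
  rewrite -!mulr_sumr.
  have -> : \sum_(q : 'I_N * 'I_N) lr q.1 ys * lr q.2 ys = (\sum_j lr j ys) ^+ 2.
    rewrite expr2 big_distrlr/= pair_big/=.
    by apply: eq_bigr => -[].
  have -> : \sum_j lr j ys * psi ys = (\sum_j lr j ys) * psi ys by rewrite mulr_suml.
  rewrite /c1 /c2 /c3 => H; apply: le_trans (le_trans _ H) _.
    by rewrite le_eqVlt; apply/orP; left; apply/eqP; ring.
  by rewrite le_eqVlt; apply/orP; left; apply/eqP; ring.
move: main.
rewrite gauss_expectD ?sz// gauss_expectD ?sz//; last 2 first.
- by move=> ys; apply: adde_ge0 => //; rewrite lee_fin.
- exact: (seq_measurableD mpsi (mcst _)).
rewrite gauss_expectD ?sz//.
rewrite gauss_expect_cst// EA EB EC p0E.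
have -> : (\sum_j GE z (A j) = (N%:R^-1 * \sum_j p j)%:E)%E.
  rewrite mulr_sumr -sumEFin; apply: eq_bigr => j _.
  rewrite gauss_expectZ ?sz//; last by move=> ys; rewrite mule_ge0// lee_fin.
  by rewrite GE_lr_psi pE -EFinM.
have -> : (\sum_j GE z (B j) = (t^-1)%:E)%E.
  rewrite (eq_bigr (fun=> c2%:E)); last first.
    move=> j _; rewrite gauss_expectZ ?sz//; last by move=> ys; rewrite lee_fin.
    by rewrite GE_lr mule1.
  rewrite sumEFin sumr_const card_ord /c2 -[X in X%:E]mulr_natr; congr _%:E.
  by field; rewrite !gt_eqF.
have HC : (\sum_q GE z (C q) <= ((2 * t)^-1 + expR S / (2 * t * N%:R))%:E)%E.
  apply: (@le_trans _ _ (\sum_(q : 'I_N * 'I_N) (c3 * (1 + (q.1 == q.2)%:R * expR S))%:E)%E).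
    apply: lee_sum => q _; rewrite gauss_expectZ ?sz//.
      by rewrite [leRHS]EFinM; apply: lee_wpmul2l; rewrite ?lee_fin.
    by move=> ys; rewrite lee_fin mulr_ge0.
  rewrite sumEFin lee_fin -mulr_sumr big_split/= sumr_const card_prod card_ord.
  rewrite -mulr_suml -(pair_bigA _ (fun i j : 'I_N => (i == j)%:R))/=.
  rewrite (eq_bigr (fun=> 1)); last first.
    move=> i _; rewrite (bigD1 i)//= eqxx big1 ?addr0// => j ji.
    by rewrite eq_sym (negbTE ji).
  rewrite sumr_const card_ord natrM /c3.
  by rewrite le_eqVlt; apply/orP; left; apply/eqP; field; rewrite !gt_eqF.
move=> H; have := le_trans H (leeD2l _ HC).
rewrite -!EFinD lee_fin.
by set q := N%:R^-1 * _; set r := expR S / _; set u := t^-1; rewrite invfM -/u; lra.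
Qed.

Lemma lecam : exists j : 'I_N, (GE (ms j) (fun ys => (psi ys)%:E) <=
  GE z (fun ys => (psi ys)%:E) + (t / 2 + expR S / (2 * t * N%:R))%:E)%E.
Proof.
have [p0 p0E] := gauss_expect_prob_fin sz.
have /choice[p pE] : forall j, exists x : R, GE (ms j) (fun ys => (psi ys)%:E) = x%:E.
  by move=> j; exact: gauss_expect_prob_fin (size_ms j).
have H := lecam_mixture pE p0E.
apply: contrapT => nex.
have big j : p0 + t / 2 + expR S / (2 * t * N%:R) < p j.
  rewrite ltNge; apply/negP => le; apply: nex; exists j.
  by rewrite pE p0E -EFinD lee_fin addrA.
have NR : 0 < N%:R :> R by rewrite ltr0n.
move: H; apply/negP; rewrite -ltNge ltr_pdivlMl//.
set B := p0 + _ + _ in big *.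
have -> : N%:R * B = \sum_(j : 'I_N) B by rewrite sumr_const card_ord mulr_natl.
apply: ltr_sum => //; by apply/hasP; exists (Ordinal N_gt0).
Qed.

End LeCam.

(** * Scaled bumps and the minimax bound *)

Section LowerBound.
Context {R : realType} (beta L c r : R).
Hypotheses (beta02 : 0 < beta <= 2) (c_gt0 : 0 < c) (cL : 8 * c <= L) (r_gt0 : 0 < r).

Definition shump (t x : R) : R := c * r `^ beta * hump ((x - t) / r).
Definition dshump (t x : R) : R := c * r `^ (beta - 1) * dhump ((x - t) / r).

Let beta_gt0 : 0 < beta. Proof. by case/andP: beta02. Qed.
Let L_gt0 : 0 < L. Proof. by move: c_gt0 cL; lra. Qed.
Let scale_dist (x y t : R) : `|(x - t) / r - (y - t) / r| = `|x - y| / r.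
Proof. by rewrite -mulrBl opprB addrA subrK normrM normfV (gtr0_norm r_gt0). Qed.

Let scale_powR (b d : R) : 0 <= d -> r `^ b * (d / r) `^ b = d `^ b.
Proof.
move=> d0; rewrite -powRM ?divr_ge0 ?(ltW r_gt0)//; congr (_ `^ _).
by rewrite mulrC divfK// gt_eqF.
Qed.

Let rbE : r `^ beta = r `^ (beta - 1) * r.
Proof. by rewrite -[X in _ * X]powRr1 ?(ltW r_gt0)// -powRD ?(gt_eqF r_gt0) ?implybT// subrK. Qed.

Lemma shump_derivative t : derivative_on01 (shump t) (dshump t).
Proof.
apply/derivative_on01P => x x01 e e0.
pose M := c * r `^ beta * (16 / r ^+ 2).
have M0 : 0 < M by rewrite !mulr_gt0 ?powR_gt0 ?invr_gt0 ?exprn_gt0.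
exists (e / M); split; first exact: divr_gt0.
move=> y y01 yx yd.
have yx0 : 0 < `|y - x| by rewrite normr_gt0 subr_eq0.
have yxn : y - x != 0 by rewrite subr_eq0.
have E : dshump t x - (y - x)^-1 * (shump t y - shump t x) =
   - (y - x)^-1 * (c * r `^ beta * (hump ((y - t) / r) - hump ((x - t) / r) -
     dhump ((x - t) / r) * ((y - t) / r - (x - t) / r))).
  by rewrite /dshump /shump rbE; field; rewrite yxn gt_eqF.
rewrite E normrM normrN normfV mulrC ltr_pdivrMr//.
rewrite normrM ger0_norm; last by rewrite mulr_ge0 ?powR_ge0// ltW.
apply: (@le_lt_trans _ _ (M * `|y - x| * `|y - x|)); last first.
  by rewrite ltr_pM2r// mulrC -ltr_pdivlMr.
have cr0 : 0 <= c * r `^ beta by rewrite mulr_ge0 ?powR_ge0// ltW.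
apply: le_trans (ler_wpM2l cr0 (hump_taylor _ _)) _.
rewrite scale_dist /M le_eqVlt; apply/orP; left; apply/eqP.
by field; rewrite gt_eqF.
Qed.

(** [powR_interp] is applied to the unit bump with w = |x - y| / r, and the amplitude cancels the
    power of r that this produces. *)
Lemma shump_Holder t : HolderClass beta L (shump t).
Proof.
have /andP[_ b2] := beta02.
have cL' : 4 * c <= L by move: c_gt0 cL; lra.
rewrite /HolderClass; have [b1|b1] := leP beta 1.
  move=> x y _ _; rewrite /shump -mulrBr normrM ger0_norm; last first.
    by rewrite mulr_ge0 ?powR_ge0// ltW.
  have B : `|hump ((x - t) / r) - hump ((y - t) / r)| <= 4 * (`|x - y| / r) `^ beta.
    apply: powR_interp; rewrite ?divr_ge0 ?(ltW r_gt0) ?(ltW beta_gt0)//.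
      have /andP[p1 p2] := hump_in01 ((x - t) / r); have /andP[p3 p4] := hump_in01 ((y - t) / r).
      by rewrite ler_norml; apply/andP; split; lra.
    by rewrite -(scale_dist x y t) hump_lip.
  apply: le_trans (ler_wpM2l _ B) _; first by rewrite mulr_ge0 ?powR_ge0// ltW.
  have -> : c * r `^ beta * (4 * (`|x - y| / r) `^ beta) =
    4 * c * (r `^ beta * (`|x - y| / r) `^ beta) by ring.
  by rewrite scale_powR//; apply: ler_wpM2r => //; exact: powR_ge0.
exists (dshump t); split; first exact: shump_derivative.
move=> x y _ _; rewrite /dshump -mulrBr normrM ger0_norm; last first.
  by rewrite mulr_ge0 ?powR_ge0// ltW.
have B : `|dhump ((x - t) / r) - dhump ((y - t) / r)| <= 8 * (`|x - y| / r) `^ (beta - 1).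
  apply: powR_interp; rewrite ?divr_ge0 ?(ltW r_gt0)//.
  - by rewrite subr_ge0 (ltW b1)/= lerBlDr.
  - apply: le_trans (ler_normB _ _) _.
    by have := dhump_le ((x - t) / r); have := dhump_le ((y - t) / r); lra.
  - by rewrite -(scale_dist x y t) dhump_lip.
apply: le_trans (ler_wpM2l _ B) _; first by rewrite mulr_ge0 ?powR_ge0// ltW.
have -> : c * r `^ (beta - 1) * (8 * (`|x - y| / r) `^ (beta - 1)) =
  8 * c * (r `^ (beta - 1) * (`|x - y| / r) `^ (beta - 1)) by ring.
by rewrite scale_powR//; apply: ler_wpM2r => //; exact: powR_ge0.
Qed.

(** For beta <= 1 the drop runs from the peak t to the edge t + r of the support. For larger beta
    the slope at t + r/2 is -(3/2) c r^(beta - 1). *)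
Lemma shump_Fclass t : 0 <= t -> t + r <= 1 ->
  Fclass beta L (c * r `^ (if beta <= 1 then beta else beta - 1)) (shump t).
Proof.
move=> t0 t1; split; first exact: shump_Holder.
have [b1|b1] := leP beta 1.
  exists t, (t + r); split => //; first by rewrite ltrDl.
  rewrite /shump subrr mul0r addrAC subrr add0r divff ?gt_eqF// -mulrBr.
  have -> : hump (0 : R) = 1.
    by rewrite /hump /hump0 expr0n /= subr0 (max_idPr _)// expr1n.
  have -> : hump (1 : R) = 0.
    by rewrite /hump hump0_out ?normr1// expr0n.
  by rewrite subr0 mulr1.
exists (dshump t); split; first exact: shump_derivative.
exists (t + r / 2); split.
  by apply/andP; split; move: r_gt0; lra.
rewrite /dshump (_ : (t + r / 2 - t) / r = 1 / 2); last first.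
  by field; rewrite gt_eqF.
have -> : dhump (1 / 2 : R) = - (3 / 2).
  by rewrite /dhump /hump0 (max_idPr _); [field|rewrite expr2; lra].
rewrite mulrN lerN2 ler_peMr//; last lra.
by rewrite mulr_ge0 ?powR_ge0// ltW.
Qed.

Lemma zero_Hclass : Hclass beta L (fun=> 0).
Proof.
split; last by move=> x y _ _ _.
rewrite /HolderClass; case: ifP => b1.
  by move=> x y _ _; rewrite subrr normr0 mulr_ge0 ?powR_ge0// ltW.
exists (fun=> 0); split; last by move=> x y _ _; rewrite subrr normr0 mulr_ge0 ?powR_ge0// ltW.
apply/derivative_on01P => x x01 e e0; exists 1; split => // y _ _ _.
by rewrite subrr mulr0 subrr normr0.
Qed.

Lemma shump_orth t1 t2 x : 2 * r <= `|t1 - t2| -> shump t1 x * shump t2 x = 0.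
Proof.
move=> far; have far' : 2 <= `|(x - t2) / r - (x - t1) / r|.
  have -> : (x - t2) / r - (x - t1) / r = (t1 - t2) / r by ring.
  by rewrite normrM normfV (gtr0_norm r_gt0) ler_pdivlMr.
have [h1|h1] := leP 1 `|(x - t1) / r|.
  by rewrite /shump {1}/hump (hump0_out h1) expr0n /= mulr0 mul0r.
have [h2|h2] := leP 1 `|(x - t2) / r|.
  by rewrite /shump [in X in _ * X]/hump (hump0_out h2) expr0n /= !mulr0.
have := ler_normB ((x - t2) / r) ((x - t1) / r); lra.
Qed.

Lemma shump_sqr t x : shump t x ^+ 2 <= (c * r `^ beta) ^+ 2 * ((`|x - t| <= r)%R : nat)%:R.
Proof.
rewrite /shump exprMn; apply: ler_wpM2l; first exact: sqr_ge0.
have [near|far] := leP `|x - t| r.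
  by have /andP[p0 p1] := hump_in01 ((x - t) / r); rewrite exprn_ile1.
rewrite /hump hump0_out; first by rewrite !expr0n.
by rewrite normrM normfV (gtr0_norm r_gt0) ler_pdivlMr// mul1r ltW.
Qed.

(** The factor 3 comes from the at most 2 n r + 1 <= 3 n r design points that meet the bump. *)
Lemma shump_norm (n : nat) t sigma : (0 < n)%N -> 1 <= n%:R * r -> 0 < sigma ->
  \sum_(i < n) shump t (i.+1%:R / n%:R) ^+ 2 / sigma ^+ 2 <=
  3 * c ^+ 2 * (n%:R * r `^ (2 * beta + 1)) / sigma ^+ 2.
Proof.
move=> n0 nr s0; rewrite -mulr_suml; apply: ler_wpM2r; first by rewrite invr_ge0 sqr_ge0.
apply: le_trans (ler_sum _ (fun i _ => shump_sqr t _)) _.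
rewrite -mulr_sumr; apply: le_trans (ler_wpM2l (sqr_ge0 _) (count_near t n0 r_gt0)) _.
have -> : r `^ (2 * beta + 1) = (r `^ beta) ^+ 2 * r.
  rewrite powRD ?(gt_eqF r_gt0) ?implybT// powRr1 ?(ltW r_gt0)//.
  by rewrite [2 * _]mulrC powRrM powR_mulrn ?powR_ge0.
have -> : 3 * c ^+ 2 * (n%:R * ((r `^ beta) ^+ 2 * r)) = (c * r `^ beta) ^+ 2 * (3 * (n%:R * r)).
  by ring.
by apply: ler_wpM2l; [exact: sqr_ge0|lra].
Qed.

(** [lecam] with t = eps: since 1 / N <= 4 r, the assumption bounds exp(S) / N by eps^2, and both
    error terms are at most eps / 2. *)
Lemma minimax_lower (n : nat) (sigma eps : R) (Psi : seq R -> bool) :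
  (0 < n)%N -> 1 <= n%:R * r -> 0 < sigma -> 0 < eps -> r <= 1 / 4 ->
  4 * r * expR (3 * c ^+ 2 * (n%:R * r `^ (2 * beta + 1)) / sigma ^+ 2) <= eps ^+ 2 ->
  measurable_test n Psi ->
  (ereal_inf [set Pf sigma n f (fun ys => (Psi ys)%:R)
      | f in Fclass beta L (c * r `^ (if (beta <= 1)%R then beta else beta - 1))%R] <=
   ereal_sup [set Pf sigma n f (fun ys => (Psi ys)%:R) | f in Hclass beta L] + eps%:E)%E.
Proof.
move=> n0 nr s0 e0 r4; set S := _ / _ => HS mPsi.
have r2 : 0 <= 1 / (2 * r) by rewrite divr_ge0// mulr_ge0// ltW.
(* The centres are the odd multiples of r; as 2 r N <= 1, the bumps lie in [0,1] with disjoint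
   supports. *)
pose N := Num.truncn (1 / (2 * r)).
have /andP[N1 N2] := truncn_itv r2; rewrite -/N in N1 N2.
have N1' : N%:R * (2 * r) <= 1 by rewrite -ler_pdivlMr// mulr_gt0.
have N2' : 1 < N.+1%:R * (2 * r) by rewrite -ltr_pdivrMr// mulr_gt0.
(* From (N + 1) 2r > 1 one gets 4 r N > 2 - 4 r, which is at least 1 because r <= 1/4. *)
have N4 : 1 <= N%:R * (4 * r).
  move: N2'; rewrite -natr1 => N2'.
  have : N%:R * (4 * r) = 2 * ((N%:R + 1) * (2 * r)) - 4 * r by ring.
  by lra.
have NR : 0 < N%:R :> R.
  by rewrite ltr0n lt0n; apply/eqP => Nz; move: N4; rewrite Nz mul0r ler10.
have N0 : (0 < N)%N by rewrite -(ltr_nat R).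
pose t (j : 'I_N) : R := (2 * j%:R + 1) * r.
pose ms (j : 'I_N) := [seq shump (t j) (i%:R / n%:R) | i <- iota 1 n].
have t_far j l : j != l -> 2 * r <= `|t j - t l|.
  move=> jl; have -> : t j - t l = 2 * r * (j%:R - l%:R) by rewrite /t; ring.
  rewrite normrM ger0_norm; last by rewrite mulr_ge0// ltW.
  rewrite ler_peMr//; first by rewrite mulr_ge0// ltW.
  have : (j < l)%N || (l < j)%N by rewrite -neq_ltn.
  move=> /orP[jl'|lj'].
    rewrite distrC ger0_norm ?subr_ge0 ?ler_nat 1?ltnW// lerBrDr.
    by rewrite -(natrD _ 1) ler_nat add1n.
  rewrite ger0_norm ?subr_ge0 ?ler_nat 1?ltnW// lerBrDr.
  by rewrite -(natrD _ 1) ler_nat add1n.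
have nthE j (i : 'I_n) : nth 0 (ms j) i = shump (t j) (i.+1%:R / n%:R) by exact: nth_means.
have orth j l : j != l -> \sum_(i < n) nth 0 (ms j) i * nth 0 (ms l) i = 0.
  move=> jl; apply: big1 => i _; rewrite !nthE; apply: shump_orth; exact: t_far.
have norm j : \sum_(i < n) nth 0 (ms j) i ^+ 2 / sigma ^+ 2 <= S.
  under eq_bigr do rewrite nthE.
  exact: shump_norm.
have [j Hj] := lecam s0 N0 e0 (fun j => size_means _ n) orth norm mPsi.
apply: (@le_trans _ _ (Pf sigma n (shump (t j)) (fun ys => (Psi ys)%:R))).
  apply: ereal_inf_lbound; exists (shump (t j)) => //; apply: shump_Fclass.
    by rewrite mulr_ge0 ?addr_ge0 ?mulr_ge0// ltW.
  have : (j.+1%:R : R) <= N%:R by rewrite ler_nat.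
  rewrite -natr1 => jN; rewrite /t.
  have : (j%:R + 1) * (2 * r) <= N%:R * (2 * r) by rewrite ler_pM2r// mulr_gt0.
  have : (2 * j%:R + 1) * r + r = (j%:R + 1) * (2 * r) by ring.
  by lra.
apply: le_trans Hj _; apply: leeD.
  apply: ereal_sup_ubound; exists (fun=> 0); first exact: zero_Hclass.
  rewrite /Pf (_ : [seq _ | _ <- _] = nseq n 0)//.
  by elim: (n) (1%N) => //= k IH m; rewrite IH.
rewrite lee_fin.
have : expR S / (2 * eps * N%:R) <= eps / 2.
  rewrite ler_pdivrMr ?mulr_gt0//.
  have -> : eps / 2 * (2 * eps * N%:R) = eps ^+ 2 * N%:R by field.
  apply: le_trans (ler_wpM2r (ltW NR) HS).
  have -> : 4 * r * expR S * N%:R = expR S * (N%:R * (4 * r)) by ring.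
  by rewrite ler_peMr ?expR_ge0.
lra.
Qed.

End LowerBound.

(** * Upper and lower limits *)

Section Limits.
Context {R : realType}.
Implicit Types (u w : nat -> \bar R).

Lemma limn_esup_le u (a : \bar R) :
  (exists N : nat, forall n, (N <= n)%N -> (u n <= a)%E) -> (limn_esup u <= a)%E.
Proof.
move=> [N uN]; apply: (@le_trans _ _ (ereal_sup [set u n | n in [set n | (N <= n)%N]])).
  apply: ereal_inf_lbound; exists [set n | (N <= n)%N] => //; exact: nbhs_infty_ge.
by apply: ge_ereal_sup => _ [n Nn <-]; exact: uN.
Qed.

Lemma limn_einf_ge u (a : \bar R) :
  (exists N : nat, forall n, (N <= n)%N -> (a <= u n)%E) -> (a <= limn_einf u)%E.
Proof.
move=> [N uN]; rewrite -leeN2 -limn_esupN; apply: limn_esup_le; exists N => n Nn /=.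
by rewrite leeN2; exact: uN.
Qed.

Lemma limn_esup_lt u (a : \bar R) : (limn_esup u < a)%E ->
  exists N : nat, forall n, (N <= n)%N -> (u n <= a)%E.
Proof.
move=> /ereal_inf_lt[_ [A [N _ NA] <-] supA]; exists N => n Nn.
apply: le_trans (ltW supA); apply: ereal_sup_ubound; exists n => //.
exact: NA.
Qed.

End Limits.

(** For beta <= 2 the exponent g = 1 / (2 beta + 1) is at least 1/5, so kap <= 1/20 <= g/4. The
    bound ln n <= 2 sqrt n costs half of g, and n^(-g/2 + g/4) still vanishes. *)
Lemma eventually_mixture_small {R : realType} (beta kap e : R) : 0 < beta <= 2 ->
  0 <= kap <= 1 / 20 -> 0 < e -> exists N : nat, forall n, (N <= n)%N ->
  4 * (ln n%:R / n%:R) `^ (2 * beta + 1)^-1 * expR (kap * ln (n%:R : R)) <= e.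
Proof.
move=> /andP[b0 b2] /andP[k0 k1] e0.
have P0 : 0 < 2 * beta + 1 by lra.
pose g := (2 * beta + 1)^-1.
have g5 : 1 / 5 <= g by rewrite mul1r /g lef_pV2 ?posrE//; lra.
have g1 : g <= 1 by rewrite invf_le1//; lra.
have g4 : 0 < g / 4 by lra.
have [N1 H1] := eventually_powR_ge (8 / e) g4.
exists (maxn N1 1) => n; rewrite geq_max => /andP[/H1 {}H1 n0].
have n0R : 0 < n%:R :> R by rewrite ltr0n.
have n1R : 1 <= n%:R :> R by rewrite ler1n.
have rate : (ln n%:R / n%:R) `^ g <= 2 * n%:R `^ (- (g / 2)).
  apply: (@le_trans _ _ ((2 * n%:R `^ (- 2^-1)) `^ g)).
    apply: ge0_ler_powR; rewrite ?nnegrE.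
    - by lra.
    - exact: rate_ge0.
    - by rewrite mulr_ge0 ?powR_ge0.
    have nn : n%:R `^ 2^-1 = n%:R `^ (- 2^-1) * n%:R :> R.
      rewrite -[X in _ = _ * X]powRr1// -powRD ?(gt_eqF n0R) ?implybT//; congr (_ `^ _); lra.
    rewrite ler_pdivrMr// -mulrA -nn; exact: ln_le_2sqrt.
  rewrite powRM ?powR_ge0// -powRrM.
  have -> : - 2^-1 * g = - (g / 2) by lra.
  apply: ler_wpM2r; first exact: powR_ge0.
  by rewrite -[leRHS]powRr1// ler_powR// ler1n.
have kE : expR (kap * ln n%:R) = n%:R `^ kap :> R by rewrite /powR gt_eqF.
rewrite kE -/g.
have kg : n%:R `^ kap <= n%:R `^ (g / 4) :> R by rewrite ler_powR//; lra.
apply: (@le_trans _ _ (4 * (2 * n%:R `^ (- (g / 2))) * n%:R `^ (g / 4))).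
  apply: ler_pM; rewrite ?mulr_ge0 ?powR_ge0//.
  by rewrite ler_pM2l.
have E : n%:R `^ (- (g / 2)) * n%:R `^ (g / 4) * n%:R `^ (g / 4) = 1 :> R.
  rewrite -!powRD ?(gt_eqF n0R) ?implybT//.
  by rewrite (_ : _ + _ = 0) ?powRr0//; lra.
have q0 : 0 < n%:R `^ (g / 4) :> R by rewrite powR_gt0.
rewrite -(ler_pM2r q0).
have -> : 4 * (2 * n%:R `^ (- (g / 2))) * n%:R `^ (g / 4) * n%:R `^ (g / 4) = 8 :> R.
  transitivity (8 * (n%:R `^ (- (g / 2)) * n%:R `^ (g / 4) * n%:R `^ (g / 4)) : R).
    by ring.
  by rewrite E mulr1.
by rewrite mulrC -ler_pdivrMr.
Qed.

Unset Implicit Arguments.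

Theorem mainTheorem2 (R : realType) (beta L sigma : R) (K : R -> R)
  (Kmin Kmax Delta LK lambda0 alpha : R) :
  0 < beta <= 2 -> 0 < L -> 0 < sigma ->
  kernel_assumptions K Kmin Kmax Delta LK ->
  0 < alpha < 1 ->
  let s := Setting beta L sigma K Kmax LK lambda0 alpha in
  0 < lambda0 ->
  (* lambda0 bounds from below the smallest eigenvalue of B_{nx}
     (bandwidth h_n) for all x in [0,1] and all large n *)
  (exists N : nat, forall n : nat, (N <= n)%N -> forall x : R, in01 x ->
     forall a : R, eigenvalue (Bmat s n (hn s n) x) a -> lambda0 <= a) ->
  exists c C : R, 0 < c < C /\
  (* (i) *)
  ((1 - alpha)%:E <=
     limn_einf (fun n : nat => ereal_inf
       [set Pf sigma n f (FOMT_prob s n) | f in Fclass beta L (C * Delta_rate beta n)]))%E /\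
  (* (ii) *)
  (forall Psi : nat -> seq R -> bool,
     (forall n : nat, measurable_test n (Psi n)) ->
     (limn_esup (fun n : nat => ereal_sup
        [set Pf sigma n f (fun ys => (Psi n ys)%:R) | f in Hclass beta L]) <= alpha%:E)%E ->
     (limn_esup (fun n : nat => ereal_inf
        [set Pf sigma n f (fun ys => (Psi n ys)%:R) | f in Fclass beta L (c * Delta_rate beta n)])
        <= alpha%:E)%E).
Proof.
move=> beta02 L_gt0 sigma_gt0 Kas alpha01 s lambda0_gt0 [N0 eig].
have Kas' : kernel_assumptions (s_K s) Kmin (s_Kmax s) Delta (s_LK s) by [].
have A0 := violation_const_ge0 (s := s) beta02 L_gt0 sigma_gt0 Kas' lambda0_gt0.
pose C := drop_const s * Ch s `^ smooth_exp s.
have C0 : 0 < C.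
  apply: mulr_gt0; last first.
    by apply: powR_gt0; exact: (Ch_gt0 (s := s) beta02 L_gt0 sigma_gt0 Kas').
  by rewrite /drop_const; move: A0; rewrite -/s /= => A0; have : 0 < s_L s := L_gt0; lra.
(* L/8 keeps the bumps in the Hölder class, sigma/8 gives 3 c^2 / sigma^2 <= 3/64 < 1/20 for
   [eventually_mixture_small], and C/2 yields c < C. *)
pose c := Num.min (Num.min (L / 8) (sigma / 8)) (C / 2).
have c0 : 0 < c.
  rewrite !lt_min; apply/andP; split; [apply/andP; split|].
  - by move: L_gt0; clear; lra.
  - by move: sigma_gt0; clear; lra.
  - by rewrite divr_gt0.
have cC : c <= C / 2 by rewrite ge_min lexx orbT.
have cL : 8 * c <= L.
  have : c <= L / 8 by rewrite !ge_min lexx.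
  by lra.
have csigma : c <= sigma / 8 by rewrite !ge_min lexx orbT.
exists c, C; split; first by rewrite c0/=; lra.
split.
  apply: limn_einf_ge.
  have [N1 HN1] := eventually_large_n (s := s) beta02 L_gt0 sigma_gt0 Kas' alpha01 lambda0_gt0.
  exists (maxn N0 N1) => n; rewrite geq_max => /andP[nN0 nN1].
  apply: le_ereal_inf_tmp => _ [f fF <-].
  exact: (FOMT_power (s := s) beta02 L_gt0 sigma_gt0 Kas' alpha01 lambda0_gt0 (HN1 n nN1)
    (eig n nN0) fF).
move=> Psi mPsi level.
have /andP[b0 b2] := beta02.
have P0 : 0 < 2 * beta + 1 by lra.
have g01 : 0 < (2 * beta + 1)^-1 < 1 by rewrite invr_gt0 P0 invf_lt1//; lra.
(* Half of the slack [e] makes the asymptotic level a bound valid for large n; the other half is the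
   error in [minimax_lower]. *)
apply/lee_addgt0Pr => e e0.
have e2 : 0 < e / 2 by rewrite divr_gt0.
have [N1 HN1] : exists N : nat, forall n, (N <= n)%N -> (ereal_sup
    [set Pf sigma n f (fun ys => (Psi n ys)%:R) | f in Hclass beta L] <= (alpha + e / 2)%:E)%E.
  apply: limn_esup_lt; apply: le_lt_trans level _.
  by rewrite lte_fin ltrDl.
pose kap := 3 * c ^+ 2 / sigma ^+ 2.
have kap20 : 0 <= kap <= 1 / 20.
  have sq0 : 0 < sigma ^+ 2 by rewrite exprn_gt0.
  have csq : c ^+ 2 <= (sigma / 8) ^+ 2.
    by rewrite ler_pXn2r ?nnegrE//; [exact: ltW|apply: divr_ge0 => //; exact: ltW].
  apply/andP; split.
    by apply: divr_ge0; [apply: mulr_ge0 => //; exact: sqr_ge0|exact: ltW].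
  by rewrite /kap ler_pdivrMr//; move: csq sq0; rewrite expr_div_n; clear; lra.
have e22 : 0 < (e / 2) ^+ 2 by rewrite exprn_gt0.
have [N2 HN2] := eventually_mixture_small beta02 kap20 e22.
have [N3 HN3] := eventually_n_rate_ge 1 g01.
have q4 : 0 < 1 / 4 :> R by lra.
have [N4 HN4] := eventually_rate_le (proj1 (andP g01)) q4.
have [N5 HN5] := eventually_ln_ge (1 : R).
apply: limn_esup_le; exists (maxn (maxn (maxn N1 N2) (maxn N3 N4)) (maxn N5 1)) => n.
rewrite !geq_max => /andP[/andP[/andP[/HN1 {}HN1 /HN2 {}HN2] /andP[/HN3 {}HN3 /HN4 {}HN4]]
  /andP[/HN5 {}HN5 n1]].
set r := (ln n%:R / n%:R) `^ _ in HN2 HN3 HN4.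
have n0R : 0 < n%:R :> R by rewrite ltr0n.
have rate0 : 0 < ln n%:R / n%:R :> R by rewrite divr_gt0//; lra.
have r0 : 0 < r by rewrite powR_gt0.
(* This identity makes the exponent in [minimax_lower] equal to kap ln n. *)
have rP : n%:R * r `^ (2 * beta + 1) = ln n%:R.
  rewrite /r -powRrM mulVf ?gt_eqF// powRr1 ?(ltW rate0)// mulrC divfK// gt_eqF//.
have DE : Delta_rate beta n = r `^ (if beta <= 1 then beta else beta - 1).
  have expE : beta - (Num.ceil beta)%:~R + 1 = if beta <= 1 then beta else beta - 1.
    have [b1|b1] := leP beta 1.
      exact: (smooth_exp_le1 (s := s) beta02 b1).
    exact: (smooth_exp_gt1 (s := s) beta02 b1).
  by rewrite /Delta_rate expE /r -powRrM [(2 * beta + 1)^-1 * _]mulrC.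
rewrite DE.
apply: le_trans (minimax_lower (eps := e / 2) beta02 c0 cL r0 n1 HN3 sigma_gt0 e2 HN4 _ (mPsi n)) _.
  rewrite rP (_ : _ / sigma ^+ 2 = kap * ln n%:R)//.
  by rewrite /kap mulrAC.
apply: le_trans (leeD2r _ HN1) _.
by rewrite -!EFinD lee_fin; lra.
Qed.
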